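(* Let $\rho$ be a positive semidefinite operator on $L^2(\mathbb{R}^n)$ with integral kernel $K_\rho$ (so $(\rho\phi)(x)=\int K_\rho(x,y)\phi(y)\,dy$), whose Wigner function $$W_\rho(x,p)=\frac{1}{(2\pi)^n}\int_{\mathbb{R}^n} e^{ip\cdot y}\,K_\rho(x-y/2,\,x+y/2)\,dy,\qquad (x,p)\in\mathbb{R}^{2n},$$ exists and is rapidly decaying. Then $W_\rho$ is a Schwartz function on $\mathbb{R}^{2n}$.
   Context: For a function $F:\mathbb{R}^m\to\mathbb{C}$ and multi-indices $a,b\in(\mathbb{N}\cup\{0\})^m$, the seminorm is $|F|_{a,b}:=\sup_{z\in\mathbb{R}^m}|z^a\partial_z^bF(z)|$, and $|F|_a:=|F|_{a,0}$. $F$ is called rapidly decaying if $|F|_a<\infty$ for all $a$, and a Schwartz function if $|F|_{a,b}<\infty$ for all $a,b$. Points of $\mathbb{R}^{2n}$ are written $(x,p)$ with $x,p\in\mathbb{R}^n$.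
   Formalization: The kernel is determined only up to null sets, so existence and rapid decay of the Wigner function are required almost everywhere, and the conclusion is that it agrees almost everywhere with a Schwartz function; pointwise the claim fails when the kernel is altered on a null set. *)

(* Defs.v *)
From HB Require Import structures.
From mathcomp Require Import all_boot all_order all_algebra.
From mathcomp Require Import all_classical all_reals all_analysis.
From mathcomp Require Import complex.
Import Order.TTheory GRing.Theory Num.Theory.
Import numFieldNormedType.Exports.
Set Implicit Arguments.
Unset Strict Implicit.
Local Open Scope classical_set_scope.
Local Open Scope ring_scope.
Section PSF.
Local Open Scope ereal_scope.
Context d1 d2 (T1 : measurableType d1) (T2 : measurableType d2) (R : realType).
Variable m1 : {sigma_finite_measure set T1 -> \bar R}.
Variable m2 : {sigma_finite_measure set T2 -> \bar R}.
Definition pmeas := (m1 \x m2).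
HB.instance Definition _ := Measure.on pmeas.
Lemma pmeas_sigma_finite : sigma_finite setT pmeas.
Proof.
have /sigma_finiteP[F [TF ndF Foo]] := sigma_finiteT m1.
have /sigma_finiteP[G [TG ndG Goo]] := sigma_finiteT m2.
exists (fun n => F n `*` G n).
 rewrite -setXTT TF TG predeqE => -[x y]; split.
    move=> [/= [n _ Fnx] [k _ Gky]]; exists (maxn n k) => //; split.
    - by move: x Fnx; exact/subsetPset/ndF/leq_maxl.
    - by move: y Gky; exact/subsetPset/ndG/leq_maxr.
  by move=> [n _ []/= ? ?]; split; exists n.
move=> k; have [? ?] := Foo k; have [? ?] := Goo k.
split; first exact: measurableX.
by rewrite /pmeas product_measure1E// lte_mul_pinfty// ge0_fin_numE.
Qed.
HB.instance Definition _ := Measure_isSigmaFinite.Build _ _ _ pmeas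
  pmeas_sigma_finite.
End PSF.

Record msp (R : realType) := MSp {
  msp_d : measure_display;
  msp_T : measurableType msp_d;
  msp_mu : {sigma_finite_measure set msp_T -> \bar R} }.

(* The measure space R^n, built as R * (R * ( ... * unit)) with the iterated
   product of Lebesgue measures (the n-dimensional Lebesgue measure on the
   Borel/product sigma-algebra). *)
Fixpoint Rsp (R : realType) (n : nat) : msp R :=
  match n with
  | 0 => @MSp R _ unit (@dirac _ unit tt R)
  | S m => @MSp R _ (measurableTypeR R * msp_T (Rsp R m))%type
             (pmeas (@lebesgue_measure R) (msp_mu (Rsp R m)))
  end.

Fixpoint coordn (R : realType) (n : nat) : msp_T (Rsp R n) -> nat -> R :=
  match n return msp_T (Rsp R n) -> nat -> R with
  | 0 => fun _ _ => 0
  | S m => fun x k => match k with 0 => x.1 | S k' => @coordn R m x.2 k' end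
  end.

Section Wigner.
Variable R : realType.
Local Open Scope complex_scope.

Definition Rn (n : nat) := msp_T (Rsp R n).
Definition lebn (n : nat) : {sigma_finite_measure set Rn n -> \bar R} :=
  msp_mu (Rsp R n).
Definition vec (n : nat) (x : Rn n) : 'rV[R]_n := \row_(i < n) coordn x i.

Definition cabs (z : R[i]) : R := Num.sqrt (complex.Re z ^+ 2 + complex.Im z ^+ 2).

Definition cmeasurable (n : nat) (f : 'rV[R]_n -> R[i]) : Prop :=
  measurable_fun setT (fun x : Rn n => complex.Re (f (vec x))) /\
  measurable_fun setT (fun x : Rn n => complex.Im (f (vec x))).

Definition cintegrable (n : nat) (f : 'rV[R]_n -> R[i]) : Prop :=
  (lebn n).-integrable setT (fun x => (complex.Re (f (vec x)))%:E) /\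
  (lebn n).-integrable setT (fun x => (complex.Im (f (vec x)))%:E).

Definition cint (n : nat) (f : 'rV[R]_n -> R[i]) : R[i] :=
  (Rintegral (lebn n) setT (fun x => complex.Re (f (vec x)))) +i*
  (Rintegral (lebn n) setT (fun x => complex.Im (f (vec x)))).

Definition L2 (n : nat) (f : 'rV[R]_n -> R[i]) : Prop :=
  cmeasurable f /\
  (lebn n).-integrable setT (fun x => ((cabs (f (vec x))) ^+ 2)%:E).

Definition kop (n : nat) (K : 'rV[R]_n -> 'rV[R]_n -> R[i])
  (phi : 'rV[R]_n -> R[i]) : 'rV[R]_n -> R[i] :=
  fun x => cint (fun y => K x y * phi y).

Definition kmeasurable (n : nat) (K : 'rV[R]_n -> 'rV[R]_n -> R[i]) : Prop :=
  measurable_fun setT (fun xy : Rn n * Rn n => complex.Re (K (vec xy.1) (vec xy.2))) /\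
  measurable_fun setT (fun xy : Rn n * Rn n => complex.Im (K (vec xy.1) (vec xy.2))).

(* K is the integral kernel of an (everywhere defined) operator
   rho : L^2(R^n) -> L^2(R^n), and rho is positive semidefinite:
   <phi, rho phi> = \int conj(phi x) (rho phi)(x) dx >= 0 (in particular real)
   for every phi in L^2(R^n). *)
Definition psd_kernel (n : nat) (K : 'rV[R]_n -> 'rV[R]_n -> R[i]) : Prop :=
  kmeasurable K /\
  forall phi : 'rV[R]_n -> R[i], L2 phi ->
    [/\ {ae lebn n, forall x : Rn n, cintegrable (fun y => K (vec x) y * phi y)},
        L2 (kop K phi) &
        0 <= cint (fun x => (phi x)^* * kop K phi x)].

Definition xpart (n : nat) (z : 'rV[R]_(n + n)) : 'rV[R]_n := lsubmx z.
Definition ppart (n : nat) (z : 'rV[R]_(n + n)) : 'rV[R]_n := rsubmx z.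

Definition dotn (n : nat) (p y : 'rV[R]_n) : R := \sum_(i < n) p 0 i * y 0 i.

Definition expi (t : R) : R[i] := cos t +i* sin t.

Definition wigner_integrand (n : nat) (K : 'rV[R]_n -> 'rV[R]_n -> R[i])
  (z : 'rV[R]_(n + n)) : 'rV[R]_n -> R[i] :=
  fun y => expi (dotn (ppart z) y) *
           K (xpart z - 2^-1 *: y) (xpart z + 2^-1 *: y).

Definition wigner (n : nat) (K : 'rV[R]_n -> 'rV[R]_n -> R[i])
  (z : 'rV[R]_(n + n)) : R[i] :=
  ((2 * pi) ^- n)%:C * cint (wigner_integrand K z).

Definition monom (m : nat) (a : 'I_m -> nat) (z : 'rV[R]_m) : R :=
  \prod_(i < m) z 0 i ^+ a i.

Definition ei (m : nat) (i : 'I_m) : 'rV[R]_m := delta_mx 0 i.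
Definition cderivable (m : nat) (i : 'I_m) (F : 'rV[R]_m -> R[i]) : Prop :=
  forall z, derivable (fun w => complex.Re (F w)) z (ei i) /\
            derivable (fun w => complex.Im (F w)) z (ei i).
Definition cpartial (m : nat) (i : 'I_m) (F : 'rV[R]_m -> R[i]) :
  'rV[R]_m -> R[i] :=
  fun z => ('D_(ei i) (fun w => complex.Re (F w)) z) +i* ('D_(ei i) (fun w => complex.Im (F w)) z).
Definition cdiff (m : nat) (s : seq 'I_m) (F : 'rV[R]_m -> R[i]) :
  'rV[R]_m -> R[i] := foldr (@cpartial m) F s.

Definition csmooth (m : nat) (F : 'rV[R]_m -> R[i]) : Prop :=
  forall (s : seq 'I_m) (i : 'I_m), cderivable i (cdiff s F).

(* |F|_{a,b} = sup_z |z^a d^b F(z)| < oo; the multi-index b is encoded by a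
   sequence s of coordinates (b_i = number of occurrences of i in s) *)
Definition seminorm_finite (m : nat) (F : 'rV[R]_m -> R[i])
  (a : 'I_m -> nat) (s : seq 'I_m) : Prop :=
  exists C : R, forall z, cabs ((monom a z)%:C * cdiff s F z) <= C.

Definition schwartz (m : nat) (F : 'rV[R]_m -> R[i]) : Prop :=
  csmooth F /\ forall a s, seminorm_finite F a s.

Definition rapidly_decaying_ae (m : nat) (F : 'rV[R]_m -> R[i]) : Prop :=
  forall a : 'I_m -> nat, exists C : R,
    {ae lebn m, forall z : Rn m, cabs ((monom a (vec z))%:C * F (vec z)) <= C}.

End Wigner.

(* Main.v *)
(* Write [<f, rho g>] for the positive form of the kernel.  For Gaussian wave
   packets [coh z] centred at points [z] of phase space, [<coh z, rho coh z>] is a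
   Gaussian average of the Wigner function [W] near [z], hence decays rapidly.  By
   the Cauchy-Schwarz inequality for the positive form,
     |<coh z, rho coh (z + d)>|^2 <= <coh z, rho coh z> <coh (z + d), rho coh (z + d)>,
   so the left-hand side decays rapidly in both [z] and [d].  With a suitable phase,
   its integral over [z] is a positive multiple of the (symplectic) Fourier transform
   of [W] at [d].  Thus the Fourier transform of [W] decays rapidly and, by Fourier
   inversion, [W] agrees almost everywhere with a smooth function all of whose
   derivatives are bounded.  This function decays rapidly, and interpolation between
   its decay and the bounds on its second derivatives makes its derivatives decay
   rapidly as well.

   The passage from [W] back to the form uses that, for almost every [X], the kernel
   [K (X - Y/2) (X + Y/2)] is the inverse Fourier transform of [W (X, -)]; in
   particular [K] is essentially bounded. *)
Require Import Defs.
From HB Require Import structures.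
From mathcomp Require Import all_boot all_order all_algebra.
From mathcomp Require Import all_classical all_reals all_analysis.
From mathcomp Require Import complex.
From mathcomp Require Import measurable_realfun ring lra.
Import Order.TTheory GRing.Theory Num.Theory.
Import numFieldNormedType.Exports.
Local Open Scope classical_set_scope.
Local Open Scope ring_scope.
Set Implicit Arguments.
Unset Strict Implicit.
Unset Printing Implicit Defensive.

(** Integrability and decay are assumed only off null sets. So [W] is first replaced by a
    representative [W0] that decays at every point, and almost-everywhere identities are carried
    between coordinate systems by measure-preserving maps. The obstacle is that positivity concerns
    the iterated integral [<f, rho f>], whereas expanding it and inserting the Wigner function call
    for an absolutely convergent double integral. The essential bound on [K] supplies this, as wave
    packets are integrable. Inversion is thus used twice, on R^n for the sections of [K] and on
    R^(n+n) for [W0], each time for an integrable function with integrable transform. Gaussian means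
    of such a function converge at every point, by dominated convergence on the transform side; the
    limit is identified by testing against continuous functions. Gaussian packets are chosen because
    the product of two of them factors in midpoint coordinates, which turns the form into an
    explicit windowed Fourier transform of [W0]. Positivity enters only through pairs of packets, so
    no square root or spectral decomposition of [rho] appears. *)

Notation cre := complex.Re.
Notation cim := complex.Im.

(** * Complex numbers through real and imaginary parts *)

Section ComplexNumbers.
Variable R : realType.
Implicit Types (x y z : R[i]) (t s : R).
Local Open Scope complex_scope.

Lemma eq_cplx x y : cre x = cre y -> cim x = cim y -> x = y.
Proof. by case: x y => [a b] [c d] /= -> ->. Qed.

Lemma creM x y : cre (x * y) = cre x * cre y - cim x * cim y.
Proof. by case: x y => [a b] [c d]. Qed.
Lemma cimM x y : cim (x * y) = cre x * cim y + cim x * cre y.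
Proof. by case: x y => [a b] [c d]. Qed.
Lemma creD x y : cre (x + y) = cre x + cre y.
Proof. by case: x y => [a b] [c d]. Qed.
Lemma cimD x y : cim (x + y) = cim x + cim y.
Proof. by case: x y => [a b] [c d]. Qed.
Lemma creN x : cre (- x) = - cre x. Proof. by case: x. Qed.
Lemma cimN x : cim (- x) = - cim x. Proof. by case: x. Qed.
Lemma creC t : cre t%:C = t. Proof. by []. Qed.
Lemma cimC t : cim t%:C = 0. Proof. by []. Qed.
Lemma creJ x : cre (x^*) = cre x. Proof. by case: x. Qed.
Lemma cimJ x : cim (x^*) = - cim x. Proof. by case: x. Qed.

Definition cE := (creM, cimM, creD, cimD, creN, cimN, creC, cimC, creJ, cimJ).

Lemma cabs_ge0 z : 0 <= cabs z. Proof. exact: sqrtr_ge0. Qed.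

Lemma sqr_cabs z : cabs z ^+ 2 = cre z ^+ 2 + cim z ^+ 2.
Proof. by rewrite sqr_sqrtr// addr_ge0// sqr_ge0. Qed.

Lemma cabs_le z t : 0 <= t -> cre z ^+ 2 + cim z ^+ 2 <= t ^+ 2 -> cabs z <= t.
Proof. by move=> t0; rewrite -sqr_cabs ler_sqr ?nnegrE ?cabs_ge0. Qed.

Lemma cabs_eq z t : 0 <= t -> cre z ^+ 2 + cim z ^+ 2 = t ^+ 2 -> cabs z = t.
Proof. by move=> t0 zt; rewrite /cabs zt sqrtr_sqr ger0_norm. Qed.

Lemma cabsM x y : cabs (x * y) = cabs x * cabs y.
Proof.
apply: cabs_eq; first by rewrite mulr_ge0 ?cabs_ge0.
rewrite exprMn !sqr_cabs !cE; ring.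
Qed.

Lemma cabsC t : cabs t%:C = `|t|.
Proof. by rewrite /cabs /= expr0n addr0 sqrtr_sqr. Qed.

Lemma cabsN z : cabs (- z) = cabs z.
Proof. by rewrite /cabs !cE !sqrrN. Qed.

Lemma cabsJ z : cabs (z^*) = cabs z.
Proof. by rewrite /cabs !cE !sqrrN. Qed.

Lemma cre_le z : `|cre z| <= cabs z.
Proof.
rewrite -ler_sqr ?nnegrE ?cabs_ge0// sqr_cabs real_normK ?num_real//.
by rewrite lerDl sqr_ge0.
Qed.

Lemma cim_le z : `|cim z| <= cabs z.
Proof.
rewrite -ler_sqr ?nnegrE ?cabs_ge0// sqr_cabs real_normK ?num_real//.
by rewrite lerDr sqr_ge0.
Qed.

Lemma cabs_le_reim z : cabs z <= `|cre z| + `|cim z|.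
Proof.
apply: cabs_le; first by rewrite addr_ge0.
rewrite sqrrD !real_normK ?num_real//.
by rewrite addrAC lerDl mulrn_wge0// mulr_ge0.
Qed.

Lemma mulcJ z : z * z^* = (cabs z ^+ 2)%:C.
Proof. by apply: eq_cplx; rewrite ?sqr_cabs !cE; ring. Qed.

Lemma cJM x y : (x * y)^*%C = x^*%C * y^*%C.
Proof. by apply: eq_cplx; rewrite !cE; ring. Qed.

Lemma cJC t : (t%:C)^*%C = t%:C.
Proof. by apply: eq_cplx; rewrite !cE ?oppr0. Qed.

Lemma cabsD x y : cabs (x + y) <= cabs x + cabs y.
Proof.
apply: cabs_le; first by rewrite addr_ge0 ?cabs_ge0.
have: cre (x * y^*) <= cabs x * cabs y.
  by rewrite -(cabsJ y) -cabsM (le_trans (ler_norm _)) ?cre_le.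
rewrite sqrrD !sqr_cabs !cE mulr2n; lra.
Qed.

Lemma cabsB x y : cabs (x - y) <= cabs x + cabs y.
Proof. by rewrite -(cabsN y) cabsD. Qed.

Lemma expi0 : expi (0 : R) = 1.
Proof. by rewrite /expi cos0 sin0. Qed.

Lemma expiD t s : expi (t + s) = expi t * expi s.
Proof. by apply: eq_cplx; rewrite ?cE /= ?cosD ?sinD; ring. Qed.

Lemma expiN t : expi (- t) = (expi t)^*%C.
Proof. by apply: eq_cplx; rewrite ?cE /= ?cosN ?sinN. Qed.

Lemma cabs_expi t : cabs (expi t) = 1.
Proof. by apply: cabs_eq => //=; rewrite cos2Dsin2 expr1n. Qed.

Lemma ge0_cplx z : 0 <= z -> 0 <= cre z /\ cim z = 0.
Proof. by case: z => a b; rewrite lecE /= => /andP[/eqP -> ->]. Qed.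

(* Testing with [c = 1] and [c = 'i] gives [b' = b^*], then [c = - t b^*] with
   [t] real gives a nonnegative quadratic polynomial in [t]. *)
Lemma psd_CS (p q b b' : R[i]) : 0 <= p -> 0 <= q ->
  (forall c, 0 <= p + c * b + c^* * b' + c * c^* * q) ->
  cabs b ^+ 2 <= cre p * cre q.
Proof.
case: p q b b' => [p p'] [q q'] [b1 b2] [d1 d2].
move=> /ge0_cplx[/= p0 ->] /ge0_cplx[/= q0 ->] H.
have Hc c1 c2 : c1 * (b2 + d2) + c2 * (b1 - d1) = 0.
  have /ge0_cplx[_] := H (c1 +i* c2); rewrite !cE /= => <-; ring.
have h1 : d2 = - b2 by have := Hc 1 0; lra.
have h2 : d1 = b1 by have := Hc 0 1; lra.
subst d1 d2; rewrite sqr_cabs /=.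
set B := b1 ^+ 2 + b2 ^+ 2.
have B0 : 0 <= B by rewrite addr_ge0 ?sqr_ge0.
have Hr c1 c2 : 0 <= p + 2 * (c1 * b1 - c2 * b2) + (c1 ^+ 2 + c2 ^+ 2) * q.
  have /ge0_cplx[+ _] := H (c1 +i* c2); rewrite !cE /=.
  by congr (_ <= _); ring.
have Ht t : 0 <= p - 2 * t * B + t ^+ 2 * B * q.
  by have := Hr (- t * b1) (t * b2); congr (_ <= _); rewrite /B; ring.
have [q00|q00] := eqVneq q 0.
  move: B0; rewrite le_eqVlt => /orP[/eqP <-|B0]; first by rewrite mulr_ge0.
  (* With [q = 0] the polynomial is [p - 2 t B], affine in [t]; this [t] gives it the value [-1]. *)
  have := Ht ((p + 1) / (2 * B)); rewrite q00 mulr0 addr0.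
  have -> : 2 * ((p + 1) / (2 * B)) * B = p + 1 by field; rewrite gt_eqF.
  by rewrite opprD addrA subrr sub0r ler0N1.
have qp : 0 < q by rewrite lt_def q00.
(* The quadratic in [t] attains its minimum at [1 / q]. *)
have := Ht q^-1.
have -> : p - 2 * q^-1 * B + q^-1 ^+ 2 * B * q = p - B / q by field.
by rewrite subr_ge0 ler_pdivrMr.
Qed.

End ComplexNumbers.

(** * Integration of complex-valued functions *)

Section ComplexMeasurable.
Context d (T : measurableType d) (R : realType).
Implicit Types (f g : T -> R[i]) (h : T -> R).
Local Open Scope complex_scope.

(** Over an arbitrary measurable space, so that functions on products are covered too;
    [cmeasurable f] is [cM] of [f] composed with [vec]. In the same way [cL1] and [cI] below
    generalize [cintegrable] and [cint]. *)
Definition cM f := measurable_fun setT (fun x => cre (f x)) /\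
                   measurable_fun setT (fun x => cim (f x)).

Lemma eq_cM f g : (forall x, f x = g x) -> cM f -> cM g.
Proof. by move=> fg; rewrite (_ : f = g)//; exact/funext. Qed.

Lemma cM_cst (c : R[i]) : cM (fun=> c).
Proof. by split; exact: measurable_cst. Qed.

Lemma cMM f g : cM f -> cM g -> cM (fun x => f x * g x).
Proof.
move=> [f1 f2] [g1 g2]; split.
  under eq_fun do rewrite creM.
  by apply: measurable_funB; apply: measurable_funM.
under eq_fun do rewrite cimM.
by apply: measurable_funD; apply: measurable_funM.
Qed.

Lemma cMD f g : cM f -> cM g -> cM (fun x => f x + g x).
Proof.
move=> [f1 f2] [g1 g2]; split.
  by under eq_fun do rewrite creD; apply: measurable_funD.
by under eq_fun do rewrite cimD; apply: measurable_funD.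
Qed.

Lemma cMJ f : cM f -> cM (fun x => (f x)^*).
Proof.
move=> [f1 f2]; split; first by under eq_fun do rewrite creJ.
by under eq_fun do rewrite cimJ; apply: measurableT_comp.
Qed.

Lemma cMC h : measurable_fun setT h -> cM (fun x => (h x)%:C).
Proof. by move=> hM; split => //; exact: measurable_cst. Qed.

Lemma cM_expi h : measurable_fun setT h -> cM (fun x => expi (h x)).
Proof.
move=> hM; split; apply: measurableT_comp => //.
  by apply: continuous_measurable_fun => x; exact: continuous_cos.
by apply: continuous_measurable_fun => x; exact: continuous_sin.
Qed.

Lemma measurable_cabs f : cM f -> measurable_fun setT (fun x => cabs (f x)).
Proof.
move=> [f1 f2]; rewrite /cabs.
apply: (measurableT_comp (continuous_measurable_fun (@sqrt_continuous R))).
by apply: measurable_funD; apply: measurable_funX.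
Qed.

End ComplexMeasurable.

Lemma cM_comp d1 d2 (T1 : measurableType d1) (T2 : measurableType d2)
  (R : realType) (f : T2 -> R[i]) (p : T1 -> T2) :
  measurable_fun setT p -> cM f -> cM (fun x => f (p x)).
Proof.
move=> mp [f1 f2]; split.
  exact: (measurableT_comp f1 mp).
exact: (measurableT_comp f2 mp).
Qed.

Section ComplexIntegral.
Context d (T : measurableType d) (R : realType).
Variable mu : {measure set T -> \bar R}.
Implicit Types (f g : T -> R[i]) (h : T -> R).
Local Open Scope complex_scope.

Definition rL1 h := mu.-integrable setT (fun x => (h x)%:E).

Definition cL1 f := rL1 (fun x => cre (f x)) /\ rL1 (fun x => cim (f x)).

Definition cI f : R[i] := (Rintegral mu setT (fun x => cre (f x))) +i*
  (Rintegral mu setT (fun x => cim (f x))).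

Lemma eq_cI f g : (forall x, f x = g x) -> cI f = cI g.
Proof. by move=> fg; congr cI; exact/funext. Qed.

Lemma eq_cL1 f g : (forall x, f x = g x) -> cL1 f -> cL1 g.
Proof. by move=> fg; rewrite (_ : f = g)//; exact/funext. Qed.

Lemma rL1_meas h : rL1 h -> measurable_fun setT h.
Proof. by move/measurable_int => /measurable_EFinP. Qed.

Lemma cL1_cM f : cL1 f -> cM f.
Proof. by case=> /rL1_meas ? /rL1_meas. Qed.

Lemma rL1_ae_le h (g : T -> R) : measurable_fun setT h -> rL1 g ->
  {ae mu, forall x, `|h x| <= g x} -> rL1 h.
Proof.
move=> mh /integrableP[mg ig] hg; apply/integrableP; split.
  exact/measurable_EFinP.
apply: le_lt_trans ig; apply: ae_ge0_le_integral => //.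
- exact/measurableT_comp/measurable_EFinP.
- exact: measurableT_comp.
- apply: filterS hg => x hgx _ /=; rewrite lee_fin.
  exact: le_trans hgx (ler_norm _).
Qed.

Lemma rL1_le h (g : T -> R) : measurable_fun setT h -> rL1 g ->
  (forall x, `|h x| <= g x) -> rL1 h.
Proof. by move=> mh ig hg; apply: rL1_ae_le ig _ => //; exact: aeW. Qed.

Lemma cL1_ae_le f (g : T -> R) : cM f -> rL1 g ->
  {ae mu, forall x, cabs (f x) <= g x} -> cL1 f.
Proof.
move=> [f1 f2] ig fg; split; apply: rL1_ae_le ig _ => //;
  apply: filterS fg => x; apply: le_trans.
- exact: cre_le.
- exact: cim_le.
Qed.

Lemma cL1_le f (g : T -> R) : cM f -> rL1 g ->
  (forall x, cabs (f x) <= g x) -> cL1 f.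
Proof. by move=> mf ig fg; apply: cL1_ae_le ig _ => //; exact: aeW. Qed.

Lemma rL1Z (c : R) h : rL1 h -> rL1 (fun x => c * h x).
Proof.
by move=> ih; apply: eq_integrable (integrableZl measurableT c ih) => // x _;
   rewrite EFinM.
Qed.

Lemma rL1D h (g : T -> R) : rL1 h -> rL1 g -> rL1 (fun x => h x + g x).
Proof.
by move=> ih ig; apply: eq_integrable (integrableD measurableT ih ig) => // x _;
   rewrite EFinD.
Qed.

Lemma cL1_cabs f : cL1 f -> rL1 (fun x => cabs (f x)).
Proof.
move=> [f1 f2].
have i1 : rL1 (fun x => `|cre (f x)|).
  by move/integrable_abse : f1; apply: eq_integrable.
have i2 : rL1 (fun x => `|cim (f x)|).
  by move/integrable_abse : f2; apply: eq_integrable.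
apply: (rL1_le _ (rL1D i1 i2)).
  by apply: measurable_cabs; exact: cL1_cM.
by move=> x; rewrite ger0_norm ?cabs_ge0// cabs_le_reim.
Qed.

Lemma cL1_bdM f g (M : R) : cM f -> (forall x, cabs (f x) <= M) -> cL1 g ->
  cL1 (fun x => f x * g x).
Proof.
move=> mf fM ig; apply: (cL1_le _ (rL1Z M (cL1_cabs ig))).
  by apply: cMM => //; exact: cL1_cM.
by move=> x; rewrite cabsM ler_wpM2r ?cabs_ge0.
Qed.

Lemma cL1Z (c : R[i]) f : cL1 f -> cL1 (fun x => c * f x).
Proof. by apply: (@cL1_bdM _ _ (cabs c)) => //; exact: cM_cst. Qed.

Lemma cL1D f g : cL1 f -> cL1 g -> cL1 (fun x => f x + g x).
Proof.
move=> fi gi; apply: (cL1_le _ (rL1D (cL1_cabs fi) (cL1_cabs gi))).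
  by apply: cMD; exact: cL1_cM.
by move=> x; exact: cabsD.
Qed.

Lemma cL1N f : cL1 f -> cL1 (fun x => - f x).
Proof.
by move=> fi; apply: eq_cL1 (cL1Z (-1) fi) => x; rewrite mulN1r.
Qed.

Lemma cL1C h : rL1 h -> cL1 (fun x => (h x)%:C).
Proof. by move=> ih; split => //=; exact: integrable0. Qed.

Lemma cID f g : cL1 f -> cL1 g -> cI (fun x => f x + g x) = cI f + cI g.
Proof.
move=> [f1 f2] [g1 g2]; apply: eq_cplx; rewrite ?cE /= -RintegralD//;
  by apply: eq_Rintegral => x _; rewrite cE.
Qed.

Lemma cIZ (c : R[i]) f : cL1 f -> cI (fun x => c * f x) = c * cI f.
Proof.
move=> [f1 f2].
have Zi (t : R) h : rL1 h -> mu.-integrable setT (EFin \o (fun x => t * h x)).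
  exact: rL1Z.
apply: eq_cplx; rewrite ?cE /= -!RintegralZl//.
  by rewrite -RintegralB// ?Zi//; apply: eq_Rintegral => x _; rewrite cE.
by rewrite -RintegralD// ?Zi//; apply: eq_Rintegral => x _; rewrite cE.
Qed.

Lemma cIZr (c : R[i]) f : cL1 f -> cI (fun x => f x * c) = cI f * c.
Proof. by move=> ?; rewrite mulrC -cIZ//; apply: eq_cI => x; rewrite mulrC. Qed.

Lemma cIN f : cL1 f -> cI (fun x => - f x) = - cI f.
Proof.
by move=> fi; rewrite -mulN1r -cIZ//; apply: eq_cI => x; rewrite mulN1r.
Qed.

Lemma cIB f g : cL1 f -> cL1 g -> cI (fun x => f x - g x) = cI f - cI g.
Proof. by move=> fi gi; rewrite cID ?cIN//; exact: cL1N. Qed.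

Lemma cIC h : cI (fun x => (h x)%:C) = (Rintegral mu setT h)%:C.
Proof.
by apply: eq_cplx => //=; rewrite /Rintegral integral0.
Qed.

Lemma ae_eq_Rintegral (h g : T -> R) : measurable_fun setT h ->
  measurable_fun setT g -> {ae mu, forall x, h x = g x} ->
  Rintegral mu setT h = Rintegral mu setT g.
Proof.
move=> mh mg hg; congr fine; apply: ae_eq_integral => //.
- exact/measurable_EFinP.
- exact/measurable_EFinP.
- by apply: filterS hg => x /= -> _.
Qed.

Lemma ae_eq_cI f g : cM f -> cM g -> {ae mu, forall x, f x = g x} ->
  cI f = cI g.
Proof.
move=> [f1 f2] [g1 g2] fg; apply: eq_cplx; apply: ae_eq_Rintegral => //;
  by apply: filterS fg => x ->.
Qed.

Lemma ae_eq_cL1 f g : cM g -> {ae mu, forall x, f x = g x} -> cL1 f -> cL1 g.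
Proof.
move=> mg fg fi; apply: (cL1_ae_le _ (cL1_cabs fi)) => //.
by apply: filterS fg => x ->.
Qed.

(* Multiply the integral [z] by [z^*]: [|z|^2 = int Re (z^* f) <= |z| int |f|]. *)
Lemma cabs_cI f : cL1 f -> cabs (cI f) <= Rintegral mu setT (fun x => cabs (f x)).
Proof.
move=> fi; set z := cI f.
have [z0|z0] := eqVneq (cabs z) 0.
  by rewrite z0; apply: Rintegral_ge0 => x _; exact: cabs_ge0.
have zp : 0 < cabs z by rewrite lt_def z0 cabs_ge0.
rewrite -(ler_pM2l zp) -expr2.
have -> : cabs z ^+ 2 = Rintegral mu setT (fun x => cre (z^* * f x)).
  have := congr1 (@complex.Re R) (cIZ (z^*) fi).
  by rewrite -/z (mulrC _ z) mulcJ creC /= => <-.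
rewrite -RintegralZl//; last exact: cL1_cabs.
apply: le_Rintegral => //.
- by have [] := cL1Z (z^*) fi.
- exact: (rL1Z _ (cL1_cabs fi)).
- move=> x _; rewrite -(cabsJ z) -cabsM.
  exact: le_trans (ler_norm _) (cre_le _).
Qed.

Lemma cabs_cI_le f (g : T -> R) : cM f -> rL1 g ->
  (forall x, cabs (f x) <= g x) -> cabs (cI f) <= Rintegral mu setT g.
Proof.
move=> mf ig fg; have fi := cL1_le mf ig fg.
apply: le_trans (cabs_cI fi) _; apply: le_Rintegral => //.
exact: cL1_cabs.
Qed.

Lemma rDCT (u : nat -> T -> R) h (g : T -> R) :
  (forall k, measurable_fun setT (u k)) -> measurable_fun setT h -> rL1 g ->
  (forall x, (fun k => u k x) @ \oo --> h x) ->
  (forall k x, `|u k x| <= g x) ->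
  (fun k => Rintegral mu setT (u k)) @ \oo --> Rintegral mu setT h.
Proof.
move=> mu_ mh ig uh ug.
have uE x : (fun k => (u k x)%:E) @ \oo --> (h x)%:E.
  by apply: cvg_EFin; [exact: nearW|exact: uh].
have [ih _ cv] := @dominated_convergence _ _ _ mu setT measurableT
  (fun k x => (u k x)%:E) (fun x => (h x)%:E) (fun x => (g x)%:E)
  (fun k => (measurable_EFinP _ _).2 (mu_ k)) ((measurable_EFinP _ _).2 mh)
  (aeW _ (fun x _ => uE x)) ig (aeW _ (fun x k _ => ug k x)).
apply: fine_cvg.
have -> // : (fine (\int[mu]_x (h x)%:E)%E)%:E = (\int[mu]_x (h x)%:E)%E.
by rewrite fineK//; exact: integrable_fin_num.
Qed.

End ComplexIntegral.

Section ComplexDCT.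
Context d (T : measurableType d) (R : realType).
Variable mu : {measure set T -> \bar R}.

Definition ccvg (u : nat -> R[i]) (l : R[i]) :=
  (fun k => cre (u k)) @ \oo --> cre l /\ (fun k => cim (u k)) @ \oo --> cim l.

Lemma ccvg_unique u l1 l2 : ccvg u l1 -> ccvg u l2 -> l1 = l2.
Proof.
move=> [r1 i1] [r2 i2]; apply: eq_cplx.
  exact: (cvg_unique _ r1 r2).
exact: (cvg_unique _ i1 i2).
Qed.

Lemma ccvg_cst l : ccvg (fun=> l) l.
Proof. by split; exact: cvg_cst. Qed.

Lemma ccvgM u v l m : ccvg u l -> ccvg v m -> ccvg (fun k => u k * v k) (l * m).
Proof.
move=> [r1 i1] [r2 i2]; split.
  rewrite creM; under eq_fun do rewrite creM.
  by apply: cvgB; apply: cvgM.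
rewrite cimM; under eq_fun do rewrite cimM.
by apply: cvgD; apply: cvgM.
Qed.

Lemma ccvgC (u : nat -> R) (l : R) :
  u @ \oo --> l -> ccvg (fun k => (u k)%:C%C) l%:C%C.
Proof. by move=> ul; split => //=; exact: cvg_cst. Qed.

Lemma ccvg_le u l M : ccvg u l -> (forall k, cabs (u k) <= M) -> cabs l <= M.
Proof.
move=> [ur ui] uM.
have M0 : 0 <= M := le_trans (cabs_ge0 (u 0%N)) (uM 0%N).
apply: cabs_le => //.
have cv : (fun k => cre (u k) ^+ 2 + cim (u k) ^+ 2) @ \oo -->
    cre l ^+ 2 + cim l ^+ 2 by apply: cvgD; rewrite expr2; apply: cvgM.
rewrite -(cvg_lim _ cv)//; apply: limr_le; first by apply/cvg_ex; eexists; exact: cv.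
by apply: nearW => k; rewrite -sqr_cabs ler_sqr ?nnegrE ?cabs_ge0.
Qed.

Lemma cDCT (u : nat -> T -> R[i]) f (g : T -> R) :
  (forall k, cM (u k)) -> cM f -> rL1 mu g ->
  (forall x, ccvg (fun k => u k x) (f x)) ->
  (forall k x, cabs (u k x) <= g x) ->
  ccvg (fun k => cI mu (u k)) (cI mu f).
Proof.
move=> mu_ [f1 f2] ig uf ug; split => /=.
  apply: (rDCT (g := g)) => // [k|x|k x]; first by have [] := mu_ k.
    by have [] := uf x.
  exact: le_trans (cre_le _) (ug _ _).
apply: (rDCT (g := g)) => // [k|x|k x]; first by have [] := mu_ k.
  by have [] := uf x.
exact: le_trans (cim_le _) (ug _ _).
Qed.

End ComplexDCT.

(** * Fubini's theorem and null sets for product measures *)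

Section Products.
Context d1 d2 (T1 : measurableType d1) (T2 : measurableType d2) (R : realType).
Variable m1 : {sigma_finite_measure set T1 -> \bar R}.
Variable m2 : {sigma_finite_measure set T2 -> \bar R}.
Local Notation pm := (pmeas m1 m2).

(** The extended integral of the sections is a difference of two Tonelli integrals, hence
    measurable, and [fine] keeps it so whatever default it returns. This covers integrands, such as
    that of the Wigner function, whose sections are integrable only almost everywhere. *)
Lemma measurable_Rintegral2 (h : T1 * T2 -> R) : measurable_fun setT h ->
  measurable_fun setT (fun x => Rintegral m2 setT (fun y => h (x, y))).
Proof.
move=> mh; apply: measurableT_comp => //.
pose f z := (h z)%:E.
have mf : measurable_fun setT f by exact/measurable_EFinP.
have -> : (fun x => \int[m2]_y (h (x, y))%:E)%E =
    (fubini_F m2 f^\+ \- fubini_F m2 f^\-)%E.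
  apply/funext=> x; rewrite [LHS](integralE _ _ (fun y => f (x, y))).
  under eq_integral do rewrite (funepos_comp f (fun y => (x, y)))/=.
  by under [X in (_ - X)%E = _]eq_integral do
    rewrite (funeneg_comp f (fun y => (x, y)))/=.
apply: emeasurable_funB.
  by apply: measurable_fun_fubini_tonelli_F; [exact: measurable_funepos|].
by apply: measurable_fun_fubini_tonelli_F; [exact: measurable_funeneg|].
Qed.

Lemma cM_cI2 (f : T1 * T2 -> R[i]) : cM f ->
  cM (fun x => cI m2 (fun y => f (x, y))).
Proof.
move=> [f1 f2]; split.
  exact: (measurable_Rintegral2 f1).
exact: (measurable_Rintegral2 f2).
Qed.

(** The inner real integral can differ from the extended one only where a section fails to be
    integrable, and this happens on a null set. *)
Lemma rFub1 (h : T1 * T2 -> R) : rL1 pm h -> Rintegral pm setT h =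
  Rintegral m1 setT (fun x => Rintegral m2 setT (fun y => h (x, y))).
Proof.
move=> ih; rewrite /Rintegral.
have -> : (\int[pm]_x (h x)%:E = \int[m1]_x \int[m2]_y (h (x, y))%:E)%E.
  by rewrite (integral12_prod_meas1 (f := fun z => (h z)%:E)).
congr fine; apply: ae_eq_integral => //.
- exact: (measurable_fubini_F (f := fun z => (h z)%:E) ih).
- by apply/measurable_EFinP; exact: (measurable_Rintegral2 (rL1_meas ih)).
- apply: filterS (ae_integrable1 ih) => x ix _ /=.
  by rewrite fineK//; exact: integrable_fin_num.
Qed.

Lemma rFub2 (h : T1 * T2 -> R) : rL1 pm h -> Rintegral pm setT h =
  Rintegral m2 setT (fun y => Rintegral m1 setT (fun x => h (x, y))).
Proof.
move=> ih; rewrite /Rintegral.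
have -> : (\int[pm]_x (h x)%:E = \int[m2]_y \int[m1]_x (h (x, y))%:E)%E.
  by rewrite (integral21_prod_meas1 (f := fun z => (h z)%:E)).
have mG := measurable_fubini_G (f := fun z => (h z)%:E) ih.
congr fine; apply: ae_eq_integral => //.
- by apply/measurable_EFinP; apply: measurableT_comp.
- apply: filterS (ae_integrable2 ih) => x ix _ /=.
  by rewrite fineK//; exact: integrable_fin_num.
Qed.

Lemma rL1_fub1 (h : T1 * T2 -> R) : rL1 pm h ->
  rL1 m1 (fun x => Rintegral m2 setT (fun y => h (x, y))).
Proof.
move=> ih; have iF := integrable_fubini_F ih.
have mF := rL1_meas ih; have mI := measurable_Rintegral2 mF.
have /integrableP[mG oo] := iF; apply/integrableP; split; first exact/measurable_EFinP.
apply: le_lt_trans oo; rewrite le_eqVlt; apply/orP; left; apply/eqP.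
apply: ae_eq_integral => //.
- by apply: measurableT_comp => //; exact/measurable_EFinP.
- exact: measurableT_comp.
apply: filterS (ae_integrable1 ih) => x ix _ /=.
by rewrite -abse_EFin fineK//; exact: integrable_fin_num.
Qed.

Lemma cFub1 (f : T1 * T2 -> R[i]) : cL1 pm f ->
  cI pm f = cI m1 (fun x => cI m2 (fun y => f (x, y))).
Proof.
move=> [f1 f2]; apply: eq_cplx.
  exact: (rFub1 f1).
exact: (rFub1 f2).
Qed.

Lemma cFub2 (f : T1 * T2 -> R[i]) : cL1 pm f ->
  cI pm f = cI m2 (fun y => cI m1 (fun x => f (x, y))).
Proof.
move=> [f1 f2]; apply: eq_cplx.
  exact: (rFub2 f1).
exact: (rFub2 f2).
Qed.

Lemma cL1_fub1 (f : T1 * T2 -> R[i]) : cL1 pm f ->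
  cL1 m1 (fun x => cI m2 (fun y => f (x, y))).
Proof.
move=> [f1 f2]; split.
  exact: (rL1_fub1 f1).
exact: (rL1_fub1 f2).
Qed.

Lemma rL1_prod (g : T1 -> R) (h : T2 -> R) : rL1 m1 g -> rL1 m2 h ->
  rL1 pm (fun z => g z.1 * h z.2).
Proof.
move=> ig ih.
have mg := rL1_meas ig; have mh := rL1_meas ih.
apply/integrable12ltyP.
  apply/measurable_EFinP; apply: measurable_funM.
    exact: (measurableT_comp mg).
  exact: (measurableT_comp mh).
have /integrableP[_ ig'] := ig; have /integrableP[_ ih'] := ih.
have h0 : (0 <= \int[m2]_y `|(h y)%:E|)%E by exact: integral_ge0.
rewrite (_ : (\int[_]_x _ = (\int[m1]_x `|(g x)%:E|) * \int[m2]_y `|(h y)%:E|)%E).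
  by apply: lte_mul_pinfty => //; rewrite ?integral_ge0// ge0_fin_numE// integral_ge0.
rewrite -ge0_integralZr//; last first.
  by apply: measurableT_comp => //; exact/measurable_EFinP.
apply: eq_integral => x _; rewrite -ge0_integralZl//; last first.
  by apply: measurableT_comp => //; exact/measurable_EFinP.
by apply: eq_integral => y _ /=; rewrite normrM EFinM.
Qed.

Lemma cL1_prod_le (f : T1 * T2 -> R[i]) (g : T1 -> R) (h : T2 -> R) : cM f ->
  rL1 m1 g -> rL1 m2 h -> (forall x y, cabs (f (x, y)) <= g x * h y) ->
  cL1 pm f.
Proof.
move=> mf ig ih fgh; apply: (cL1_le mf (rL1_prod ig ih)).
by move=> [x y]; exact: fgh.
Qed.

(** By Tonelli the measures of the sections of a null set have integral zero, so almost all of these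
    sections are null. *)
Lemma ae_sections (P : T1 * T2 -> Prop) : {ae pm, forall z, P z} ->
  {ae m1, forall x, {ae m2, forall y, P (x, y)}}.
Proof.
move=> [N [mN N0 PN]].
have mi : measurable_fun setT (fun z : T1 * T2 => (\1_N z)%:E : \bar R).
  exact/measurable_EFinP/measurable_indic.
have i0 : (\int[m1]_x \int[m2]_y (\1_N (x, y))%:E = 0)%E.
  rewrite -(fubini_tonelli1 (fun z => (\1_N z)%:E))//.
    by rewrite integral_indic// setIT.
have mF : measurable_fun setT (fun x => \int[m2]_y (\1_N (x, y))%:E)%E.
  by apply: (measurable_fun_fubini_tonelli_F (fun z => (\1_N z)%:E)).
have Hae : ae_eq m1 setT (fun x => \int[m2]_y (\1_N (x, y))%:E)%E (cst 0%E).
  apply/ae_eq_integral_abs => //; rewrite -[RHS]i0.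
  by apply: eq_integral => x _; rewrite gee0_abs// integral_ge0.
apply: filterS Hae => x /(_ I) /= Hx.
have mNx : measurable (xsection N x) by exact: measurable_xsection.
exists (xsection N x); split => //.
  rewrite -[RHS]Hx -[LHS]/(m2 _) -(setIT (xsection N x)) -integral_indic//.
  by apply: eq_integral => y _; rewrite !indicE mem_xsection.
move=> y /= nP; apply/mem_set/PN => //=; exact/mem_set.
Qed.

(** Tonelli for the indicator of the complement, whence the measurability of [A]; [measurable_ceq]
    supplies it when [A] is the set where two functions agree. *)
Lemma ae_of_sections (A : set (T1 * T2)) : measurable A ->
  {ae m1, forall x, {ae m2, forall y, A (x, y)}} -> {ae pm, forall z, A z}.
Proof.
move=> mA H; exists (~` A); split => //; first exact: measurableC.
have mC : measurable (~` A) by exact: measurableC.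
rewrite -(setIT (~` A)) -integral_indic//.
rewrite fubini_tonelli1//; last first.
  exact/measurable_EFinP/measurable_indic.
rewrite -[RHS](integral0 m1 setT); apply: ae_eq_integral => //.
  apply: (measurable_fun_fubini_tonelli_F (fun z => (\1_(~` A) z)%:E)) => //.
  exact/measurable_EFinP/measurable_indic.
apply: filterS H => x Hx _.
rewrite /fubini_F -[RHS](integral0 m2 setT); apply: ae_eq_integral => //.
  apply/measurable_EFinP.
  have mi : measurable_fun setT (\1_(~` A) : T1 * T2 -> R).
    exact: measurable_indic.
  exact: (measurableT_comp mi).
by apply: filterS Hx => y Axy _; rewrite indicE memNset// => /(_ Axy).
Qed.

Lemma measurable_ceq d (T : measurableType d) (f g : T -> R[i]) : cM f -> cM g ->
  measurable [set z | f z = g z].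
Proof.
move=> [f1 f2] [g1 g2].
have -> : [set z | f z = g z] = [set z | cre (f z) = cre (g z)] `&`
    [set z | cim (f z) = cim (g z)].
  apply/seteqP; split => z /=; first by move=> ->.
  by case=> ? ?; exact: eq_cplx.
have key (u v : T -> R) : measurable_fun setT u -> measurable_fun setT v ->
    measurable [set z | u z = v z].
  move=> mu mv; have := measurable_fun_eqr mu mv => /(_ measurableT [set true]).
  rewrite setTI (_ : _ @^-1` _ = [set z | u z = v z]); first exact.
  by apply/seteqP; split => z /= /eqP.
by apply: measurableI; exact: key.
Qed.

End Products.

(** * Measure-preserving maps *)

Section MeasurePreserving.
Context (R : realType).

(** Phrased with integrals of nonnegative functions rather than measures of preimages: compositions
    are then immediate, and products, shears and swaps reduce to Tonelli. *)
Definition mpres d1 d2 (T1 : measurableType d1) (T2 : measurableType d2)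
  (m1 : {measure set T1 -> \bar R}) (m2 : {measure set T2 -> \bar R})
  (p : T1 -> T2) := measurable_fun setT p /\
  forall f : T2 -> \bar R, measurable_fun setT f -> (forall y, 0 <= f y)%E ->
    (\int[m1]_x f (p x) = \int[m2]_y f y)%E.

Lemma mpres_comp d1 d2 d3 (T1 : measurableType d1) (T2 : measurableType d2)
  (T3 : measurableType d3) (m1 : {measure set T1 -> \bar R})
  (m2 : {measure set T2 -> \bar R}) (m3 : {measure set T3 -> \bar R}) p q :
  @mpres _ _ T1 T2 m1 m2 p -> @mpres _ _ T2 T3 m2 m3 q -> mpres m1 m3 (q \o p).
Proof.
move=> [mp Hp] [mq Hq]; split; first exact: measurableT_comp.
move=> f mf f0; rewrite -Hq//; apply: (Hp (f \o q)) => [|y]; last exact: f0.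
exact: measurableT_comp.
Qed.

Lemma mpres_inv d1 d2 (T1 : measurableType d1) (T2 : measurableType d2)
  (m1 : {measure set T1 -> \bar R}) (m2 : {measure set T2 -> \bar R})
  (p : T1 -> T2) (q : T2 -> T1) :
  mpres m1 m2 p -> measurable_fun setT q -> cancel p q -> mpres m2 m1 q.
Proof.
move=> [mp Hp] mq pq; split => // f mf f0.
rewrite -(Hp (f \o q)) => [|//|y]; last exact: f0.
  by apply: eq_integral => x _ /=; rewrite pq.
exact: measurableT_comp.
Qed.

Section OneMap.
Context d1 d2 (T1 : measurableType d1) (T2 : measurableType d2).
Variables (m1 : {measure set T1 -> \bar R}) (m2 : {measure set T2 -> \bar R}).
Variables (p : T1 -> T2) (Hp : mpres m1 m2 p).

Lemma mpres_integral (f : T2 -> \bar R) : measurable_fun setT f ->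
  (\int[m1]_x f (p x) = \int[m2]_y f y)%E.
Proof.
move=> mf; rewrite integralE [RHS]integralE; congr (_ - _)%E.
  rewrite -Hp.2//; last exact: measurable_funepos.
  by apply: eq_integral => x _; rewrite funepos_comp.
rewrite -Hp.2//; last exact: measurable_funeneg.
by apply: eq_integral => x _; rewrite funeneg_comp.
Qed.

Lemma mpres_rI (h : T2 -> R) : measurable_fun setT h ->
  Rintegral m1 setT (fun x => h (p x)) = Rintegral m2 setT h.
Proof.
move=> mh; congr fine; apply: (mpres_integral (f := fun x => (h x)%:E)).
exact/measurable_EFinP.
Qed.

Lemma mpres_cI (f : T2 -> R[i]) : cM f -> cI m1 (fun x => f (p x)) = cI m2 f.
Proof.
move=> [f1 f2]; apply: eq_cplx.
  exact: (mpres_rI f1).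
exact: (mpres_rI f2).
Qed.

Lemma mpres_rL1 (h : T2 -> R) : rL1 m2 h -> rL1 m1 (fun x => h (p x)).
Proof.
move=> ih; have mh := rL1_meas ih; apply/integrableP; split.
  by apply/measurable_EFinP; apply: (measurableT_comp mh); case: Hp.
have /integrableP[_] := ih; congr (_ < _)%E.
rewrite -(@mpres_integral (fun x => `|(h x)%:E|%E))//.
by apply: measurableT_comp => //; exact/measurable_EFinP.
Qed.

Lemma mpres_cL1 (f : T2 -> R[i]) : cL1 m2 f -> cL1 m1 (fun x => f (p x)).
Proof.
move=> [f1 f2]; split.
  exact: (mpres_rL1 f1).
exact: (mpres_rL1 f2).
Qed.

(** The preimage of a null set is null, by invariance of the integral of its indicator.
    Almost-everywhere statements pass through this lemma from one coordinate system to another. *)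
Lemma mpres_ae (P : T2 -> Prop) :
  {ae m2, forall y, P y} -> {ae m1, forall x, P (p x)}.
Proof.
move=> [N [mN N0 PN]].
have mpN : measurable (p @^-1` N) by rewrite -(setTI (_ @^-1` _)); apply: Hp.1.
exists (p @^-1` N); split => //; last by move=> x /= /PN.
rewrite -(setIT (p @^-1` N)) -integral_indic//.
rewrite (@mpres_integral (fun y => (\1_N y)%:E)).
  by rewrite integral_indic// setIT.
exact/measurable_EFinP/measurable_indic.
Qed.

End OneMap.

Lemma mpres_pair d1 d2 d3 d4 (T1 : measurableType d1) (T2 : measurableType d2)
  (T3 : measurableType d3) (T4 : measurableType d4)
  (m1 : {sigma_finite_measure set T1 -> \bar R})
  (m2 : {sigma_finite_measure set T2 -> \bar R})
  (m3 : {sigma_finite_measure set T3 -> \bar R})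
  (m4 : {sigma_finite_measure set T4 -> \bar R}) (p : T1 -> T3) (q : T2 -> T4) :
  mpres m1 m3 p -> mpres m2 m4 q ->
  mpres (pmeas m1 m2) (pmeas m3 m4) (fun z => (p z.1, q z.2)).
Proof.
move=> [mp Hp] [mq Hq].
have mpq : measurable_fun setT (fun z : T1 * T2 => (p z.1, q z.2)).
  by apply: measurable_fun_pair; apply: measurableT_comp.
split => // f mf f0.
rewrite fubini_tonelli1//; last exact: (measurableT_comp mf mpq).
rewrite /fubini_F /= [RHS]fubini_tonelli1//.
rewrite -(Hp (fubini_F m4 f)).
- apply: eq_integral => x _; apply: (Hq (fun y => f (p x, y))) => //.
  exact: measurableT_comp.
- exact: measurable_fun_fubini_tonelli_F.
- by move=> y; exact: integral_ge0.
Qed.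

Lemma mpres_assoc d1 d2 d3 (T1 : measurableType d1) (T2 : measurableType d2)
  (T3 : measurableType d3)
  (m1 : {sigma_finite_measure set T1 -> \bar R})
  (m2 : {sigma_finite_measure set T2 -> \bar R})
  (m3 : {sigma_finite_measure set T3 -> \bar R}) :
  mpres (pmeas m1 (pmeas m2 m3)) (pmeas (pmeas m1 m2) m3)
    (fun z => ((z.1, z.2.1), z.2.2)).
Proof.
have ma : measurable_fun setT
    (fun z : T1 * (T2 * T3) => ((z.1, z.2.1), z.2.2)).
  apply: measurable_fun_pair; last exact: measurableT_comp.
  by apply: measurable_fun_pair => //; exact: measurableT_comp.
split => // f mf f0.
rewrite fubini_tonelli1//; last exact: (measurableT_comp mf ma).
rewrite [RHS]fubini_tonelli1// [RHS]fubini_tonelli1//; first last.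
- by move=> y; exact: integral_ge0.
- exact: measurable_fun_fubini_tonelli_F.
apply: eq_integral => x _; rewrite /fubini_F /= [LHS]fubini_tonelli1//.
apply: measurableT_comp => //.
apply: measurable_fun_pair => //; apply: measurable_fun_pair => //.
Qed.

(** Tonelli with the moved variable innermost: for a fixed second variable only the invariance under
    [t y] is involved. *)
Lemma mpres_shear d1 d2 (T1 : measurableType d1) (T2 : measurableType d2)
  (m1 : {sigma_finite_measure set T1 -> \bar R})
  (m2 : {sigma_finite_measure set T2 -> \bar R}) (t : T2 -> T1 -> T1) :
  measurable_fun setT (fun z : T1 * T2 => t z.2 z.1) ->
  (forall y, mpres m1 m1 (t y)) ->
  mpres (pmeas m1 m2) (pmeas m1 m2) (fun z => (t z.2 z.1, z.2)).
Proof.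
move=> mt Ht.
have ms : measurable_fun setT (fun z : T1 * T2 => (t z.2 z.1, z.2)).
  exact: measurable_fun_pair.
split => // f mf f0.
rewrite fubini_tonelli2//; last exact: (measurableT_comp mf ms).
rewrite [RHS](fubini_tonelli2 f)//; apply: eq_integral => y _.
apply: ((Ht y).2 (fun x => f (x, y))) => //.
exact: measurableT_comp.
Qed.

Lemma mpres_swap d1 d2 (T1 : measurableType d1) (T2 : measurableType d2)
  (m1 : {sigma_finite_measure set T1 -> \bar R})
  (m2 : {sigma_finite_measure set T2 -> \bar R}) :
  mpres (pmeas m1 m2) (pmeas m2 m1) (fun z => (z.2, z.1)).
Proof.
have ms : measurable_fun setT (fun z : T1 * T2 => (z.2, z.1)).
  exact: measurable_fun_pair.
split => // f mf f0.
rewrite fubini_tonelli2//; last exact: (measurableT_comp mf ms).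
by rewrite [RHS]fubini_tonelli1.
Qed.

End MeasurePreserving.

(** * Coordinates and changes of variables in R^n *)

Section Coordinates.
Variable R : realType.

(** Coordinates are read from a function on [nat], which keeps the recursion free of casts between
    ordinal types. [unvec], built on it, is the inverse of [vec]: measures live on nested pairs,
    algebra on row vectors. *)
Fixpoint mkRn (n : nat) (v : nat -> R) : Rn R n :=
  match n return Rn R n with
  | 0 => tt
  | S m => (v 0%N, mkRn m (fun k => v k.+1))
  end.

Definition rvcoef n (v : 'rV[R]_n) (k : nat) : R :=
  if insub k is Some i then v 0 i else 0.

Definition unvec n (v : 'rV[R]_n) : Rn R n := mkRn n (rvcoef v).

Lemma rvcoefE n (v : 'rV[R]_n) (i : 'I_n) : rvcoef v i = v 0 i.
Proof. by rewrite /rvcoef valK. Qed.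

Lemma coordn_mkRn n v k : (k < n)%N -> coordn (mkRn n v) k = v k.
Proof.
by elim: n v k => [//|n IH] v [|k] //= kn; rewrite IH.
Qed.

Lemma vecE n (x : Rn R n) (i : 'I_n) : vec x 0 i = coordn x i.
Proof. by rewrite mxE. Qed.

Lemma unvecK n (v : 'rV[R]_n) : vec (unvec v) = v.
Proof. by apply/rowP => i; rewrite vecE coordn_mkRn// rvcoefE. Qed.

Lemma mkRn_ext n (v w : nat -> R) : (forall k, (k < n)%N -> v k = w k) ->
  mkRn n v = mkRn n w.
Proof.
elim: n v w => [//|n IH] v w vw /=.
by rewrite vw// (IH _ (fun k => w k.+1))// => k kn; exact: vw.
Qed.

Lemma mkRn_coordn n (x : Rn R n) : mkRn n (coordn x) = x.
Proof.
elim: n x => [[]//|n IH] [x1 x2]; congr pair; exact: IH.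
Qed.

Lemma vecK n (x : Rn R n) : unvec (vec x) = x.
Proof.
rewrite /unvec -[RHS]mkRn_coordn; apply: mkRn_ext => k kn.
by rewrite -[k]/(nat_of_ord (Ordinal kn)) rvcoefE vecE.
Qed.

Lemma measurable_coordn n k : measurable_fun setT (fun x : Rn R n => coordn x k).
Proof.
elim: n k => [|n IH] [|k] /=; do ?exact: measurable_cst.
  exact: measurable_fst.
exact: (measurableT_comp (IH k)).
Qed.

Section Maps.
Context d (T : measurableType d).

Lemma measurable_mkRn n (v : T -> nat -> R) :
  (forall k, (k < n)%N -> measurable_fun setT (fun t => v t k)) ->
  measurable_fun setT (fun t => mkRn n (v t)).
Proof.
elim: n v => [|n IH] v mv; first exact: measurable_cst.
apply: measurable_fun_pair; first exact: mv.
by apply: (IH (fun t k => v t k.+1)) => k kn; exact: mv.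
Qed.

(** The sigma-algebra is carried by [Rn], so measurability into row vectors is stated by
    coordinates; [vmeas_unvec] links the two. *)
Definition vmeas n (f : T -> 'rV[R]_n) :=
  forall i, measurable_fun setT (fun t => f t 0 i).

Lemma vmeas_unvec n (f : T -> 'rV[R]_n) : vmeas f ->
  measurable_fun setT (fun t => unvec (f t)).
Proof.
move=> mf; apply: measurable_mkRn => k kn.
have := mf (Ordinal kn); apply: eq_measurable_fun => t _.
by rewrite -(rvcoefE (f t) (Ordinal kn)).
Qed.

Lemma vmeas_comp n (f : T -> 'rV[R]_n) (h : 'rV[R]_n -> R) : vmeas f ->
  measurable_fun setT (fun x : Rn R n => h (vec x)) ->
  measurable_fun setT (fun t => h (f t)).
Proof.
move=> mf mh; have := measurableT_comp mh (vmeas_unvec mf).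
by apply: eq_measurable_fun => t _ /=; rewrite unvecK.
Qed.

Lemma vmeas_cM n (f : T -> 'rV[R]_n) (F : 'rV[R]_n -> R[i]) : vmeas f ->
  cmeasurable F -> cM (fun t => F (f t)).
Proof.
move=> mf [F1 F2]; split.
  exact: (vmeas_comp (h := fun v => cre (F v)) mf F1).
exact: (vmeas_comp (h := fun v => cim (F v)) mf F2).
Qed.

Lemma vmeasD n (f g : T -> 'rV[R]_n) : vmeas f -> vmeas g ->
  vmeas (fun t => f t + g t).
Proof.
move=> mf mg i; under eq_fun do rewrite mxE.
exact: measurable_funD.
Qed.

Lemma vmeasZ n (c : R) (f : T -> 'rV[R]_n) : vmeas f ->
  vmeas (fun t => c *: f t).
Proof.
move=> mf i; under eq_fun do rewrite mxE.
by apply: measurable_funM => //; exact: measurable_cst.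
Qed.

Lemma vmeasN n (f : T -> 'rV[R]_n) : vmeas f -> vmeas (fun t => - f t).
Proof.
move=> mf i; under eq_fun do rewrite mxE.
exact: measurable_funN.
Qed.

Lemma vmeasB n (f g : T -> 'rV[R]_n) : vmeas f -> vmeas g ->
  vmeas (fun t => f t - g t).
Proof. by move=> mf mg; apply: vmeasD => //; exact: vmeasN. Qed.

Lemma vmeas_cst n (a : 'rV[R]_n) : vmeas (fun=> a).
Proof. by move=> i; exact: measurable_cst. Qed.

Lemma vmeas_row n m (f : T -> 'rV[R]_n) (g : T -> 'rV[R]_m) :
  vmeas f -> vmeas g -> vmeas (fun t => row_mx (f t) (g t)).
Proof.
move=> mf mg i; case: (splitP i) => j ij.
  have -> : i = lshift m j by apply/val_inj.
  under eq_fun do rewrite row_mxEl.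
  exact: mf.
have -> : i = rshift n j by apply/val_inj.
under eq_fun do rewrite row_mxEr.
exact: mg.
Qed.

Lemma vmeas_lsub n m (f : T -> 'rV[R]_(n + m)) : vmeas f ->
  vmeas (fun t => lsubmx (f t)).
Proof.
move=> mf i; under eq_fun do rewrite mxE.
exact: mf.
Qed.

Lemma vmeas_rsub n m (f : T -> 'rV[R]_(n + m)) : vmeas f ->
  vmeas (fun t => rsubmx (f t)).
Proof.
move=> mf i; under eq_fun do rewrite mxE.
exact: mf.
Qed.

Lemma measurable_dotn n (f g : T -> 'rV[R]_n) : vmeas f -> vmeas g ->
  measurable_fun setT (fun t => dotn (f t) (g t)).
Proof.
move=> mf mg; apply: measurable_sum => i.
by apply: measurable_funM.
Qed.

Lemma vmeas_vec n (f : T -> Rn R n) : measurable_fun setT f ->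
  vmeas (fun t => vec (f t)).
Proof.
move=> mf i; under eq_fun do rewrite vecE.
exact: (measurableT_comp (measurable_coordn i)).
Qed.

End Maps.

Lemma vmeas_vec1 n : vmeas (fun x : Rn R n => vec x).
Proof. exact: vmeas_vec. Qed.

End Coordinates.

(** * Affine changes of variables and splitting of coordinates *)

Section AffineChange.
Variable R : realType.
Local Notation leb := (@lebesgue_measure R).

Lemma measurable_affine (c a : R) :
  measurable_fun setT (fun x : measurableTypeR R => c * x + a : measurableTypeR R).
Proof. by apply: measurable_funD => //; apply: measurable_funM. Qed.

(** Uniqueness of Lebesgue measure: [c] times its pushforward under [x |-> c * x + a] gives
    half-open intervals their length. *)
Lemma lebesgue_affine (c a : R) (f : R -> \bar R) : 0 < c ->
  measurable_fun setT f -> (forall x, 0 <= f x)%E ->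
  (\int[leb]_x f (c * x + a)%R = (c^-1)%:E * \int[leb]_x f x)%E.
Proof.
move=> c0 mf f0.
pose p (x : measurableTypeR R) : measurableTypeR R := c * x + a.
have mp : measurable_fun setT p by exact: measurable_affine.
pose k : {nonneg R} := NngNum (ltW c0).
pose pf : {measure set (measurableTypeR R) -> \bar R} :=
  measure_function_pushforward__canonical__measure_function_Measure leb mp.
pose nu : {measure set (measurableTypeR R) -> \bar R} := mscale k pf.
have E A : measurable A -> leb A = nu A.
  apply: lebesgue_measure_unique => _ [[u v] _ <-] /=.
  have -> : nu `]u, v]%classic = (c%:E * leb (p @^-1` `]u, v]))%E by [].
  have -> : p @^-1` `]u, v] = `](u - a) / c, (v - a) / c]%classic.
    apply/seteqP; split => x; rewrite /= !in_itv /= /p.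
      by rewrite ltr_pdivrMr// ler_pdivlMr// ltrBlDr lerBrDr mulrC.
    by rewrite ltr_pdivrMr// ler_pdivlMr// ltrBlDr lerBrDr mulrC.
  rewrite !lebesgue_measure_itv /= !lte_fin ltr_pM2r ?invr_gt0//.
  rewrite ltrD2r; case: ifP => _; last by rewrite mule0.
  by rewrite -!EFinB -EFinM; congr EFin; field; rewrite gt_eqF.
have -> : (\int[leb]_x f x = c%:E * \int[leb]_x f (p x))%E.
  rewrite (eq_measure_integral nu); last by move=> A mA _; exact: E.
  by rewrite ge0_integral_mscale// ge0_integral_pushforward.
by rewrite muleA -EFinM mulVf ?gt_eqF// mul1e.
Qed.

Lemma vec_affine n (c : R) (a : 'rV[R]_n.+1) (x : Rn R n.+1) :
  unvec (c *: vec x + a) = (c * x.1 + a 0 0,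
    unvec (c *: vec x.2 + \row_i a 0 (lift ord0 i))).
Proof.
rewrite /unvec /=; congr pair.
  by rewrite -[0%N]/(nat_of_ord (@ord0 n)) rvcoefE !mxE.
apply: mkRn_ext => k kn; rewrite -[k]/(nat_of_ord (Ordinal kn)).
rewrite -[(_ _).+1]/(nat_of_ord (lift ord0 (Ordinal kn))) !rvcoefE !mxE.
by congr (_ * _ + _).
Qed.

Lemma integral_lebnS n (f : Rn R n.+1 -> \bar R) : measurable_fun setT f ->
  (forall x, 0 <= f x)%E ->
  (\int[lebn R n.+1]_x f x = \int[leb]_x \int[lebn R n]_y f (x, y))%E.
Proof. by move=> mf f0; exact: (fubini_tonelli1 f). Qed.

Lemma integral_affine n (c : R) (a : 'rV[R]_n) (f : Rn R n -> \bar R) : 0 < c ->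
  measurable_fun setT f -> (forall x, 0 <= f x)%E ->
  (\int[lebn R n]_x f (unvec (c *: vec x + a)) =
   (c ^- n)%:E * \int[lebn R n]_x f x)%E.
Proof.
move=> c0; elim: n a f => [|n IH] a f mf f0.
  rewrite expr0 invr1 mul1e; apply: eq_integral => x _.
  by congr f; case: x; case: (unvec _).
have maf : measurable_fun setT (fun x : Rn R n.+1 =>
    f (unvec (c *: vec x + a))).
  apply: (measurableT_comp mf); apply: vmeas_unvec.
  by apply: vmeasD; [apply: vmeasZ; exact: vmeas_vec|exact: vmeas_cst].
rewrite [LHS]integral_lebnS// [X in (_ * X)%E]integral_lebnS//.
have mF := measurable_fun_fubini_tonelli_F (m2 := lebn R n) f mf f0.
transitivity (\int[leb]_x ((c ^- n)%:E * fubini_F (lebn R n) f (c * x + a 0 0)%R))%E.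
  apply: eq_integral => x _.
  under eq_integral do rewrite vec_affine /=.
  apply: (IH _ (fun y => f (c * x + a 0 0, y))) => //.
  exact: measurableT_comp.
have F0 x : (0 <= fubini_F (lebn R n) f x)%E by exact: integral_ge0.
have mFc := measurableT_comp mF (measurable_affine c (a 0 0)).
have cn : (0 <= (c ^- n)%:E)%E by rewrite lee_fin invr_ge0 exprn_ge0// ltW.
rewrite (ge0_integralZl leb measurableT mFc (fun x _ => F0 _) cn).
by rewrite (lebesgue_affine _ c0 mF)// muleA -EFinM exprSr invfM mulrC.
Qed.

Lemma mpres_translate n (a : 'rV[R]_n) :
  mpres (lebn R n) (lebn R n) (fun x => unvec (vec x + a)).
Proof.
split; first by apply: vmeas_unvec; apply: vmeasD;
  [exact: vmeas_vec|exact: vmeas_cst].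
move=> f mf f0; have := integral_affine a (@ltr01 R) mf f0.
rewrite expr1n invr1 mul1e => <-.
by apply: eq_integral => x _; rewrite scale1r.
Qed.

Section Scale.
Variables (n : nat) (c : R) (c0 : 0 < c) (a : 'rV[R]_n).

Lemma rL1_scale (h : 'rV[R]_n -> R) : rL1 (lebn R n) (fun x => h (vec x)) ->
  rL1 (lebn R n) (fun x => h (c *: vec x + a)).
Proof.
move=> ih; have mh := rL1_meas ih; apply/integrableP; split.
  apply/measurable_EFinP; apply: (vmeas_comp _ mh).
  by apply: vmeasD; [apply: vmeasZ; exact: vmeas_vec|exact: vmeas_cst].
have mE : measurable_fun setT (fun x : Rn R n => `|(h (vec x))%:E|%E).
  by apply: measurableT_comp => //; exact/measurable_EFinP.
have H := integral_affine a c0 mE (fun=> abse_ge0 _).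
apply: (@le_lt_trans _ _ ((c ^- n)%:E * \int[lebn R n]_x `|(h (vec x))%:E|)%E).
  by rewrite -H le_eqVlt; apply/orP; left; apply/eqP/eq_integral => x _;
    rewrite unvecK.
apply: lte_mul_pinfty; rewrite ?lee_fin ?invr_ge0 ?exprn_ge0 ?ltW//.
by have /integrableP[] := ih.
Qed.

Lemma rI_scale (h : 'rV[R]_n -> R) : rL1 (lebn R n) (fun x => h (vec x)) ->
  Rintegral (lebn R n) setT (fun x => h (c *: vec x + a)) =
  c ^- n * Rintegral (lebn R n) setT (fun x => h (vec x)).
Proof.
move=> ih; have mh := rL1_meas ih.
have mE : measurable_fun setT (fun x : Rn R n => (h (vec x))%:E).
  exact/measurable_EFinP.
rewrite /Rintegral -[c ^- n]/(fine (c ^- n)%:E) -fineM//; last first.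
  exact: integrable_fin_num.
congr fine; rewrite integralE [X in (_ * X)%E]integralE.
rewrite muleBr//; last first.
  by apply: fin_num_adde_defr; exact: integrable_pos_fin_num.
have kp := @integral_affine n c a ((fun x => (h (vec x))%:E)^\+)%E c0
  (measurable_funepos mE) (funepos_ge0 _).
have kn := @integral_affine n c a ((fun x => (h (vec x))%:E)^\-)%E c0
  (measurable_funeneg mE) (funeneg_ge0 _).
rewrite -kp -kn; congr (_ - _)%E; apply: eq_integral => x _.
  by rewrite !funeposE unvecK.
by rewrite !funenegE unvecK.
Qed.

Lemma cL1_scale (F : 'rV[R]_n -> R[i]) : cintegrable F ->
  cintegrable (fun v => F (c *: v + a)).
Proof.
move=> [F1 F2]; split.
  exact: (rL1_scale (h := fun v => cre (F v)) F1).
exact: (rL1_scale (h := fun v => cim (F v)) F2).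
Qed.

Lemma cI_scale (F : 'rV[R]_n -> R[i]) : cintegrable F ->
  cint (fun v => F (c *: v + a)) = (c ^- n)%:C%C * cint F.
Proof.
move=> [F1 F2]; apply: eq_cplx; rewrite ?cE /= mul0r ?subr0 ?addr0.
  exact: (rI_scale (h := fun v => cre (F v)) F1).
exact: (rI_scale (h := fun v => cim (F v)) F2).
Qed.

End Scale.

Lemma cI_translate n (a : 'rV[R]_n) (F : 'rV[R]_n -> R[i]) : cmeasurable F ->
  cint (fun v => F (v + a)) = cint F.
Proof.
move=> mF.
have H := mpres_cI (mpres_translate a) (f := fun x => F (vec x)) mF.
apply: etrans _ H; by apply: eq_cI => x; rewrite unvecK.
Qed.

Lemma rI_translate n (a : 'rV[R]_n) (h : 'rV[R]_n -> R) :
  measurable_fun setT (fun x : Rn R n => h (vec x)) ->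
  Rintegral (lebn R n) setT (fun x => h (vec x + a)) =
  Rintegral (lebn R n) setT (fun x => h (vec x)).
Proof.
move=> mh.
have H := mpres_rI (mpres_translate a) (h := fun x => h (vec x)) mh.
apply: etrans _ H; by apply: eq_Rintegral => x _; rewrite unvecK.
Qed.

Lemma rL1_translate n (a : 'rV[R]_n) (h : 'rV[R]_n -> R) :
  rL1 (lebn R n) (fun x => h (vec x)) ->
  rL1 (lebn R n) (fun x => h (vec x + a)).
Proof.
move=> ih.
have := mpres_rL1 (mpres_translate a) (h := fun x => h (vec x)) ih.
by apply: eq_integrable => // x _; rewrite unvecK.
Qed.

(** The recursion follows the computation of [n + m], so both sides have matching types without a
    cast. *)
Fixpoint splitRn n m : Rn R (n + m) -> Rn R n * Rn R m :=
  match n return Rn R (n + m) -> Rn R n * Rn R m with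
  | 0 => fun x => (tt, x)
  | S n' => fun x => ((x.1, (@splitRn n' m x.2).1), (@splitRn n' m x.2).2)
  end.

Lemma coordn_split n m (x : Rn R (n + m)) k :
  coordn x k = if (k < n)%N then coordn (splitRn x).1 k
               else coordn (splitRn x).2 (k - n).
Proof.
elim: n x k => [|n IH] x k; first by rewrite ltn0 subn0.
case: k => [//|k]; rewrite ltnS subSS; exact: IH.
Qed.

Lemma vec_split n m (x : Rn R (n + m)) :
  vec x = row_mx (vec (splitRn x).1) (vec (splitRn x).2).
Proof.
apply/rowP => i; rewrite vecE coordn_split; case: (splitP i) => j ij.
  have -> : i = lshift m j by apply/val_inj.
  by rewrite row_mxEl vecE.
have -> : i = rshift n j by apply/val_inj.
by rewrite row_mxEr vecE /= addKn.
Qed.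

Lemma mpres_split n m :
  mpres (lebn R (n + m)) (pmeas (lebn R n) (lebn R m)) (@splitRn n m).
Proof.
elim: n => [|n IH].
  have ms : measurable_fun setT (@splitRn 0 m).
    exact: measurable_fun_pair.
  split => // f mf f0; rewrite [RHS]fubini_tonelli1//.
  have mF := measurable_fun_fubini_tonelli_F (m2 := lebn R m) f mf f0.
  rewrite [RHS]integral_dirac//.
  by rewrite diracT mul1e.
have id1 : mpres (T1 := measurableTypeR R) leb leb idfun.
  by split => //; exact: measurable_id.
exact: mpres_comp (mpres_pair id1 IH) (mpres_assoc _ _ _).
Qed.

Lemma mpres_unsplit n m :
  mpres (pmeas (lebn R n) (lebn R m)) (lebn R (n + m))
    (fun z => unvec (row_mx (vec z.1) (vec z.2))).
Proof.
apply: (mpres_inv (mpres_split n m)) => [|x]; last by rewrite -vec_split vecK.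
by apply: vmeas_unvec; apply: vmeas_row; apply: vmeas_vec.
Qed.

(* Two shears, [x := X - Y/2] followed by [y := Y + x]. *)
Lemma mpres_wigner n : mpres (pmeas (lebn R n) (lebn R n))
  (pmeas (lebn R n) (lebn R n))
  (fun z => (unvec (vec z.1 - 2^-1 *: vec z.2), unvec (vec z.1 + 2^-1 *: vec z.2))).
Proof.
pose t1 (y x : Rn R n) := unvec (vec x + (- (2^-1 *: vec y))).
pose t2 (x y : Rn R n) := unvec (vec y + vec x).
have m1 : measurable_fun setT (fun z : Rn R n * Rn R n => t1 z.2 z.1).
  apply: vmeas_unvec; apply: vmeasB; first exact: vmeas_vec.
  by apply: vmeasZ; exact: vmeas_vec.
have m2 : measurable_fun setT (fun z : Rn R n * Rn R n => t2 z.2 z.1).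
  by apply: vmeas_unvec; apply: vmeasD; exact: vmeas_vec.
have H1 := mpres_shear (lebn R n) m1 (fun y => mpres_translate _).
have H2 := mpres_shear (lebn R n) m2 (fun y => mpres_translate _).
have S := mpres_swap (lebn R n) (lebn R n).
have H := mpres_comp (mpres_comp (mpres_comp H1 S) H2) S.
have : forall z, ((fun z : Rn R n * Rn R n => (z.2, z.1)) \o
    (fun z => (t2 z.2 z.1, z.2)) \o
    (fun z : Rn R n * Rn R n => (z.2, z.1)) \o
    (fun z => (t1 z.2 z.1, z.2))) z =
  (unvec (vec z.1 - 2^-1 *: vec z.2), unvec (vec z.1 + 2^-1 *: vec z.2)).
  move=> [x y]; rewrite /t1 /t2 /= unvecK; congr (_, unvec _).
  rewrite addrC -addrA; congr (_ + _).
  rewrite -[X in - _ + X]scale1r -scaleNr -scalerDl.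
  by congr (_ *: _); field.
by move/funext => <-.
Qed.

(** Passage to midpoint and difference; it carries the bound on the centered kernel back to the
    kernel itself. *)
Lemma mpres_wigner_inv n : mpres (pmeas (lebn R n) (lebn R n))
  (pmeas (lebn R n) (lebn R n))
  (fun z => (unvec (2^-1 *: (vec z.1 + vec z.2)), unvec (vec z.2 - vec z.1))).
Proof.
apply: (mpres_inv (mpres_wigner n)) => [|[x y] /=].
  apply: measurable_fun_pair; apply: vmeas_unvec.
    by apply: vmeasZ; apply: vmeasD; exact: vmeas_vec.
  by apply: vmeasB; exact: vmeas_vec.
rewrite !unvecK -[in RHS](vecK x) -[in RHS](vecK y); congr (unvec _, unvec _).
  apply/rowP => i; rewrite !mxE; lra.
apply/rowP => i; rewrite !mxE; lra.
Qed.

End AffineChange.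

(** * Gaussians and polynomial weights *)

Section Gauss1D.
Variable R : realType.
Local Notation leb := (@lebesgue_measure R).
Implicit Types x t s : R.

Definition g1 x : R := expR (- (x ^+ 2 / 2)).
(** The total mass of [g1], by [integral_g1]. *)
Definition c0 : R := Num.sqrt (2 * pi).

Lemma g1_gt0 x : 0 < g1 x. Proof. exact: expR_gt0. Qed.
Lemma g1_ge0 x : 0 <= g1 x. Proof. exact: expR_ge0. Qed.
Lemma g1_le1 x : g1 x <= 1.
Proof. by rewrite /g1 expR_le1 oppr_le0 divr_ge0 ?sqr_ge0. Qed.

Lemma g1N x : g1 (- x) = g1 x. Proof. by rewrite /g1 sqrrN. Qed.

Lemma c0_gt0 : 0 < c0.
Proof. by rewrite sqrtr_gt0 mulr_gt0 ?pi_gt0. Qed.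

Lemma c0_sqr : c0 ^+ 2 = 2 * pi.
Proof. by rewrite sqr_sqrtr// mulr_ge0 ?pi_ge0. Qed.

Lemma continuous_g1 : continuous g1.
Proof.
move=> x; apply: (@continuous_comp _ _ _ (fun x : R => - (x ^+ 2 / 2)) expR).
  by apply: cvgN; apply: cvgM; [rewrite expr2; apply: cvgM|exact: cvg_cst].
exact: continuous_expR.
Qed.

Lemma measurable_g1 : measurable_fun setT g1.
Proof. exact: (continuous_measurable_fun continuous_g1). Qed.

(* From [y <= exp y] at [y = s (1 + x^2) / N]. *)
Lemma pow_le_exp (N : nat) s : 0 < s ->
  exists C, forall x, (1 + x ^+ 2) ^+ N <= C * expR (s * x ^+ 2).
Proof.
move=> s0; case: N => [|N].
  exists 1 => x; rewrite expr0 mul1r -expR0 ler_expR.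
  by rewrite mulr_ge0 ?sqr_ge0 ?ltW.
set M : R := N.+1%:R; have M0 : 0 < M by rewrite ltr0n.
exists ((M / s) ^+ N.+1 * expR s) => x.
have y0 : 0 <= s * (1 + x ^+ 2) / M.
  by rewrite divr_ge0 ?ltW// mulr_gt0// ltr_pwDl// sqr_ge0.
rewrite -mulrA -expRD.
have -> : s + s * x ^+ 2 = M * (s * (1 + x ^+ 2) / M) by field; rewrite gt_eqF.
rewrite expRM_natl -exprMn; apply: lerXn2r; rewrite ?nnegrE.
- by rewrite addr_ge0 ?sqr_ge0.
- by rewrite mulr_ge0 ?expR_ge0// divr_ge0 ?ltW.
rewrite -ler_pdivrMl ?divr_gt0// invf_div.
have -> : s / M * (1 + x ^+ 2) = s * (1 + x ^+ 2) / M by field; rewrite gt_eqF.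
by apply: le_trans (expR_ge1Dx _); rewrite lerDr.
Qed.

Lemma rL1_cauchy : rL1 leb (fun x => (1 + x ^+ 2)^-1).
Proof.
have cont : continuous (fun x : R => (1 + x ^+ 2)^-1) by exact: continuous_oneDsqrV.
have pos x : (0 <= (1 + x ^+ 2)^-1) by rewrite invr_ge0 addr_ge0 ?sqr_ge0.
apply/integrableP; split.
  by apply/measurable_EFinP; exact: continuous_measurable_fun.
under eq_integral do rewrite /= ger0_norm//.
rewrite ge0_symfun_integralT//; last by move=> x /=; rewrite sqrrN.
rewrite (_ : [set x | _] = `[0, +oo[%classic); last first.
  by apply/seteqP; split => x/=; rewrite in_itv/= andbT.
by rewrite integral0y_oneDsqr -EFinM ltry.
Qed.

(** Exponent 2 in [pow_le_exp] turns the bound into [C / (1 + x^2)]. The factor [1 + x^2] leaves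
    room for the [x] that differentiating [g1], or the oscillating factor in its frequency,
    produces. *)
Lemma rL1_poly_g1 (h : R -> R) : measurable_fun setT h ->
  (forall x, `|h x| <= (1 + x ^+ 2) * g1 x) -> rL1 leb h.
Proof.
move=> mh hh; have [C HC] := pow_le_exp 2 (s := 2^-1) (ltac:(lra)).
apply: (@rL1_le _ (measurableTypeR R) R leb h _ mh (rL1Z C rL1_cauchy)) => x.
apply: le_trans (hh x) _.
have p0 : 0 < 1 + x ^+ 2 by rewrite ltr_pwDl// sqr_ge0.
rewrite ler_pdivlMr// mulrAC -expr2.
have -> : C = C * expR (2^-1 * x ^+ 2) * g1 x.
  by rewrite -mulrA -expRD (mulrC _ 2^-1) subrr expR0 mulr1.
by rewrite ler_wpM2r ?g1_ge0.
Qed.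

Lemma rL1_g1 : rL1 leb g1.
Proof.
apply: rL1_poly_g1 => [|x]; first exact: measurable_g1.
by rewrite ger0_norm ?g1_ge0// ler_peMl ?g1_ge0// lerDl sqr_ge0.
Qed.

Lemma integral_g1 : Rintegral leb setT g1 = c0.
Proof.
have s2 : 0 < (Num.sqrt (2 : R))^-1 by rewrite invr_gt0 sqrtr_gt0.
have mg : measurable_fun setT (fun x => (gauss_fun x)%:E : \bar R).
  by apply/measurable_EFinP; exact: measurable_gauss_fun.
have := lebesgue_affine 0 s2 mg (fun x => gauss_fun_ge0 x).
rewrite integralT_gauss invrK -EFinM => H.
rewrite /Rintegral (_ : (\int[leb]_x (g1 x)%:E)%E = (c0%:E)%E)//.
rewrite /c0 sqrtrM// -H; apply: eq_integral => x _.
by rewrite /gauss_fun /g1 addr0 exprMn exprVn sqr_sqrtr// mulrC.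
Qed.

Lemma is_derive_continuous (f f' : R -> R) :
  (forall x, is_derive x (1 : R) f (f' x)) -> continuous f.
Proof.
move=> df x; apply: differentiable_continuous; apply/derivable1_diffP.
exact: ex_derive.
Qed.

(** The fundamental theorem of calculus on growing symmetric intervals, then dominated convergence.
    The rate in the last hypothesis is the one proved for Gaussian boundary terms in [by_parts]:
    [2 / (k + 1)] for each endpoint. *)
Lemma integral_derive0 (H h : R -> R) : (forall x, is_derive x (1 : R) H (h x)) ->
  continuous h -> rL1 leb h ->
  (forall k : nat, `|H k%:R - H (- k%:R)| <= 4 / k.+1%:R) ->
  Rintegral leb setT h = 0.
Proof.
move=> dH ch ih bH.
have cH : continuous H := is_derive_continuous dH.
(* The endpoint is [k + 1] so that the interval is nondegenerate also for [k = 0]. *)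
pose I (k : nat) : set R := `[- k.+1%:R, k.+1%:R]%classic.
have cv : (fun k => Rintegral leb setT (h \_ (I k))) @ \oo --> Rintegral leb setT h.
  apply: (@rDCT _ (measurableTypeR R) R leb _ h (fun x => `|h x|)).
  - move=> k; apply/(measurable_restrictT _ _).1.
      exact: measurable_itv.
    exact: measurable_funTS (continuous_measurable_fun ch).
  - exact: continuous_measurable_fun.
  - by move/integrable_abse : ih; apply: eq_integrable.
  - move=> x; apply: cvg_near_cst; near=> k.
    rewrite patchE ifT//; apply/mem_set; rewrite /I /= in_itv /= -ler_norml.
    apply: le_trans (_ : k%:R <= _); last by rewrite ler_nat.
    near: k; exact: nbhs_infty_ger.
  - by move=> k x; rewrite patchE; case: ifP => // _; rewrite normr0.
have E k : Rintegral leb setT (h \_ (I k)) = H k.+1%:R - H (- k.+1%:R).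
  rewrite -Rintegral_mkcond /Rintegral (@continuous_FTC2 _ h H)//.
  - by rewrite gtrN// ltr0n.
  - by apply: continuous_in_subspaceT => x ?; exact: ch.
  - split.
    + by move=> x _; apply: ex_derive.
    + by apply: cvg_at_right_filter; exact: cH.
    + by apply: cvg_at_left_filter; exact: cH.
  - by move=> x _; rewrite derive1E; exact: derive_val.
have cv0 : (fun k => Rintegral leb setT (h \_ (I k))) @ \oo --> (0 : R).
  apply: norm_cvg0.
  apply: (@squeeze_cvgr _ _ _ _ (cst 0) (fun k => 4 * (k.+1%:R)^-1)).
  - apply: nearW => k; rewrite normr_ge0 /= E; apply: le_trans (bH _) _.
    by rewrite ler_pM2l// lef_pV2 ?posrE ?ltr0n// ler_nat.
  - exact: cvg_cst.
  - rewrite -[X in _ --> X](mulr0 (4 : R)); apply: cvgM; first exact: cvg_cst.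
    exact: cvg_harmonic.
exact: (cvg_unique _ cv cv0).
Unshelve. all: end_near. Qed.

(** * Gaussian integrals of cosine and sine together: (u, v) is (cos, - sin) or (sin, cos) *)

Section Oscillating.
Variables u v : R -> R.
Hypothesis du : forall x, is_derive x (1 : R) u (v x).
Hypothesis dv : forall x, is_derive x (1 : R) v (- u x).
Hypothesis u1 : forall x, `|u x| <= 1.
Hypothesis v1 : forall x, `|v x| <= 1.

Let cu : continuous u := is_derive_continuous du.
Let cv : continuous v := is_derive_continuous dv.

Let cscale (f : R -> R) t : continuous f -> continuous (fun x => f (t * x)).
Proof.
move=> cf x; apply: (@continuous_comp _ _ _ (fun x : R => t * x) f).
  by apply: cvgM; [exact: cvg_cst|exact: cvg_id].
exact: cf.
Qed.

Let I t := Rintegral leb setT (fun x => u (t * x) * g1 x).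

Let iu t : rL1 leb (fun x => u (t * x) * g1 x).
Proof.
apply: (@rL1_le _ (measurableTypeR R) R leb _ _ _ rL1_g1) => [|x]; last first.
  by rewrite normrM (ger0_norm (g1_ge0 _)) ler_piMl ?g1_ge0.
apply: measurable_funM; last exact: measurable_g1.
by apply: continuous_measurable_fun; exact: cscale.
Qed.

Let absx_le x : `|x| <= 1 + x ^+ 2.
Proof. by have := sqr_ge0 (`|x| - 1); rewrite -(real_normK (num_real x)); nra. Qed.

Let ixv t : rL1 leb (fun x => x * v (t * x) * g1 x).
Proof.
apply: rL1_poly_g1 => [|x].
  apply: measurable_funM; last exact: measurable_g1.
  apply: measurable_funM => //.
  by apply: continuous_measurable_fun; exact: cscale.
rewrite !normrM (ger0_norm (g1_ge0 _)) ler_wpM2r ?g1_ge0//.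
by apply: le_trans (absx_le x); rewrite ler_piMr.
Qed.

(** The derivative of [v (t x) * g1 x] has integral zero, and it is the difference of the two
    integrands because [v' = - u] and [g1' = - x g1]. *)
Let by_parts t : Rintegral leb setT (fun x => x * v (t * x) * g1 x) = - t * I t.
Proof.
have dg x : is_derive x (1 : R) g1 (- x * g1 x).
  rewrite /g1; apply: trigger_derive.
  by rewrite /GRing.scale /=; field.
have dvt x : is_derive x (1 : R) (fun x => v (t * x)) (- t * u (t * x)).
  have dt : is_derive x (1 : R) (fun x => t * x) t.
    by apply: trigger_derive; rewrite /GRing.scale /=; ring.
  have -> : - t * u (t * x) = - u (t * x) * t by ring.
  exact: (@is_derive1_comp _ v _ x _ _ (dv _) dt).
have D x : is_derive x (1 : R) (fun x => v (t * x) * g1 x)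
    (- t * (u (t * x) * g1 x) - x * v (t * x) * g1 x).
  by apply: trigger_derive; rewrite /GRing.scale /=; ring.
have i0 : rL1 leb (fun x => - t * (u (t * x) * g1 x) - x * v (t * x) * g1 x).
  have := rL1D (rL1Z (- t) (iu t)) (rL1Z (-1) (ixv t)).
  by apply: eq_integrable => // x _; rewrite mulN1r.
have : Rintegral leb setT
    (fun x => - t * (u (t * x) * g1 x) - x * v (t * x) * g1 x) = 0.
  apply: (integral_derive0 D) => //.
    move=> x; apply: cvgB.
      apply: cvgM; first exact: cvg_cst.
      by apply: cvgM; [exact: cscale|exact: continuous_g1].
    apply: cvgM; last exact: continuous_g1.
    by apply: cvgM; [exact: cvg_id|exact: cscale].
  move=> k; apply: le_trans (ler_normB _ _) _.
  have B x : `|v (t * x) * g1 x| <= g1 x.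
    by rewrite normrM (ger0_norm (g1_ge0 _)) ler_piMl ?g1_ge0.
  apply: le_trans (lerD (B _) (B _)) _; rewrite g1N.
  suff G : g1 k%:R <= 2 / k.+1%:R.
    by rewrite (_ : (4 : R) = 2 + 2); [rewrite mulrDl lerD|ring].
  rewrite /g1 expRN -[2 / _]invf_div lef_pV2 ?posrE ?expR_gt0 ?divr_gt0 ?ltr0n//.
  apply: le_trans (expR_ge1Dx _).
  rewrite -(natr1 k); have := sqr_ge0 (k%:R - 1 : R); nra.
rewrite (@RintegralB _ _ _ leb setT _ _ measurableT (rL1Z (- t) (iu t)) (ixv t)).
rewrite (@RintegralZl _ _ _ leb setT _ (- t) measurableT (iu t)) => /eqP.
by rewrite subr_eq0 => /eqP ->.
Qed.

(** Differentiation under the integral sign; since [|v| <= 1], the function [(1 + y^2) * g1 y]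
    dominates the parameter derivative uniformly in the parameter. *)
Let dI t : is_derive t (1 : R) I (- t * I t).
Proof.
pose f (s x : R) := u (s * x) * g1 x.
have d1 s x : is_derive s (1 : R) (f ^~ x) (x * v (s * x) * g1 x).
  have du' : is_derive s (1 : R) (fun s => u (s * x)) (x * v (s * x)).
    have ds : is_derive s (1 : R) (fun s => s * x) x.
      by apply: trigger_derive; rewrite /GRing.scale /=; ring.
    by rewrite [x * _]mulrC; exact: (@is_derive1_comp _ u _ s _ _ (du _) ds).
  by rewrite /f; apply: trigger_derive; rewrite /GRing.scale /=; ring.
have pE s x : partial1of2 f s x = x * v (s * x) * g1 x.
  by rewrite partial1of2E; exact: derive_val.
have iG : leb.-integrable setT (EFin \o (fun x => (1 + x ^+ 2) * g1 x)).
  apply: rL1_poly_g1 => [|x].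
    apply: measurable_funM; last exact: measurable_g1.
    by apply: measurable_funD => //; apply: measurable_funX.
  by rewrite ger0_norm// mulr_ge0 ?g1_ge0// addr_ge0 ?sqr_ge0.
have tI : [set` `]t - 1, t + 1[] t by rewrite /= in_itv /=; lra.
have i1 s : [set` `]t - 1, t + 1[] s -> leb.-integrable setT (EFin \o f s).
  by move=> _; exact: (iu s).
have i2 s y : [set` `]t - 1, t + 1[] s -> setT y -> derivable (f ^~ y) s 1.
  by move=> _ _; exact: ex_derive.
have i3 s y : [set` `]t - 1, t + 1[] s -> setT y ->
    `|partial1of2 f s y| <= (1 + y ^+ 2) * g1 y.
  move=> _ _; rewrite pE !normrM (ger0_norm (g1_ge0 _)) ler_wpM2r ?g1_ge0//.
  by apply: le_trans (absx_le y); rewrite ler_piMr.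
have i4 (y : R) : 0 <= (1 + y ^+ 2) * g1 y.
  by rewrite mulr_ge0 ?g1_ge0// addr_ge0 ?sqr_ge0.
apply: DeriveDef.
  exact: (derivable_under_integral measurableT tI i1 i2 i4 iG i3).
rewrite -derive1E (differentiation_under_integral measurableT tI i1 i2 i4 iG i3).
by rewrite -by_parts; apply: eq_Rintegral => x _; rewrite -pE partial1of2E.
Qed.

(* Integrating by parts gives [I' t = - t I t], so [I t * exp (t^2/2)] is constant. *)
Lemma gauss_oscillating t :
  Rintegral leb setT (fun x => u (t * x) * g1 x) = u 0 * c0 * g1 t.
Proof.
pose J s := I s * expR (s ^+ 2 / 2).
have dJ s : is_derive s (1 : R) J 0.
  pose e (s : R) := expR (s ^+ 2 / 2).
  have de : is_derive s (1 : R) e (s * e s).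
    by rewrite /e; apply: trigger_derive; rewrite /GRing.scale /=; field.
  have -> : 0 = I s *: (s * e s) + e s *: (- s * I s).
    by rewrite /GRing.scale /=; ring.
  exact: (is_deriveM (dI s) de).
have := is_derive_0_is_cst t 0 dJ.
rewrite /J expr0n mul0r expR0 mulr1 => Jt.
have -> : u 0 * c0 = I 0.
  rewrite -integral_g1 /I -RintegralZl//; last exact: rL1_g1.
  by apply: eq_Rintegral => x _; rewrite mul0r.
by rewrite -Jt /g1 -mulrA -expRD subrr expR0 mulr1.
Qed.

End Oscillating.

Lemma gauss_cos t : Rintegral leb setT (fun x => cos (t * x) * g1 x) = c0 * g1 t.
Proof.
have b1 x : `|cos x : R| <= 1 by rewrite ler_norml cos_geN1 cos_le1.
have b2 x : `|- sin x : R| <= 1 by rewrite normrN ler_norml sin_geN1 sin_le1.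
have d2 x : is_derive x (1 : R) (fun x => - sin x) (- cos x).
  exact: is_deriveN.
by rewrite (gauss_oscillating (@is_derive_cos R) d2 b1 b2) cos0 mul1r.
Qed.

Lemma gauss_sin t : Rintegral leb setT (fun x => sin (t * x) * g1 x) = 0.
Proof.
have b1 x : `|cos x : R| <= 1 by rewrite ler_norml cos_geN1 cos_le1.
have b2 x : `|sin x : R| <= 1 by rewrite ler_norml sin_geN1 sin_le1.
by rewrite (gauss_oscillating (@is_derive_sin R) (@is_derive_cos R) b2 b1) sin0 !mul0r.
Qed.

End Gauss1D.

Lemma cI_prod d1 d2 (T1 : measurableType d1) (T2 : measurableType d2)
  (R : realType) (m1 : {sigma_finite_measure set T1 -> \bar R})
  (m2 : {sigma_finite_measure set T2 -> \bar R}) (f : T1 -> R[i])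
  (g : T2 -> R[i]) : cL1 m1 f -> cL1 m2 g ->
  cI (pmeas m1 m2) (fun z => f z.1 * g z.2) = cI m1 f * cI m2 g.
Proof.
move=> fi gi; rewrite cFub1 -?cIZr//.
  by apply: eq_cI => x /=; rewrite cIZ.
apply: (cL1_prod_le _ (cL1_cabs fi) (cL1_cabs gi)) => [|x y].
  apply: cMM; first exact: (cM_comp _ (cL1_cM fi)).
  exact: (cM_comp _ (cL1_cM gi)).
by rewrite cabsM.
Qed.

(** * Weights and Gaussians in several variables *)

Section Weights.
Variable R : realType.

Section Dot.
Variable n : nat.
Implicit Types u v w : 'rV[R]_n.

Lemma dotnC u v : dotn u v = dotn v u.
Proof. by apply: eq_bigr => i _; rewrite mulrC. Qed.

Lemma dotnDl u v w : dotn (u + v) w = dotn u w + dotn v w.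
Proof. by rewrite -big_split; apply: eq_bigr => i _; rewrite mxE mulrDl. Qed.

Lemma dotnDr u v w : dotn u (v + w) = dotn u v + dotn u w.
Proof. by rewrite dotnC dotnDl !(dotnC u). Qed.

Lemma dotnZl (c : R) u v : dotn (c *: u) v = c * dotn u v.
Proof. by rewrite mulr_sumr; apply: eq_bigr => i _; rewrite mxE mulrA. Qed.

Lemma dotnZr (c : R) u v : dotn u (c *: v) = c * dotn u v.
Proof. by rewrite dotnC dotnZl dotnC. Qed.

Lemma dotnNl u v : dotn (- u) v = - dotn u v.
Proof. by rewrite -scaleN1r dotnZl mulN1r. Qed.

Lemma dotnNr u v : dotn u (- v) = - dotn u v.
Proof. by rewrite dotnC dotnNl dotnC. Qed.

Lemma dotn0l v : dotn 0 v = 0.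
Proof. by rewrite -(scale0r v) dotnZl mul0r. Qed.

End Dot.

Lemma dotn_row n m (u1 v1 : 'rV[R]_n) (u2 v2 : 'rV[R]_m) :
  dotn (row_mx u1 u2) (row_mx v1 v2) = dotn u1 v1 + dotn u2 v2.
Proof.
rewrite /dotn big_split_ord /=; congr (_ + _); apply: eq_bigr => i _.
  by rewrite !row_mxEl.
by rewrite !row_mxEr.
Qed.

(* Peetre's inequality [wt_peetre] makes powers of this weight behave well under
   translations, and [1 / wt] is integrable; all decay is measured against it. *)
Definition wt n (v : 'rV[R]_n) : R := \prod_(i < n) (1 + v 0 i ^+ 2).
Definition gs n (v : 'rV[R]_n) : R := \prod_(i < n) g1 (v 0 i).

Lemma wt1_ge1 (x : R) : 1 <= 1 + x ^+ 2. Proof. by rewrite lerDl sqr_ge0. Qed.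
Lemma wt1_gt0 (x : R) : 0 < 1 + x ^+ 2. Proof. exact: lt_le_trans (wt1_ge1 x). Qed.

Lemma wt_gt0 n (v : 'rV[R]_n) : 0 < wt v.
Proof. by apply: prodr_gt0 => i _; exact: wt1_gt0. Qed.

Lemma wt_ge0 n (v : 'rV[R]_n) : 0 <= wt v. Proof. exact/ltW/wt_gt0. Qed.

Lemma wt_ge1 n (v : 'rV[R]_n) : 1 <= wt v.
Proof.
rewrite /wt; elim/big_rec: _ => // i y _ y1.
by apply: (le_trans y1); rewrite ler_peMl ?wt1_ge1// (le_trans ler01).
Qed.

Lemma wtX_gt0 n (v : 'rV[R]_n) N : 0 < wt v ^+ N.
Proof. by rewrite exprn_gt0 ?wt_gt0. Qed.

Lemma wtX_ge1 n (v : 'rV[R]_n) N : 1 <= wt v ^+ N.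
Proof. by rewrite exprn_ege1 ?wt_ge1. Qed.

Lemma wtN n (v : 'rV[R]_n) : wt (- v) = wt v.
Proof. by apply: eq_bigr => i _; rewrite mxE sqrrN. Qed.

Lemma wt_peetre n (u v : 'rV[R]_n) : wt (u + v) <= 2 ^+ n * (wt u * wt v).
Proof.
rewrite /wt -big_split /= -[X in 2 ^+ X](card_ord n) -prodr_const -big_split /=.
apply: ler_prod => i _; rewrite (le_trans ler01 (wt1_ge1 _)) /= mxE.
set a := u 0 i; set b := v 0 i.
have := sqr_ge0 (a - b); have := sqr_ge0 (a * b); nra.
Qed.

Lemma wt_row n m (u : 'rV[R]_n) (v : 'rV[R]_m) : wt (row_mx u v) = wt u * wt v.
Proof.
rewrite /wt big_split_ord /=; congr (_ * _); apply: eq_bigr => i _.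
  by rewrite row_mxEl.
by rewrite row_mxEr.
Qed.

Lemma gs_ge0 n (v : 'rV[R]_n) : 0 <= gs v.
Proof. by apply: prodr_ge0 => i _; exact: g1_ge0. Qed.

Lemma gs_gt0 n (v : 'rV[R]_n) : 0 < gs v.
Proof. by apply: prodr_gt0 => i _; exact: g1_gt0. Qed.

Lemma gs_le1 n (v : 'rV[R]_n) : gs v <= 1.
Proof.
rewrite -[leRHS](expr1n R n) -[X in _ ^+ X](card_ord n) -prodr_const.
by apply: ler_prod => i _; rewrite g1_ge0 g1_le1.
Qed.

Lemma gsN n (v : 'rV[R]_n) : gs (- v) = gs v.
Proof. by apply: eq_bigr => i _; rewrite mxE g1N. Qed.

Lemma gsE n (v : 'rV[R]_n) : gs v = expR (- (dotn v v / 2)).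
Proof.
rewrite /gs /dotn mulr_suml -sumrN expR_sum.
by apply: eq_bigr => i _; rewrite /g1 expr2.
Qed.

Lemma gs_wt n N : exists2 C, 0 < C & forall v : 'rV[R]_n, gs v <= C / wt v ^+ N.
Proof.
have [C HC] := pow_le_exp N (s := (2 : R)^-1) (ltac:(lra)).
have C0 : 0 < C.
  have := HC 0; rewrite expr0n mulr0 addr0 expr1n expR0 mulr1.
  exact: lt_le_trans.
exists (C ^+ n); first by rewrite exprn_gt0.
move=> v; rewrite ler_pdivlMr ?wtX_gt0// /gs /wt -prodrXl -big_split /=.
rewrite -[X in _ ^+ X](card_ord n) -prodr_const; apply: ler_prod => i _.
rewrite mulr_ge0 ?g1_ge0 ?exprn_ge0 ?(ltW (wt1_gt0 _))//=.
rewrite mulrC /g1 expRN ler_pdivrMr ?expR_gt0//.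
by rewrite [X in expR X]mulrC HC.
Qed.

Lemma vec0 n (x : Rn R n.+1) : vec x 0 ord0 = x.1.
Proof. by rewrite vecE. Qed.

Lemma vecS n (x : Rn R n.+1) (i : 'I_n) : vec x 0 (lift ord0 i) = vec x.2 0 i.
Proof. by rewrite !vecE. Qed.

Lemma wt_vecS n (x : Rn R n.+1) : wt (vec x) = (1 + x.1 ^+ 2) * wt (vec x.2).
Proof.
rewrite /wt big_ord_recl vec0; congr (_ * _); apply: eq_bigr => i _.
by rewrite (vecS x i).
Qed.

Lemma gs_vecS n (x : Rn R n.+1) : gs (vec x) = g1 x.1 * gs (vec x.2).
Proof.
rewrite /gs big_ord_recl vec0; congr (_ * _); apply: eq_bigr => i _.
by rewrite (vecS x i).
Qed.

Lemma dotn_vecS n (t : 'rV[R]_n.+1) (x : Rn R n.+1) :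
  dotn t (vec x) = t 0 ord0 * x.1 + dotn (\row_i t 0 (lift ord0 i)) (vec x.2).
Proof.
rewrite /dotn big_ord_recl vec0; congr (_ + _); apply: eq_bigr => i _.
by rewrite (vecS x i) mxE.
Qed.

Lemma rL1_wt n : rL1 (lebn R n) (fun x => (wt (vec x))^-1).
Proof.
elim: n => [|n IH].
  apply: (eq_integrable measurableT (fun=> 1%:E)).
    by move=> x _; rewrite /wt big_ord0 invr1.
  apply/integrableP; split; first exact: measurable_cst.
  by rewrite integral_dirac//= ?normr1 ?mule1 ?diracT ?ltry.
have := rL1_prod (m2 := lebn R n) (@rL1_cauchy R) IH.
apply: eq_integrable => // x _.
by rewrite wt_vecS invfM.
Qed.

Section Meas.
Context d (T : measurableType d).

Lemma measurable_wt n (f : T -> 'rV[R]_n) : vmeas f ->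
  measurable_fun setT (fun t => wt (f t)).
Proof.
move=> mf; apply: measurable_prod => i _.
by apply: measurable_funD => //; apply: measurable_funX.
Qed.

Lemma measurable_gs n (f : T -> 'rV[R]_n) : vmeas f ->
  measurable_fun setT (fun t => gs (f t)).
Proof.
move=> mf; under eq_fun do rewrite gsE.
apply: measurableT_comp => //; apply: measurableT_comp => //.
by apply: measurable_funM => //; exact: measurable_dotn.
Qed.

Lemma measurable_wtXV n N (f : T -> 'rV[R]_n) : vmeas f ->
  measurable_fun setT (fun t => (wt (f t) ^+ N)^-1).
Proof.
move=> mf.
(* As [wt > 0], the reciprocal power is an exponential of a logarithm, hence a composition of
   measurable functions. *)
have -> : (fun t => (wt (f t) ^+ N)^-1) = (fun t => expR (- (N%:R * ln (wt (f t))))).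
  by apply/funext => t; rewrite expRN expRM_natl lnK ?posrE ?wt_gt0.
apply: measurableT_comp => //; apply: measurableT_comp => //.
apply: measurable_funM => //; apply: measurableT_comp; first exact: measurable_ln.
exact: measurable_wt.
Qed.

End Meas.

Lemma rL1_wtX n N : rL1 (lebn R n) (fun x => (wt (vec x) ^+ N.+1)^-1).
Proof.
apply: (rL1_le _ (rL1_wt n)) => [|x]; first by apply: measurable_wtXV; exact: vmeas_vec.
rewrite ger0_norm ?invr_ge0 ?exprn_ge0 ?wt_ge0//.
rewrite lef_pV2 ?posrE ?exprn_gt0 ?wt_gt0//.
by rewrite exprS ler_peMr ?wt_ge0 ?wtX_ge1.
Qed.

Lemma rL1_gs n : rL1 (lebn R n) (fun x => gs (vec x)).
Proof.
have [C C0 HC] := gs_wt n 1.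
apply: (rL1_le _ (rL1Z C (rL1_wtX n 0))) => [|x].
  by apply: measurable_gs; exact: vmeas_vec.
by rewrite ger0_norm ?gs_ge0.
Qed.

Lemma cL1_gs_expi n (t : 'rV[R]_n) :
  cL1 (lebn R n) (fun x => expi (dotn t (vec x)) * (gs (vec x))%:C%C).
Proof.
apply: (cL1_bdM (M := 1)) => [|x|]; last exact/cL1C/rL1_gs.
  by apply: cM_expi; apply: measurable_dotn; [exact: vmeas_cst|exact: vmeas_vec].
by rewrite cabs_expi.
Qed.

(** Exponential and Gaussian both factor over the coordinates; each factor is [gauss_cos], its
    imaginary part vanishing by [gauss_sin]. *)
Lemma gs_fourier n (t : 'rV[R]_n) :
  cint (fun x => expi (dotn t x) * (gs x)%:C%C) = (@c0 R ^+ n * gs t)%:C%C.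
Proof.
rewrite -[LHS]/(cI (lebn R n) (fun x => expi (dotn t (vec x)) * (gs (vec x))%:C%C)).
elim: n t => [|n IH] t.
  rewrite expr0 mul1r /gs big_ord0 (_ : (fun _ => _) = fun=> 1%:C%C); last first.
    by apply/funext => x; rewrite /dotn !big_ord0 expi0 mul1r.
  rewrite cIC /Rintegral integral_dirac//=.
  by rewrite indicT mulr1.
have i1 : cL1 (@lebesgue_measure R) (fun x => expi (t 0 ord0 * x) * (g1 x)%:C%C).
  apply: (cL1_bdM (M := 1)) => [|x|]; last exact/cL1C/rL1_g1.
    by apply: cM_expi; exact: measurable_funM.
  by rewrite cabs_expi.
have E1 : cI (@lebesgue_measure R) (fun x => expi (t 0 ord0 * x) * (g1 x)%:C%C)
    = (@c0 R * g1 (t 0 ord0))%:C%C.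
  apply: eq_cplx.
    rewrite creC -gauss_cos; apply: eq_Rintegral => x _.
    by rewrite creM creC cimC mulr0 subr0.
  rewrite cimC -(gauss_sin (t 0 ord0)); apply: eq_Rintegral => x _.
  by rewrite cimM creC cimC mulr0 add0r.
pose t' := \row_i t 0 (lift ord0 i).
have := cI_prod i1 (cL1_gs_expi t').
rewrite E1 IH => H; apply: etrans (etrans H _).
  apply: eq_cI => x /=; rewrite dotn_vecS expiD gs_vecS rmorphM /=; ring.
rewrite -rmorphM /= /gs big_ord_recl exprS; congr (_%:C%C).
rewrite mulrACA; congr (_ * (_ * _)).
by apply: eq_bigr => i _; rewrite mxE.
Qed.

Lemma gs_integral n : Rintegral (lebn R n) setT (fun x => gs (vec x)) = @c0 R ^+ n.
Proof.
have := congr1 (@complex.Re R) (gs_fourier (0 : 'rV[R]_n)).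
have -> : gs (0 : 'rV[R]_n) = 1 by rewrite gsE dotn0l mul0r oppr0 expR0.
rewrite mulr1 => H; apply: etrans _ H.
rewrite [RHS]/(Rintegral (lebn R n) setT
  (fun x => cre (expi (dotn 0 (vec x)) * (gs (vec x))%:C%C))).
apply: eq_Rintegral => x _.
by rewrite dotn0l expi0 creM creC cimC mulr0 subr0 mul1r.
Qed.

End Weights.

(** * Fourier inversion for integrable functions with integrable transform *)

Section Octants.
Variables (R : realType) (n : nat).
Implicit Types a b : 'rV[R]_n.

(** Octants are stable under intersection, generate the Borel sets, and have indicators that are
    limits of products of continuous functions of one variable: what a uniqueness argument by
    continuous tests requires. *)
Definition octant a : set (Rn R n) := [set x | forall i, a 0 i < vec x 0 i].

Definition octants : set (set (Rn R n)) := [set A | exists a, A = octant a].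

Lemma octants_setI : setI_closed octants.
Proof.
move=> _ _ [a ->] [b ->]; exists (\row_i Num.max (a 0 i) (b 0 i)).
apply/seteqP; split => x /=.
  by move=> [ha hb] i; rewrite mxE gt_max ha hb.
by move=> h; split => i; have := h i; rewrite mxE gt_max => /andP[].
Qed.

(* The identity from [Rn R n], equipped with the sigma-algebra of the octants, to
   [Rn R n] is measurable because its coordinates are. *)
Lemma sub_octants (E : set (Rn R n)) : measurable E -> (<<s octants >>) E.
Proof.
move=> mE; pose T := g_sigma_algebraType octants.
suff mid : measurable_fun setT (fun x : T => mkRn n (coordn (x : Rn R n)) : Rn R n).
  have := mid measurableT E mE; rewrite setTI.
  rewrite (_ : _ @^-1` E = E)//.
  by apply/seteqP; split => x /=; rewrite mkRn_coordn.
apply: measurable_mkRn => k kn _.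
apply: (measurability _ (RGenOInfty.measurableE R)) => //.
move=> _ [_ [c ->] <-]; rewrite setTI.
pose i0 := Ordinal kn.
(* The half-space [x_i0 > c] is the union over [j] of the octants whose other bounds are [- j]. *)
pose a (j : nat) : 'rV[R]_n := \row_i (if i == i0 then c else - j%:R).
rewrite [X in measurable X](_ : _ = \bigcup_j octant (a j)).
  by apply: bigcupT_measurable => j; apply: sub_sigma_algebra; exists (a j).
apply/seteqP; split => x /=; rewrite in_itv /= andbT.
  move=> cx; pose M := \sum_(i < n) `|vec (x : Rn R n) 0 i|.
  have [j Mj] : exists j : nat, M < j%:R.
    by exists (Num.bound M); apply: archi_boundP; exact: sumr_ge0.
  exists j => // i; rewrite mxE; case: eqP => [->|_]; first by rewrite vecE.
  rewrite ltrNl; apply: le_lt_trans Mj; rewrite (le_trans (ler_norm _))// normrN.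
  by rewrite /M (bigD1 i)//= lerDl sumr_ge0.
by move=> [j _ /(_ i0)]; rewrite mxE eqxx vecE.
Qed.

Lemma measurable_octant a : measurable (octant a).
Proof.
rewrite (_ : octant a = \bigcap_(i in [set: 'I_n]) [set x | a 0 i < vec x 0 i]).
  apply: fin_bigcap_measurable => // i _.
  have := @vmeas_vec1 R n i measurableT `]a 0 i, +oo[%classic (measurable_itv _).
  rewrite setTI; congr measurable.
  by apply/seteqP; split => x /=; rewrite in_itv /= andbT.
by apply/seteqP; split => x /= H i => [_|]; [exact: H|exact: (H i I)].
Qed.

(** Dynkin's argument: the sets over which [h] integrates to zero form a lambda-system, the whole
    space being an increasing union of octants and such unions being handled by dominated
    convergence. All measurable sets then qualify, which forces [h = 0] almost everywhere. *)
Lemma octant_ae0 (h : Rn R n -> R) : rL1 (lebn R n) h ->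
  (forall a, Rintegral (lebn R n) (octant a) h = 0) ->
  {ae lebn R n, forall x, h x = 0}.
Proof.
move=> ih h0; have mh := rL1_meas ih.
pose H := [set E : set (Rn R n) | measurable E /\ Rintegral (lebn R n) E h = 0].
have iE (E : set (Rn R n)) : measurable E -> (lebn R n).-integrable E (EFin \o h).
  by move=> mE; apply: integrableS ih.
have HD : ndseq_closed H.
  move=> F ndF HF; have mF k : measurable (F k) by have [] := HF k.
  have mU : measurable (\bigcup_k F k) by exact: bigcupT_measurable.
  split=> //; rewrite Rintegral_mkcond.
  have cv : (fun k => Rintegral (lebn R n) setT (h \_ (F k))) @ \oo -->
      Rintegral (lebn R n) setT (h \_ (\bigcup_k F k)).
    apply: (rDCT (g := fun x => `|h x|)).
    - by move=> k; apply/(measurable_restrictT _ (mF k)).1; exact: measurable_funTS.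
    - by apply/(measurable_restrictT _ mU).1; exact: measurable_funTS.
    - by move/integrable_abse : ih; apply: eq_integrable.
    - move=> x; apply: cvg_near_cst; have [[j _ Fjx]|nF] := pselect ((\bigcup_k F k) x).
        exists j => // k /= jk; rewrite !patchE !ifT//; apply/mem_set.
          by exists j.
        by move: x Fjx; apply/subsetPset/ndF.
      apply: nearW => k; rewrite !patchE !ifF//; apply/negbTE/negP => /set_mem//.
      by move=> Fkx; apply: nF; exists k.
    - by move=> k x; rewrite patchE; case: ifP => // _; rewrite normr0.
  have E0 : (fun k => Rintegral (lebn R n) setT (h \_ (F k))) = fun=> 0.
    by apply/funext => k; rewrite -Rintegral_mkcond; have [] := HF k.
  by rewrite E0 in cv; apply/esym; apply: (cvg_unique _ (cvg_cst _) cv).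
have Hoct a : H (octant a) by split; [exact: measurable_octant|exact: h0].
have HT : H setT.
  pose b (j : nat) : 'rV[R]_n := \row_i (- j%:R).
  rewrite (_ : setT = \bigcup_j octant (b j)); last first.
    apply/seteqP; split => // x _.
    pose M := \sum_(i < n) `|vec x 0 i|.
    exists (Num.bound M) => // i; rewrite mxE ltrNl.
    apply: le_lt_trans (archi_boundP _); last by rewrite sumr_ge0.
    rewrite (le_trans (ler_norm _))// normrN.
    by rewrite /M (bigD1 i)//= lerDl sumr_ge0.
  apply: HD => // j k jk; apply/subsetPset => x Hx i; apply: le_lt_trans (Hx i).
  by rewrite !mxE lerN2 ler_nat.
have Hlam : lambda_system setT H.
  split => // A B BA [mA A0] [mB B0]; split; first exact: measurableD.
  have := @Rintegral_setU _ _ _ (lebn R n) B (A `\` B) h mB (measurableD mA mB).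
  rewrite setDUK// A0 B0 add0r => <- //; first exact: iE.
  by apply/disj_set2P; rewrite setDE setICA setICr setI0.
have HE E : measurable E -> H E.
  move=> mE; apply: (lambda_system_subset octants_setI Hlam) => //.
    by move=> _ [a ->].
  exact: sub_octants.
have := @integral_ae_eq _ _ _ (lebn R n) setT measurableT (cst 0%E)
  (fun x => (h x)%:E) ih (measurable_cst _).
have HH E : E `<=` setT -> measurable E ->
  (\int[lebn R n]_(x in E) (h x)%:E = \int[lebn R n]_(x in E) (cst 0 x))%E.
  move=> _ mE; have [_ /=] := HE E mE; rewrite integral0 => H0.
  by rewrite -[LHS]fineK ?[fine _]H0//; exact: (integrable_fin_num mE (iE E mE)).
by move=> /(_ HH); apply: filterS => x /(_ I) /= [].
Qed.

End Octants.

(** * Gaussian means of an integrable function *)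

Section Inversion.
Variables (R : realType) (n : nat).
Local Notation l := (lebn R n).
Local Notation C0 := ((@c0 R ^+ n)%:C%C).

Lemma rL1_gs_scale (e : R) : 0 < e -> rL1 l (fun x => gs (e *: vec x)).
Proof.
move=> e0; have := rL1_scale (h := @gs R n) e0 0 (@rL1_gs R n).
by apply: eq_integrable => // x _; rewrite addr0.
Qed.

Lemma gs_fourier_scale (e : R) (t : 'rV[R]_n) : 0 < e ->
  cI l (fun p => expi (dotn t (vec p)) * (gs (e *: vec p))%:C%C) =
  (e ^- n * (@c0 R ^+ n * gs (e^-1 *: t)))%:C%C.
Proof.
move=> e0; rewrite rmorphM /= -gs_fourier.
rewrite -(@cI_scale _ _ _ e0 0 (fun x => expi (dotn (e^-1 *: t) x) * (gs x)%:C%C)).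
  apply: eq_cI => p; rewrite addr0 dotnZl dotnZr mulrA mulVf ?gt_eqF//.
  by rewrite mul1r.
exact: cL1_gs_expi.
Qed.

Variable f : 'rV[R]_n -> R[i].
Hypothesis fi : cintegrable f.

(** The sign is that of the Wigner function and no constant is included, so inversion produces the
    factor [(2 pi)^n]. *)
Definition ft (p : 'rV[R]_n) : R[i] := cint (fun y => expi (dotn p y) * f y).

Let mf : cM (fun x : Rn R n => f (vec x)). Proof. exact: cL1_cM fi. Qed.

Lemma cL1_expi_mul (t : 'rV[R]_n) (g : 'rV[R]_n -> R[i]) : cintegrable g ->
  cL1 l (fun y => expi (dotn t (vec y)) * g (vec y)).
Proof.
move=> gi; apply: (cL1_bdM (M := 1)) => [|x|]; last exact: gi.
  by apply: cM_expi; apply: measurable_dotn; [exact: vmeas_cst|exact: vmeas_vec].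
by rewrite cabs_expi.
Qed.

Lemma cM_ft : cmeasurable ft.
Proof.
have m2 : cM (fun z : Rn R n * Rn R n => expi (dotn (vec z.1) (vec z.2)) * f (vec z.2)).
  apply: cMM; last exact: (cM_comp _ mf).
  by apply: cM_expi; apply: measurable_dotn; apply: vmeas_vec.
exact: (cM_cI2 l m2).
Qed.

Lemma ft_le p : cabs (ft p) <= Rintegral l setT (fun x => cabs (f (vec x))).
Proof.
apply: le_trans (cabs_cI (cL1_expi_mul p fi)) _.
rewrite le_eqVlt; apply/orP; left; apply/eqP.
by apply: eq_Rintegral => x _; rewrite cabsM cabs_expi mul1r.
Qed.

Lemma cL1_ft_gs (y : 'rV[R]_n) (e : R) : 0 < e ->
  cL1 l (fun p => ft (vec p) * expi (- dotn (vec p) y) * (gs (e *: vec p))%:C%C).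
Proof.
move=> e0; apply: (cL1_bdM (M := Rintegral l setT (fun x => cabs (f (vec x))))).
- apply: cMM; first exact: cM_ft.
  apply: cM_expi; apply: measurable_funN.
  by apply: measurable_dotn; [exact: vmeas_vec|exact: vmeas_cst].
- by move=> x; rewrite cabsM cabs_expi mulr1 ft_le.
- exact/cL1C/rL1_gs_scale.
Qed.

(* The right-hand side is, up to a constant, the average of [f] against a Gaussian
   of width [e] centred at [y]. *)
Lemma gauss_mean (y : 'rV[R]_n) (e : R) : 0 < e ->
  cI l (fun p => ft (vec p) * expi (- dotn (vec p) y) * (gs (e *: vec p))%:C%C) =
  C0 * cI l (fun u => f (y + e *: vec u) * (gs (vec u))%:C%C).
Proof.
move=> e0.
pose H (z : Rn R n * Rn R n) := expi (dotn (vec z.1) (vec z.2)) * f (vec z.2) *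
  (expi (- dotn (vec z.1) y) * (gs (e *: vec z.1))%:C%C).
have mH : cM H.
  apply: cMM.
    apply: cMM; last exact: (cM_comp _ mf).
    by apply: cM_expi; apply: measurable_dotn; apply: vmeas_vec.
  apply: cMM.
    apply: cM_expi; apply: measurable_funN.
    by apply: measurable_dotn; [exact: vmeas_vec|exact: vmeas_cst].
  by apply: cMC; apply: measurable_gs; apply: vmeasZ; exact: vmeas_vec.
have iH : cL1 (pmeas l l) H.
  apply: (cL1_prod_le mH (rL1_gs_scale e0) (cL1_cabs fi)) => p y'.
  rewrite /H /= !cabsM !cabs_expi !mul1r cabsC ger0_norm ?gs_ge0//.
  by rewrite mulrC.
transitivity (cI l (fun p => cI l (fun y' => H (p, y')))).
  apply: eq_cI => p; rewrite /H /= cIZr; last exact: cL1_expi_mul.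
  by rewrite mulrA.
rewrite -cFub1// cFub2//.
pose G v := f v * (gs (e^-1 *: (v - y)))%:C%C.
have iG : cintegrable G.
  apply: (cL1_le _ (cL1_cabs fi)) => [|x].
    apply: cMM; first exact: mf.
    apply: cMC; apply: measurable_gs; apply: vmeasZ; apply: vmeasB.
      exact: vmeas_vec.
    exact: vmeas_cst.
  by rewrite cabsM cabsC ger0_norm ?gs_ge0// ler_piMr ?cabs_ge0 ?gs_le1.
transitivity (((e ^- n)%:C%C * C0) * cI l (fun y' => G (vec y'))).
  rewrite -cIZ; last exact: iG.
  apply: eq_cI => y'; rewrite /H /=.
  have -> : (e ^- n)%:C%C * C0 * G (vec y') = f (vec y') *
      (e ^- n * (@c0 R ^+ n * gs (e^-1 *: (vec y' - y))))%:C%C.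
    by rewrite /G !rmorphM /=; ring.
  rewrite -gs_fourier_scale// -cIZ.
    apply: eq_cI => p; rewrite dotnC dotnDl dotnNl expiD (dotnC y).
    by rewrite (dotnC (vec y')); ring.
  apply: (cL1_bdM (M := 1)) => [|x|]; last exact/cL1C/rL1_gs_scale.
    by apply: cM_expi; apply: measurable_dotn; [exact: vmeas_cst|exact: vmeas_vec].
  by rewrite cabs_expi.
rewrite (mulrC _ C0) -mulrA; congr (_ * _).
rewrite -(cI_scale e0 y iG); apply: eq_cI => u.
rewrite /G addrK scalerA mulVf ?gt_eqF// scale1r.
by rewrite addrC.
Qed.

Definition eps (k : nat) : R := k.+1%:R^-1.

Lemma eps_gt0 k : 0 < eps k. Proof. by rewrite invr_gt0 ltr0n. Qed.
Lemma eps_le1 k : eps k <= 1.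
Proof. by rewrite /eps invf_le1 ?ltr0n// ler1n. Qed.

Lemma cvg_eps : eps @ \oo --> (0 : R). Proof. exact: cvg_harmonic. Qed.

Lemma cvg_gs_eps (p : 'rV[R]_n) : (fun k => gs (eps k *: p)) @ \oo --> (1 : R).
Proof.
under eq_fun do rewrite gsE dotnZl dotnZr.
have cv : (fun k => - (eps k * (eps k * dotn p p) / 2)) @ \oo -->
    (- (0 * (0 * dotn p p) / 2) : R).
  apply: cvgN; apply: cvgM; last exact: cvg_cst.
  apply: cvgM; first exact: cvg_eps.
  by apply: cvgM; [exact: cvg_eps|exact: cvg_cst].
rewrite !mul0r oppr0 in cv.
have := cvg_comp _ _ cv (@continuous_expR R 0).
by rewrite expR0.
Qed.

Hypothesis fti : cintegrable ft.

(** A function of [f], not of its transform: [ft] followed by the unnormalized inverse kernel. *)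
Definition ift (y : 'rV[R]_n) : R[i] :=
  cint (fun p => ft p * expi (- dotn p y)).

(** By [gauss_mean] the mean is the inverse integral damped by [gs (eps k *: p)]. The damping tends
    to 1 and [|ft|] dominates, so the means converge at every point although [f] is merely
    integrable. *)
Lemma cvg_gauss_mean (y : 'rV[R]_n) :
  ccvg (fun k => C0 * cI l (fun u => f (y + eps k *: vec u) * (gs (vec u))%:C%C))
    (ift y).
Proof.
have mi : cM (fun p : Rn R n => ft (vec p) * expi (- dotn (vec p) y)).
  apply: cMM; first exact: cM_ft.
  apply: cM_expi; apply: measurable_funN.
  by apply: measurable_dotn; [exact: vmeas_vec|exact: vmeas_cst].
have -> : (fun k => C0 * cI l (fun u => f (y + eps k *: vec u) * (gs (vec u))%:C%C)) =
   (fun k => cI l (fun p => ft (vec p) * expi (- dotn (vec p) y) *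
     (gs (eps k *: vec p))%:C%C)).
  by apply/funext => k; rewrite gauss_mean// eps_gt0.
apply: (cDCT (g := fun p => cabs (ft (vec p)))).
- move=> k; apply: cMM => //; apply: cMC; apply: measurable_gs.
  by apply: vmeasZ; exact: vmeas_vec.
- exact: mi.
- exact: (cL1_cabs fti).
- move=> p; rewrite -[X in ccvg _ X]mulr1; apply: ccvgM; first exact: ccvg_cst.
  exact: (ccvgC (cvg_gs_eps (vec p))).
- move=> k p; rewrite cabsM cabsC cabsM cabs_expi mulr1 ger0_norm ?gs_ge0//.
  by rewrite ler_piMr ?cabs_ge0 ?gs_le1.
Qed.

Lemma cM_ift : cmeasurable ift.
Proof.
have m2 : cM (fun z : Rn R n * Rn R n =>
    ft (vec z.2) * expi (- dotn (vec z.2) (vec z.1))).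
  apply: cMM; first exact: (cM_comp _ cM_ft).
  apply: cM_expi; apply: measurable_funN.
  by apply: measurable_dotn; apply: vmeas_vec.
exact: (cM_cI2 l m2).
Qed.

Let A := Rintegral l setT (fun p => cabs (ft (vec p))).

Lemma ift_le y : cabs (ift y) <= A.
Proof.
apply: cabs_cI_le => [||p]; last by rewrite cabsM cabs_expi mulr1.
  apply: cMM; first exact: cM_ft.
  apply: cM_expi; apply: measurable_funN.
  by apply: measurable_dotn; [exact: vmeas_vec|exact: vmeas_cst].
exact: (cL1_cabs fti).
Qed.

Lemma gauss_mean_le y k :
  cabs (C0 * cI l (fun u => f (y + eps k *: vec u) * (gs (vec u))%:C%C)) <= A.
Proof.
rewrite -gauss_mean ?eps_gt0//; apply: cabs_cI_le => [||p].
- by apply: cL1_cM; apply: cL1_ft_gs; exact: eps_gt0.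
- exact: (cL1_cabs fti).
- rewrite cabsM cabsC cabsM cabs_expi mulr1 ger0_norm ?gs_ge0//.
  by rewrite ler_piMr ?cabs_ge0 ?gs_le1.
Qed.

Section TestFunction.
Variable h : 'rV[R]_n -> R.
Hypothesis mh : measurable_fun setT (fun x : Rn R n => h (vec x)).
Hypothesis h0 : forall v, 0 <= h v.
Hypothesis h1 : forall v, h v <= (wt v)^-1.
Hypothesis ch : forall v u, (fun k => h (v - eps k *: u)) @ \oo --> h v.

Let hle1 v : h v <= 1.
Proof. by apply: le_trans (h1 v) _; rewrite invf_le1 ?wt_gt0 ?wt_ge1. Qed.

Let J k := cI (pmeas l l) (fun z => (h (vec z.1 - eps k *: vec z.2))%:C%C *
  (f (vec z.1) * (gs (vec z.2))%:C%C)).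

Let ifg : cL1 (pmeas l l) (fun z => f (vec z.1) * (gs (vec z.2))%:C%C).
Proof.
apply: (cL1_prod_le _ (cL1_cabs fi) (@rL1_gs R n)) => [|x y].
  apply: cMM; first exact: (cM_comp _ mf).
  by apply: cMC; apply: measurable_gs; exact: vmeas_vec.
by rewrite cabsM cabsC ger0_norm ?gs_ge0.
Qed.

Let shift k := fun z : Rn R n * Rn R n => (unvec (vec z.1 + eps k *: vec z.2), z.2).

Let mpres_shift k : mpres (pmeas l l) (pmeas l l) (shift k).
Proof.
apply: (mpres_shear _ (t := fun u x => unvec (vec x + eps k *: vec u))).
  apply: vmeas_unvec; apply: vmeasD; first exact: vmeas_vec.
  by apply: vmeasZ; exact: vmeas_vec.
by move=> u; exact: mpres_translate.
Qed.

Let mean_J k : cI l (fun y => (h (vec y))%:C%C *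
   (C0 * cI l (fun u => f (vec y + eps k *: vec u) * (gs (vec u))%:C%C))) =
  C0 * J k.
Proof.
pose G (z : Rn R n * Rn R n) := (h (vec z.1))%:C%C *
  (f (vec z.1 + eps k *: vec z.2) * (gs (vec z.2))%:C%C).
have iS : cL1 (pmeas l l)
    (fun z => f (vec z.1 + eps k *: vec z.2) * (gs (vec z.2))%:C%C).
  have := mpres_cL1 (mpres_shift k) ifg.
  by apply: eq_cL1 => z; rewrite /= unvecK.
have iG : cL1 (pmeas l l) G.
  apply: (cL1_bdM (M := 1)) => // [|z].
    by apply: cMC; apply: (vmeas_comp _ mh); exact: vmeas_vec.
  by rewrite cabsC ger0_norm.
have mJ : cM (fun z : Rn R n * Rn R n => (h (vec z.1 - eps k *: vec z.2))%:C%C *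
    (f (vec z.1) * (gs (vec z.2))%:C%C)).
  apply: cMM; last exact: cL1_cM ifg.
  apply: cMC; apply: (vmeas_comp _ mh); apply: vmeasB; first exact: vmeas_vec.
  by apply: vmeasZ; exact: vmeas_vec.
rewrite /J -(mpres_cI (mpres_shift k) mJ).
have -> : cI (pmeas l l) (fun z =>
    (h (vec (shift k z).1 - eps k *: vec (shift k z).2))%:C%C *
    (f (vec (shift k z).1) * (gs (vec (shift k z).2))%:C%C)) =
  cI (pmeas l l) G.
  by apply: eq_cI => z; rewrite /shift /= unvecK addrK.
rewrite cFub1// -cIZ; last exact: cL1_fub1.
apply: eq_cI => y; rewrite mulrCA; congr (_ * _).
rewrite /G /= cIZ//.
have iy : cL1 l (fun u => f (eps k *: vec u + vec y)).
  exact: (cL1_scale (eps_gt0 k) (vec y) fi).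
apply: (cL1_le _ (cL1_cabs iy)) => [|u].
  apply: cMM; last by apply: cMC; apply: measurable_gs; exact: vmeas_vec.
  by have := cL1_cM iy; apply: eq_cM => u; rewrite addrC.
rewrite cabsM cabsC ger0_norm ?gs_ge0// addrC.
by rewrite ler_piMr ?cabs_ge0 ?gs_le1.
Qed.

(** The limit of the means tested against [h] is computed in two ways. Pointwise convergence of the
    means gives the left side. By [mean_J] a translation moves the small shift from [f] to [h],
    which is continuous along it; this gives the right side. Of the two factors [c0 ^+ n] in
    [(2 pi)^n], one comes from [gauss_mean], the other is the mass of [gs]. *)
Lemma test_ift : cI l (fun y => (h (vec y))%:C%C * ift (vec y)) =
  ((2 * pi) ^+ n)%:C%C * cI l (fun y => (h (vec y))%:C%C * f (vec y)).
Proof.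
have c1 : ccvg (fun k => C0 * J k) (cI l (fun y => (h (vec y))%:C%C * ift (vec y))).
  under [X in ccvg X _]eq_fun do rewrite -mean_J.
  apply: (cDCT (g := fun x => A * (wt (vec x))^-1)).
  - move=> k; apply: cMM; first exact: cMC.
    under eq_fun do rewrite -gauss_mean ?eps_gt0//.
    have m2 : cM (fun z : Rn R n * Rn R n => ft (vec z.2) *
        expi (- dotn (vec z.2) (vec z.1)) * (gs (eps k *: vec z.2))%:C%C).
      apply: cMM.
        apply: cMM; first exact: (cM_comp _ cM_ft).
        apply: cM_expi; apply: measurable_funN.
        by apply: measurable_dotn; apply: vmeas_vec.
      by apply: cMC; apply: measurable_gs; apply: vmeasZ; exact: vmeas_vec.
    exact: (cM_cI2 l m2).
  - by apply: cMM; [exact: cMC|exact: cM_ift].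
  - exact: (rL1Z _ (@rL1_wt R n)).
  - by move=> y; apply: ccvgM; [exact: ccvg_cst|exact: cvg_gauss_mean].
  - move=> k y; rewrite cabsM cabsC ger0_norm// mulrC.
    by apply: ler_pM => //; [exact: cabs_ge0|exact: gauss_mean_le].
have c2 : ccvg J (cI (pmeas l l)
    (fun z => (h (vec z.1))%:C%C * (f (vec z.1) * (gs (vec z.2))%:C%C))).
  apply: (cDCT (g := fun z => cabs (f (vec z.1) * (gs (vec z.2))%:C%C))).
  - move=> k; apply: cMM; last exact: cL1_cM ifg.
    apply: cMC; apply: (vmeas_comp _ mh); apply: vmeasB; first exact: vmeas_vec.
    by apply: vmeasZ; exact: vmeas_vec.
  - apply: cMM; last exact: cL1_cM ifg.
    by apply: cMC; apply: (vmeas_comp _ mh); exact: vmeas_vec.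
  - exact: cL1_cabs.
  - by move=> z; apply: ccvgM; [exact: ccvgC|exact: ccvg_cst].
  - by move=> k z; rewrite cabsM cabsC ger0_norm// ler_piMl ?cabs_ge0.
have c3 := ccvgM (ccvg_cst C0) c2.
rewrite (ccvg_unique c1 c3).
have ihf : cL1 l (fun y => (h (vec y))%:C%C * f (vec y)).
  apply: (cL1_bdM (M := 1)) => [|x|]; [exact: cMC| |exact: fi].
  by rewrite cabsC ger0_norm.
have -> : cI (pmeas l l)
      (fun z => (h (vec z.1))%:C%C * (f (vec z.1) * (gs (vec z.2))%:C%C)) =
    cI (pmeas l l)
      (fun z => ((h (vec z.1))%:C%C * f (vec z.1)) * (gs (vec z.2))%:C%C).
  by apply: eq_cI => z; rewrite mulrA.
rewrite (cI_prod ihf (cL1C (@rL1_gs R n))) cIC gs_integral mulrCA mulrC.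
by congr (_ * _); rewrite -rmorphM /= -exprMn -c0_sqr expr2.
Qed.

End TestFunction.

End Inversion.

Lemma cvg_bigprod (R : realType) (I : Type) (r : seq I) (u : I -> nat -> R)
  (lim : I -> R) : (forall i, u i @ \oo --> lim i) ->
  (fun k => \prod_(i <- r) u i k) @ \oo --> \prod_(i <- r) lim i.
Proof.
move=> ul; elim: r => [|i r IH].
  by rewrite big_nil; under eq_fun do rewrite big_nil; exact: cvg_cst.
rewrite big_cons; under eq_fun do rewrite big_cons.
by apply: cvgM; [exact: ul|exact: IH].
Qed.

(** * Test functions approximating octants *)

Section InversionTheorem.
Variables (R : realType) (n : nat).
Local Notation l := (lebn R n).

Definition clip (x : R) : R := Num.min 1 (Num.max 0 x).

Lemma clip_ge0 x : 0 <= clip x.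
Proof. by rewrite le_min ler01 le_max lexx. Qed.

Lemma clip_le1 x : clip x <= 1.
Proof. by rewrite ge_min lexx. Qed.

Lemma clipE0 x : x <= 0 -> clip x = 0.
Proof. by move=> x0; rewrite /clip max_l// min_r. Qed.

Lemma clipE1 x : 1 <= x -> clip x = 1.
Proof. by move=> x1; rewrite /clip max_r ?min_l// (le_trans ler01). Qed.

Lemma clipE x : 0 <= x <= 1 -> clip x = x.
Proof. by move=> /andP[x0 x1]; rewrite /clip max_r// min_r. Qed.

Lemma clip_lip x y : `|clip x - clip y| <= `|x - y|.
Proof.
wlog xy : x y / x <= y.
  move=> H; have [xy|/ltW yx] := leP x y; first exact: H.
  by rewrite distrC (distrC x); exact: H.
rewrite !ler0_norm ?subr_le0//; last first.
  by rewrite /clip le_min2// le_max2.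
have [x0|x0] := leP x 0; have [y0|y0] := leP y 0; have [x1|x1] := leP 1 x;
  have [y1|y1] := leP 1 y; rewrite ?(clipE0 x0) ?(clipE0 y0) ?(clipE1 x1) ?(clipE1 y1)
   ?(clipE (x := x)) ?(clipE (x := y)) ?(ltW x0) ?(ltW y0) ?(ltW x1) ?(ltW y1); lra.
Qed.

Lemma cvg_clip (u : nat -> R) x : u @ \oo --> x ->
  (fun k => clip (u k)) @ \oo --> clip x.
Proof.
move=> ux; apply/cvgrPdist_le => e e0; have /cvgrPdist_le/(_ e e0) := ux.
by apply: filterS => k; apply: le_trans; exact: clip_lip.
Qed.

(** At [x = 0] every term is 0, which matches the strict inequalities of [octant]. *)
Lemma cvg_clip_step (x : R) :
  (fun j : nat => clip (j%:R * x)) @ \oo --> ((0 < x)%R%:R : R).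
Proof.
have [x0|x0] := ltP 0 x; last first.
  apply: cvg_near_cst; apply: nearW => j; apply: clipE0.
  by rewrite mulr_ge0_le0.
apply: cvg_near_cst; near=> j; apply: clipE1.
rewrite -ler_pdivrMr// div1r; near: j; exact: nbhs_infty_ger.
Unshelve. all: end_near. Qed.

Lemma measurable_clip : measurable_fun setT clip.
Proof.
by apply: measurable_minr => //; apply: measurable_maxr.
Qed.

Variable a : 'rV[R]_n.

(* Continuous approximation, as [j] grows, of the indicator of [octant a]; the
   weight makes it integrable. *)
Definition octant_test (j : nat) (v : 'rV[R]_n) : R :=
  (\prod_(i < n) clip (j%:R * (v 0 i - a 0 i))) / wt v.

Lemma octant_test_ge0 j v : 0 <= octant_test j v.
Proof.
by rewrite divr_ge0 ?wt_ge0//; apply: prodr_ge0 => i _; exact: clip_ge0.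
Qed.

Lemma octant_test_le j v : octant_test j v <= (wt v)^-1.
Proof.
rewrite ler_piMl ?invr_ge0 ?wt_ge0//.
rewrite -[leRHS](expr1n R n) -[X in _ ^+ X](card_ord n) -prodr_const.
by apply: ler_prod => i _; rewrite clip_ge0 clip_le1.
Qed.

Lemma measurable_octant_test j :
  measurable_fun setT (fun x : Rn R n => octant_test j (vec x)).
Proof.
apply: measurable_funM; last first.
  by have := measurable_wtXV 1 (@vmeas_vec1 R n); apply: eq_measurable_fun.
apply: measurable_prod => i _; apply: (measurableT_comp measurable_clip).
apply: measurable_funM => //; apply: measurable_funB => //.
exact: vmeas_vec1.
Qed.

Lemma cvg_octant_test_line j v u :
  (fun k => octant_test j (v - eps R k *: u)) @ \oo --> octant_test j v.
Proof.
have cvi (i : 'I_n) : (fun k => (v - eps R k *: u) 0 i) @ \oo --> v 0 i.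
  have H : (fun k => v 0 i - eps R k * u 0 i) @ \oo --> v 0 i - 0 * u 0 i.
    apply: cvgB; first exact: cvg_cst.
    by apply: cvgM; [exact: cvg_eps|exact: cvg_cst].
  rewrite mul0r subr0 in H.
  by under eq_fun do rewrite !mxE.
apply: cvgM.
  apply: cvg_bigprod => i; apply: cvg_clip.
  apply: cvgM; first exact: cvg_cst.
  by apply: cvgB; [exact: cvi|exact: cvg_cst].
apply: cvgV; first by rewrite gt_eqF// wt_gt0.
apply: cvg_bigprod => i; apply: cvgD; first exact: cvg_cst.
by rewrite expr2; apply: cvgM; exact: cvi.
Qed.

Definition octant_ind (v : 'rV[R]_n) : R := \prod_(i < n) (0 < v 0 i - a 0 i)%R%:R.

Lemma cvg_octant_test v : (fun j => octant_test j v) @ \oo --> octant_ind v / wt v.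
Proof.
apply: cvgM; last exact: cvg_cst.
by apply: cvg_bigprod => i; exact: cvg_clip_step.
Qed.

Lemma octant_ind_patch (h : Rn R n -> R) (x : Rn R n) :
  (h \_ (octant a)) x = octant_ind (vec x) * h x.
Proof.
rewrite patchE /octant_ind; case: ifPn => [/set_mem ax|/negP ax].
  by rewrite big1 ?mul1r// => i _; rewrite subr_gt0 ax.
have [i /negP ai] : exists i, ~ (a 0 i < vec x 0 i).
  by apply/existsNP => h'; apply: ax; apply/mem_set.
by rewrite (bigD1 i)//= subr_gt0 (negbTE ai) !mul0r.
Qed.

Lemma measurable_octant_ind : measurable_fun setT (fun x : Rn R n => octant_ind (vec x)).
Proof.
have := measurable_indic (@measurable_octant R n a) => mi.
have : measurable_fun setT (\1_(octant a) : Rn R n -> R) by exact: mi.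
apply: eq_measurable_fun => x _.
have := octant_ind_patch (cst 1) x; rewrite mulr1 => <-.
by rewrite patchE indicE; case: (x \in octant a).
Qed.

Lemma octant_ind_ge0 v : 0 <= octant_ind v.
Proof. by apply: prodr_ge0. Qed.

Lemma octant_ind_le1 v : octant_ind v <= 1.
Proof.
rewrite -[leRHS](expr1n R n) -[X in _ ^+ X](card_ord n) -prodr_const.
by apply: ler_prod => i _; rewrite ler0n /= lern1 leq_b1.
Qed.

End InversionTheorem.

(** * Inversion almost everywhere *)

Section InversionTheorem2.
Variables (R : realType) (n : nat) (f : 'rV[R]_n -> R[i]).
Hypothesis fi : cintegrable f.
Hypothesis fti : cintegrable (ft f).
Local Notation l := (lebn R n).
Local Notation D := (fun v : 'rV[R]_n => ift f v - ((2 * pi) ^+ n)%:C%C * f v).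
(** The weight makes the difference [D] integrable: [ift f] is known only to be bounded, by
    [ift_le]. *)
Local Notation E := (fun x : Rn R n => ((wt (vec x))^-1)%:C%C * D (vec x)).

Let A := Rintegral l setT (fun p => cabs (ft f (vec p))).

Let mw : cM (fun x : Rn R n => ((wt (vec x))^-1)%:C%C).
Proof.
apply: cMC; have := measurable_wtXV 1 (@vmeas_vec1 R n).
by apply: eq_measurable_fun.
Qed.

Let iwf : cL1 l (fun x => ((wt (vec x))^-1)%:C%C * f (vec x)).
Proof.
apply: (cL1_bdM (M := 1)) => [|x|]; [exact: mw| |exact: fi].
rewrite cabsC ger0_norm ?invr_ge0 ?wt_ge0//.
by rewrite invf_le1 ?wt_gt0 ?wt_ge1.
Qed.

Let iwi : cL1 l (fun x => ((wt (vec x))^-1)%:C%C * ift f (vec x)).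
Proof.
apply: (cL1_le _ (rL1Z A (@rL1_wt R n))) => [|x].
  by apply: cMM; [exact: mw|exact: cM_ift].
rewrite cabsM cabsC ger0_norm ?invr_ge0 ?wt_ge0// mulrC.
by rewrite ler_wpM2r ?invr_ge0 ?wt_ge0 ?ift_le.
Qed.

Let iE : cL1 l E.
Proof.
apply: eq_cL1 (cL1D iwi (cL1Z (- ((2 * pi) ^+ n)%:C%C) iwf)) => x.
by rewrite mulrBr mulNr; congr (_ - _); rewrite mulrCA.
Qed.

Let ind_cvg a (g : 'rV[R]_n -> R[i]) : cmeasurable g ->
  cL1 l (fun x => ((wt (vec x))^-1)%:C%C * g (vec x)) ->
  ccvg (fun j => cI l (fun y => (octant_test a j (vec y))%:C%C * g (vec y)))
    (cI l (fun x => (octant_ind a (vec x))%:C%C * (((wt (vec x))^-1)%:C%C * g (vec x)))).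
Proof.
move=> mg ig.
apply: (cDCT (g := fun x => cabs (((wt (vec x))^-1)%:C%C * g (vec x)))).
- by move=> j; apply: cMM => //; apply: cMC; exact: measurable_octant_test.
- by apply: cMM; [apply: cMC; exact: measurable_octant_ind|exact: cL1_cM ig].
- exact: cL1_cabs ig.
- move=> x; rewrite mulrA -rmorphM /=.
  by apply: ccvgM; [apply: ccvgC; exact: cvg_octant_test|exact: ccvg_cst].
- move=> j x; rewrite !cabsM !cabsC ger0_norm ?octant_test_ge0//.
  by rewrite ger0_norm ?invr_ge0 ?wt_ge0// ler_wpM2r ?cabs_ge0 ?octant_test_le.
Qed.

Let cI_oct a : cI l (fun x => (octant_ind a (vec x))%:C%C * E x) = 0.
Proof.
have c1 := ind_cvg a (cM_ift fi) iwi.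
have c2 := ind_cvg a (cL1_cM fi) iwf.
have e j : cI l (fun y => (octant_test a j (vec y))%:C%C * ift f (vec y)) =
    ((2 * pi) ^+ n)%:C%C * cI l (fun y => (octant_test a j (vec y))%:C%C * f (vec y)).
  apply: test_ift => //.
  - exact: measurable_octant_test.
  - exact: octant_test_ge0.
  - exact: octant_test_le.
  - exact: cvg_octant_test_line.
have c3 := ccvgM (ccvg_cst ((2 * pi) ^+ n)%:C%C) c2.
rewrite (_ : (fun j => _) = (fun j =>
    cI l (fun y => (octant_test a j (vec y))%:C%C * ift f (vec y)))) in c3; last first.
  by apply/funext => j; rewrite e.
have H := ccvg_unique c1 c3.
have mo : cM (fun x : Rn R n => (octant_ind a (vec x))%:C%C).
  by apply: cMC; exact: measurable_octant_ind.
have bo (x : Rn R n) : cabs ((octant_ind a (vec x))%:C%C) <= 1.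
  by rewrite cabsC ger0_norm ?octant_ind_ge0 ?octant_ind_le1.
have i1 := cL1_bdM mo bo iwi.
have i2 := cL1_bdM mo bo iwf.
apply: etrans (_ : _ - ((2 * pi) ^+ n)%:C%C * _ = 0); last first.
  by apply/eqP; rewrite subr_eq0; apply/eqP; exact: H.
rewrite -cIZ// -cIB//; last exact: cL1Z.
by apply: eq_cI => x; ring.
Qed.

Let Rint_oct a (h : Rn R n -> R) : Rintegral l (octant a) h =
  Rintegral l setT (fun x => octant_ind a (vec x) * h x).
Proof.
by rewrite Rintegral_mkcond; apply: eq_Rintegral => x _; rewrite octant_ind_patch.
Qed.

(** Letting [j] grow in [test_ift] for [octant_test] shows that the weighted difference integrates
    to zero over every octant; [octant_ae0] applies to its two parts, and the weight does not
    vanish. *)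
Theorem fourier_inversion :
  {ae l, forall x, ift f (vec x) = ((2 * pi) ^+ n)%:C%C * f (vec x)}.
Proof.
have [i1 i2] := iE.
have h1 a : Rintegral l (octant a) (fun x => cre (E x)) = 0.
  have := congr1 (@complex.Re R) (cI_oct a); rewrite Rint_oct => h.
  apply: etrans h; apply: eq_Rintegral => x _.
  by rewrite [RHS]creM creC cimC mul0r subr0.
have h2 a : Rintegral l (octant a) (fun x => cim (E x)) = 0.
  have := congr1 (@complex.Im R) (cI_oct a); rewrite Rint_oct => h.
  apply: etrans h; apply: eq_Rintegral => x _.
  by rewrite [RHS]cimM creC cimC mul0r addr0.
have a1 := octant_ae0 i1 h1.
have a2 := octant_ae0 i2 h2.
apply: filterS2 a1 a2 => x e1 e2.
have : E x = 0 by apply: eq_cplx.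
move=> /eqP; rewrite mulf_eq0 => /orP[/eqP /(congr1 (@complex.Re R)) /= /eqP|].
  by rewrite invr_eq0 gt_eqF ?wt_gt0.
by rewrite subr_eq0 => /eqP.
Qed.

End InversionTheorem2.

(** * Rapid decay *)

Section RapidDecay.
Variables (R : realType) (m : nat).
Implicit Types (F : 'rV[R]_m -> R[i]).
Local Notation l := (lebn R m).

(** Bounds at every point, unlike [rapidly_decaying_ae]; powers of [wt] dominate all monomials, by
    [monom_wt]. *)
Definition rapid F := forall N : nat,
  exists2 C, 0 < C & forall v, cabs (F v) <= C / wt v ^+ N.

Lemma rapid_cL1 F : cmeasurable F -> rapid F -> cintegrable F.
Proof.
move=> mF rF; have [C C0 HC] := rF 1.
by apply: (cL1_le mF (rL1Z C (@rL1_wt R m))) => x.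
Qed.

Lemma rapid_scale (c : R[i]) F : rapid F -> rapid (fun v => c * F v).
Proof.
move=> rF N; have [C C0 HC] := rF N.
exists ((cabs c + 1) * C) => [|v].
  by rewrite mulr_gt0// ltr_pwDr// cabs_ge0.
rewrite cabsM -mulrA; apply: ler_pM; rewrite ?cabs_ge0//.
by rewrite lerDl.
Qed.

Lemma monomD (a : 'I_m -> nat) (i : 'I_m) (z : 'rV[R]_m) :
  monom (fun j => (a j + (if j == i then 2 else 0))%N) z =
  monom a z * z 0 i ^+ 2.
Proof.
rewrite /monom; under eq_bigr do rewrite exprD.
rewrite big_split /=; congr (_ * _).
by rewrite (bigD1 i)//= eqxx big1 ?mulr1// => j /negbTE ->; rewrite expr0.
Qed.

(** Rather than expanding [wt ^+ N] into monomials, [Q q] records that [q * F] is almost everywhere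
    bounded against every monomial. This survives multiplication of [q] by [1 + v_i^2], at the cost
    of raising one exponent by 2. *)
Lemma rapid_ae_wt F : rapidly_decaying_ae F -> forall N, exists C,
  {ae l, forall x, wt (vec x) ^+ N * cabs (F (vec x)) <= C}.
Proof.
move=> dF.
pose Q (q : 'rV[R]_m -> R) := (forall v, 0 <= q v) /\
  forall a : 'I_m -> nat, exists C,
  {ae l, forall x, `|monom a (vec x)| * q (vec x) * cabs (F (vec x)) <= C}.
have Q1 : Q (fun=> 1).
  split=> // a; have [C HC] := dF a; exists C; apply: filterS HC => x.
  by rewrite cabsM cabsC mulr1.
have Qi q i : Q q -> Q (fun v => (1 + v 0 i ^+ 2) * q v).
  move=> [q0 Hq]; split=> [v|a]; first by rewrite mulr_ge0// ltW// wt1_gt0.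
  have [C1 H1] := Hq a.
  have [C2 H2] := Hq (fun j => (a j + (if j == i then 2 else 0))%N).
  exists (C1 + C2); apply: filterS2 H1 H2 => x h1 h2.
  rewrite monomD normrM (ger0_norm (sqr_ge0 _)) in h2.
  by apply: le_trans (lerD h1 h2); rewrite le_eqVlt; apply/orP; left; apply/eqP; ring.
have Qw q : Q q -> Q (fun v => wt v * q v).
  move=> Hq; rewrite /wt; elim: (index_enum _) => [|i r IH].
    by under [X in Q X]eq_fun do rewrite big_nil mul1r.
  under [X in Q X]eq_fun do rewrite big_cons -mulrA.
  exact: Qi.
have QN N : Q (fun v => wt v ^+ N).
  elim: N => [|N IH]; first by [].
  by under [X in Q X]eq_fun do rewrite exprS; exact: Qw.
move=> N; have [_ /(_ (fun=> 0%N))[C HC]] := QN N; exists C.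
apply: filterS HC => x; rewrite /monom.
by under eq_bigr do rewrite expr0; rewrite big1_eq normr1 mul1r.
Qed.

(** [F] is cut off to the set [G] where all the bounds hold at once; there are countably many, so
    [G] is measurable and has full measure. *)
Lemma rapid_version F : cmeasurable F -> rapidly_decaying_ae F ->
  exists F0, [/\ cmeasurable F0, rapid F0 &
    {ae l, forall x, F (vec x) = F0 (vec x)}].
Proof.
move=> mF dF; have [C HC] := choice (rapid_ae_wt dF).
pose G := [set x : Rn R m | forall N, wt (vec x) ^+ N * cabs (F (vec x)) <= C N].
have mG : measurable G.
  rewrite (_ : G = \bigcap_N [set x | wt (vec x) ^+ N * cabs (F (vec x)) <= C N]).
    apply: bigcapT_measurable => N.
    have mN : measurable_fun setT
        (fun x : Rn R m => wt (vec x) ^+ N * cabs (F (vec x))).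
      apply: measurable_funM; last exact: measurable_cabs.
      by apply: measurable_funX; apply: measurable_wt; exact: vmeas_vec.
    have := mN measurableT `]-oo, C N]%classic (measurable_itv _).
    by rewrite setTI; congr measurable; apply/seteqP; split => x /=; rewrite in_itv.
  by apply/seteqP; split => x /= H N => [_|]; [exact: H|exact: (H N I)].
pose F0 v := ((\1_G (unvec v) : R)%:C%C * F v).
have F0E (x : Rn R m) : F0 (vec x) = (\1_G x : R)%:C%C * F (vec x).
  by rewrite /F0 vecK.
exists F0; split.
- apply: (eq_cM (fun x => esym (F0E x))); apply: cMM => //.
  by apply: cMC; exact: measurable_indic.
- move=> N; exists (`|C N| + 1) => [|v]; first by rewrite ltr_pwDr.
  rewrite -(unvecK v) F0E cabsM cabsC ler_pdivlMr ?wtX_gt0//.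
  rewrite indicE; have [/set_mem Gv|_] := boolP (_ \in G).
    rewrite normr1 mul1r mulrC; apply: le_trans (Gv N) _.
    by rewrite (le_trans (ler_norm _))// lerDl.
  by rewrite normr0 !mul0r addr_ge0.
- have HA : {ae l, forall x, forall N, wt (vec x) ^+ N * cabs (F (vec x)) <= C N}.
    by apply/ae_foralln => N; exact: HC.
  apply: filterS HA => x Gx; rewrite F0E indicE mem_set ?mul1r//.
Qed.

Lemma monom_wt (a : 'I_m -> nat) (v : 'rV[R]_m) :
  `|monom a v| <= wt v ^+ (\max_i a i).
Proof.
rewrite /monom normr_prod /wt -prodrXl; apply: ler_prod => i _.
rewrite normr_ge0 /= normrX.
apply: (@le_trans _ _ ((1 + v 0 i ^+ 2) ^+ a i)).
  apply: lerXn2r; rewrite ?nnegrE ?(ltW (wt1_gt0 _))//.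
  have := sqr_ge0 (`|v 0 i| - 1); rewrite -(real_normK (num_real (v 0 i))); nra.
by apply: ler_weXn2l; [exact: wt1_ge1|exact: leq_bigmax].
Qed.

(** Were [P] false everywhere, the whole space would be null and the Gaussian would have integral
    zero. *)
Lemma ae_ex (P : Rn R m -> Prop) : {ae l, forall x, P x} -> exists x, P x.
Proof.
move=> HP; apply: contrapT => /forallNP nP.
have : Rintegral l setT (fun x => gs (vec x)) = Rintegral l setT (fun=> 0).
  apply: ae_eq_Rintegral; [exact: rL1_meas (@rL1_gs R m)|exact: measurable_cst|].
  by apply: filterS HP => x /(nP x).
rewrite gs_integral /Rintegral integral0 /= => /eqP.
by rewrite gt_eqF// exprn_gt0// c0_gt0.
Qed.

End RapidDecay.

(** * The positive form defined by the kernel *)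

Section WignerKernel.
Variables (R : realType) (n : nat) (K : 'rV[R]_n -> 'rV[R]_n -> R[i]).
Local Notation l := (lebn R n).
Local Notation E := (Rn R n).
Hypothesis mK : kmeasurable K.

Let cMK : cM (fun z : E * E => K (vec z.1) (vec z.2)). Proof. exact: mK. Qed.

Lemma cM_kernel d (T : measurableType d) (f g : T -> 'rV[R]_n) :
  vmeas f -> vmeas g -> cM (fun t => K (f t) (g t)).
Proof.
move=> mf mg.
have mfg : measurable_fun setT (fun t => (unvec (f t), unvec (g t)) : E * E).
  by apply: measurable_fun_pair; exact: vmeas_unvec.
by apply: eq_cM (cM_comp mfg cMK) => t /=; rewrite !unvecK.
Qed.

Definition centered (z : E * E) : R[i] :=
  K (vec z.1 - 2^-1 *: vec z.2) (vec z.1 + 2^-1 *: vec z.2).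

Lemma cM_centered : cM centered.
Proof.
apply: cM_kernel; [apply: vmeasB|apply: vmeasD]; try exact: vmeas_vec.
  by apply: vmeasZ; exact: vmeas_vec.
by apply: vmeasZ; exact: vmeas_vec.
Qed.

Lemma cM_wigner : cmeasurable (wigner K).
Proof.
pose H (z : Rn R (n + n) * E) := expi (dotn (ppart (vec z.1)) (vec z.2)) *
  K (xpart (vec z.1) - 2^-1 *: vec z.2) (xpart (vec z.1) + 2^-1 *: vec z.2).
have mx : vmeas (fun z : Rn R (n + n) * E => xpart (vec z.1)).
  by apply: vmeas_lsub; exact: vmeas_vec.
have mp : vmeas (fun z : Rn R (n + n) * E => ppart (vec z.1)).
  by apply: vmeas_rsub; exact: vmeas_vec.
have my : vmeas (fun z : Rn R (n + n) * E => vec z.2) by exact: vmeas_vec.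
have mH : cM H.
  apply: cMM; first by apply: cM_expi; exact: measurable_dotn.
  by apply: cM_kernel; [apply: vmeasB|apply: vmeasD] => //; exact: vmeasZ.
apply: cMM; first exact: cM_cst.
exact: (cM_cI2 l mH).
Qed.

Hypothesis iW : {ae lebn R (n + n), forall z : Rn R (n + n),
  cintegrable (wigner_integrand K (vec z))}.

Variable W0 : 'rV[R]_(n + n) -> R[i].
Hypothesis mW0 : cmeasurable W0.
Hypothesis rW0 : rapid W0.
Hypothesis eW0 : {ae lebn R (n + n), forall z, wigner K (vec z) = W0 (vec z)}.

Lemma cM_W0 d (T : measurableType d) (f g : T -> 'rV[R]_n) :
  vmeas f -> vmeas g -> cM (fun t => W0 (row_mx (f t) (g t))).
Proof. by move=> mf mg; apply: (vmeas_cM _ mW0); exact: vmeas_row. Qed.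

(** No constant appears: the [(2 pi)^-n] of [wigner] is exactly the inversion constant on R^n. *)
Definition partial_ift (z : E * E) : R[i] :=
  cI l (fun p => W0 (row_mx (vec z.1) (vec p)) * expi (- dotn (vec p) (vec z.2))).

Lemma cM_partial_ift : cM partial_ift.
Proof.
have m2 : cM (fun w : (E * E) * E => W0 (row_mx (vec w.1.1) (vec w.2)) *
    expi (- dotn (vec w.2) (vec w.1.2))).
  apply: cMM.
    apply: cM_W0; apply: vmeas_vec => //.
    exact: (measurableT_comp measurable_fst).
  apply: cM_expi; apply: measurable_funN; apply: measurable_dotn.
    exact: vmeas_vec.
  by apply: vmeas_vec; exact: (measurableT_comp measurable_snd).
exact: (cM_cI2 l m2).
Qed.

Lemma W0_row_le N : exists2 C, 0 < C & forall x p : 'rV[R]_n,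
  cabs (W0 (row_mx x p)) <= C * ((wt x ^+ N)^-1 * (wt p ^+ N)^-1).
Proof.
have [C C0 HC] := rW0 N; exists C => // x p.
by apply: le_trans (HC _) _; rewrite wt_row exprMn invfM.
Qed.

Lemma cL1_W0_row (x : 'rV[R]_n) : cL1 l (fun p => W0 (row_mx x (vec p))).
Proof.
have [C C0 HC] := W0_row_le 1.
apply: (cL1_le _ (rL1Z C (@rL1_wt R n))) => [|p].
  by apply: cM_W0; [exact: vmeas_cst|exact: vmeas_vec].
apply: le_trans (HC _ _) _; rewrite ler_pM2l// ler_piMl ?invr_ge0 ?wt_ge0//.
by rewrite invf_le1 ?wt_gt0 ?wt_ge1.
Qed.

Lemma partial_ift_le : exists M, forall z, cabs (partial_ift z) <= M.
Proof.
have [C C0 HC] := W0_row_le 1.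
exists (Rintegral l setT (fun p => C * (wt (vec p))^-1)) => z.
apply: cabs_cI_le.
- apply: cMM; first exact: cL1_cM (cL1_W0_row _).
  apply: cM_expi; apply: measurable_funN.
  by apply: measurable_dotn; [exact: vmeas_vec|exact: vmeas_cst].
- exact: (rL1Z C (@rL1_wt R n)).
- move=> p; rewrite cabsM cabs_expi mulr1.
  apply: le_trans (HC _ _) _; rewrite ler_pM2l// ler_piMl ?invr_ge0 ?wt_ge0//.
  by rewrite invf_le1 ?wt_gt0 ?wt_ge1.
Qed.

(* Fourier inversion in the second variable, for almost every first variable. *)
Lemma ae_centered : {ae pmeas l l, forall z, centered z = partial_ift z}.
Proof.
apply: ae_of_sections.
  exact: measurable_ceq cM_centered cM_partial_ift.
have s1 := ae_sections (mpres_ae (mpres_unsplit R n n) iW).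
have s2 := ae_sections (mpres_ae (mpres_unsplit R n n) eW0).
apply: filterS2 s1 s2 => X h1 h2.
(* Integrability at a single momentum suffices: the integrands at two momenta differ by a factor of
   modulus one. *)
have {h1}[p0] := ae_ex h1; rewrite unvecK /= => ip0.
pose f (y : 'rV[R]_n) := K (vec X - 2^-1 *: y) (vec X + 2^-1 *: y).
have fi : cintegrable f.
  have := cL1_expi_mul (- vec p0) ip0; apply: eq_cL1 => y.
  rewrite /wigner_integrand /xpart /ppart row_mxKl row_mxKr mulrA -expiD.
  by rewrite dotnNl addNr expi0 mul1r.
have twopi : ((2 * pi : R) ^+ n) != 0.
  by rewrite expf_neq0// mulf_neq0// gt_eqF ?pi_gt0.
have ftE p : ft f p = ((2 * pi) ^+ n)%:C%C * wigner K (row_mx (vec X) p).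
  rewrite /wigner mulrA -rmorphM /= divff// mul1r; apply: eq_cI => y.
  by rewrite /wigner_integrand /xpart /ppart row_mxKl row_mxKr.
have ae_ft : {ae l, forall p, ft f (vec p) =
    ((2 * pi) ^+ n)%:C%C * W0 (row_mx (vec X) (vec p))}.
  by apply: filterS h2 => p /=; rewrite unvecK ftE => ->.
have fti : cintegrable (ft f).
  have := cL1Z ((2 * pi) ^+ n)%:C%C (cL1_W0_row (vec X)).
  apply: ae_eq_cL1; first exact: cM_ft.
  by apply: filterS ae_ft => p ->.
apply: filterS (fourier_inversion fi fti) => Y.
have -> : ift f (vec Y) = ((2 * pi) ^+ n)%:C%C * partial_ift (X, Y).
  have mY : cM (fun p : E => expi (- dotn (vec p) (vec Y))).
    apply: cM_expi; apply: measurable_funN.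
    by apply: measurable_dotn; [exact: vmeas_vec|exact: vmeas_cst].
  rewrite -cIZ.
    apply: ae_eq_cI.
    - by apply: cMM; [exact: cM_ft|exact: mY].
    - apply: cMM; first exact: cM_cst.
      by apply: cMM; [exact: cL1_cM (cL1_W0_row _)|exact: mY].
    - by apply: filterS ae_ft => p ->; rewrite mulrA.
  apply: eq_cL1 (cL1_bdM (M := 1) mY _ (cL1_W0_row (vec X))) => p.
    by rewrite mulrC.
  by rewrite cabs_expi.
have t0 : ((2 * pi : R) ^+ n)%:C%C != 0.
  apply: contra twopi => /eqP /(congr1 (@complex.Re R)) /= h.
  by apply/eqP.
by move=> /(mulfI t0) ->.
Qed.

(** [partial_ift] is bounded and the midpoint coordinates preserve null sets. Through this bound the
    double integral [sesq] converges absolutely for integrable arguments. *)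
Lemma ae_kernel_le : exists M, {ae pmeas l l, forall z : E * E,
  cabs (K (vec z.1) (vec z.2)) <= M}.
Proof.
have [M HM] := partial_ift_le; exists M.
apply: filterS (mpres_ae (mpres_wigner_inv R n) ae_centered) => z e.
apply: le_trans (HM (unvec (2^-1 *: (vec z.1 + vec z.2)), unvec (vec z.2 - vec z.1))).
rewrite -e /centered /= !unvecK le_eqVlt; apply/orP; left; apply/eqP.
congr (cabs (K _ _)); apply/rowP => i; rewrite !mxE; lra.
Qed.

(* [<phi, rho psi>], written as a double integral. *)
Definition sesq (phi psi : 'rV[R]_n -> R[i]) : R[i] :=
  cI (pmeas l l) (fun z => (phi (vec z.1))^*%C * K (vec z.1) (vec z.2) * psi (vec z.2)).

(** A class inside both L^1, for Fubini, and L^2, for positivity, stable under the combinations that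
    Cauchy-Schwarz tests. *)
Definition testlike (phi : 'rV[R]_n -> R[i]) := cmeasurable phi /\
  exists C, forall v, cabs (phi v) <= C * (wt v)^-1.

Lemma testlike_cL1 phi : testlike phi -> cintegrable phi.
Proof.
move=> [mphi [C HC]].
by apply: (cL1_le mphi (rL1Z C (@rL1_wt R n))) => x; exact: HC.
Qed.

Lemma cL1_sesq phi psi : testlike phi -> testlike psi ->
  cL1 (pmeas l l)
    (fun z => (phi (vec z.1))^*%C * K (vec z.1) (vec z.2) * psi (vec z.2)).
Proof.
move=> tp ts; have [M HM] := ae_kernel_le.
have ip := cL1_cabs (testlike_cL1 tp); have js := cL1_cabs (testlike_cL1 ts).
apply: (cL1_ae_le _ (rL1Z M (rL1_prod ip js))).
  apply: cMM; last exact: (cM_comp _ ts.1).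
  by apply: cMM; [apply: cMJ; exact: (cM_comp _ tp.1)|exact: cMK].
apply: filterS HM => z hM; rewrite !cabsM cabsJ mulrAC mulrC.
by apply: ler_wpM2r => //; rewrite mulr_ge0 ?cabs_ge0.
Qed.

Lemma testlikeD phi psi (c : R[i]) : testlike phi -> testlike psi ->
  testlike (fun v => phi v + c * psi v).
Proof.
move=> [mp [C1 H1]] [ms [C2 H2]]; split.
  by apply: cMD => //; apply: cMM => //; exact: cM_cst.
exists (C1 + cabs c * C2) => v; apply: le_trans (cabsD _ _) _.
rewrite mulrDl; apply: lerD; first exact: H1.
by rewrite cabsM -mulrA ler_wpM2l ?cabs_ge0.
Qed.

Hypothesis psdK : psd_kernel K.

Lemma testlike_L2 phi : testlike phi -> L2 phi.
Proof.
move=> [mp [C HC]]; split => //.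
apply: (rL1_le _ (rL1Z (C ^+ 2) (@rL1_wt R n))) => [|x].
  by apply: measurable_funX; exact: measurable_cabs.
rewrite ger0_norm ?sqr_ge0//.
have w1 : (wt (vec x))^-1 <= 1 by rewrite invf_le1 ?wt_gt0 ?wt_ge1.
have w0 : 0 <= (wt (vec x))^-1 by rewrite invr_ge0 wt_ge0.
apply: (@le_trans _ _ ((C * (wt (vec x))^-1) ^+ 2)).
  by apply: lerXn2r; rewrite ?nnegrE ?cabs_ge0// (le_trans (cabs_ge0 _) (HC _)).
by rewrite exprMn expr2 ler_wpM2l ?sqr_ge0// expr2 ler_piMl.
Qed.

(** Fubini turns the double integral into the one in [psd_kernel]; the factor [(phi x)^*] leaves the
    inner integral for almost every [x], those where [psd_kernel] grants integrability. *)
Lemma sesq_ge0 phi : testlike phi -> 0 <= sesq phi phi.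
Proof.
move=> tp; have [_ H] := psdK; have [iK [mKp _] pos] := H _ (testlike_L2 tp).
have js := cL1_sesq tp tp.
suff -> : sesq phi phi = cint (fun x => (phi x)^*%C * kop K phi x) by [].
rewrite /sesq cFub1//; apply: ae_eq_cI.
- exact: cL1_cM (cL1_fub1 js).
- by apply: cMM; [apply: cMJ; exact: tp.1|exact: mKp].
- apply: filterS iK => x ix; rewrite /kop /= -[RHS]cIZ//.
  by apply: eq_cI => y; rewrite mulrA.
Qed.

Lemma sesq_expand phi psi c : testlike phi -> testlike psi ->
  sesq (fun v => phi v + c * psi v) (fun v => phi v + c * psi v) =
  sesq phi phi + c * sesq phi psi + c^*%C * sesq psi phi + c * c^*%C * sesq psi psi.
Proof.
move=> tp ts.
have i1 := cL1_sesq tp tp; have i2 := cL1Z c (cL1_sesq tp ts).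
have i3 := cL1Z (c^*%C) (cL1_sesq ts tp); have i4 := cL1Z (c * c^*%C) (cL1_sesq ts ts).
rewrite /sesq -!cIZ; try exact: cL1_sesq.
rewrite -(cID i1 i2) -(cID (cL1D i1 i2) i3) -(cID (cL1D (cL1D i1 i2) i3) i4).
by apply: eq_cI => z; rewrite rmorphD rmorphM /=; ring.
Qed.

Lemma sesq_CS phi psi : testlike phi -> testlike psi ->
  cabs (sesq phi psi) ^+ 2 <= cre (sesq phi phi) * cre (sesq psi psi).
Proof.
move=> tp ts; apply: (psd_CS (b' := sesq psi phi)); try exact: sesq_ge0.
by move=> c; rewrite -sesq_expand//; apply: sesq_ge0; exact: testlikeD.
Qed.

End WignerKernel.

(** * Coherent states *)

Section WeightBounds.
Variables (R : realType) (n : nat).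
Implicit Types u v : 'rV[R]_n.

(** Peetre's inequality in the form that trades decay at two points for decay at their sum. *)
Lemma wt_peetreV N u v : (wt u ^+ N)^-1 * (wt v ^+ N)^-1 <=
  (2 ^+ n) ^+ N * (wt (u + v) ^+ N)^-1.
Proof.
rewrite -invfM -exprMn ler_pdivlMr ?wtX_gt0// mulrC ler_pdivrMr; last first.
  by rewrite exprn_gt0// mulr_gt0 ?wt_gt0.
rewrite -exprMn; apply: lerXn2r; rewrite ?nnegrE ?wt_ge0 ?wt_peetre//.
by rewrite mulr_ge0 ?mulr_ge0 ?wt_ge0// exprn_ge0.
Qed.

Lemma wtVX_ge0 N v : 0 <= (wt v ^+ N)^-1.
Proof. by rewrite invr_ge0 exprn_ge0 ?wt_ge0. Qed.

Lemma wtVX_le1 N v : (wt v ^+ N)^-1 <= 1.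
Proof. by rewrite invf_le1 ?wtX_gt0 ?wtX_ge1. Qed.

Lemma dotn_ge0 v : 0 <= dotn v v.
Proof. by apply: sumr_ge0 => i _; rewrite -expr2 sqr_ge0. Qed.

Lemma expR_nsq_le v : expR (- dotn v v) <= gs v.
Proof. rewrite gsE ler_expR; have := dotn_ge0 v; lra. Qed.

(** The parallelogram identity: the squared norms add up to [2 |u|^2 + |v|^2 / 2], without cross
    terms. *)
Lemma expR_nsq_pair u v : expR (- dotn (u - 2^-1 *: v) (u - 2^-1 *: v)) *
  expR (- dotn (u + 2^-1 *: v) (u + 2^-1 *: v)) = gs (2 *: u) * gs v.
Proof.
rewrite !gsE -!expRD; congr expR.
rewrite !(dotnDl, dotnDr, dotnNl, dotnNr, dotnZl, dotnZr) (dotnC v u); lra.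
Qed.

Lemma gs_fourier_translate (t d : 'rV[R]_n) :
  cI (lebn R n) (fun y => (gs (vec y - d))%:C%C * expi (dotn t (vec y))) =
  expi (dotn t d) * (@c0 R ^+ n * gs t)%:C%C.
Proof.
rewrite -gs_fourier.
have mF : cmeasurable (fun v => (gs (v - d))%:C%C * expi (dotn t v)).
  apply: cMM.
    apply: cMC; apply: measurable_gs; apply: vmeasB; first exact: vmeas_vec.
    exact: vmeas_cst.
  by apply: cM_expi; apply: measurable_dotn; [exact: vmeas_cst|exact: vmeas_vec].
apply: etrans (esym (cI_translate d mF)) _.
rewrite -[RHS]cIZ; last exact: cL1_gs_expi.
by apply: eq_cI => y; rewrite addrK dotnDr expiD; ring.
Qed.

Lemma rL1_gs_affine (c : R) (a : 'rV[R]_n) : 0 < c ->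
  rL1 (lebn R n) (fun x => gs (c *: (vec x - a))).
Proof.
move=> c0; have := rL1_scale (h := @gs R n) c0 (- (c *: a)) (@rL1_gs R n).
by apply: eq_integrable => // x _; rewrite scalerBr.
Qed.

End WeightBounds.

Section CoherentStates.
Variables (R : realType) (n : nat) (K : 'rV[R]_n -> 'rV[R]_n -> R[i]).
Local Notation l := (lebn R n).
Local Notation E := (Rn R n).
Local Notation C0 := ((@c0 R ^+ n)%:C%C).
Local Notation phase := 'rV[R]_(n + n).

(* An unnormalized Gaussian wave packet with position [lsubmx z] and momentum
   [rsubmx z]. *)
Definition coh (z : phase) : 'rV[R]_n -> R[i] := fun x =>
  (expR (- dotn (x - lsubmx z) (x - lsubmx z)))%:C%C * expi (dotn (rsubmx z) x).

Lemma coh_testlike (z : phase) : testlike (coh z).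
Proof.
split.
  apply: cMM; last first.
    by apply: cM_expi; apply: measurable_dotn; [exact: vmeas_cst|exact: vmeas_vec].
  apply: cMC; apply: measurableT_comp => //; apply: measurable_funN.
  by apply: measurable_dotn; apply: vmeasB; try exact: vmeas_vec; exact: vmeas_cst.
have [C C0 HC] := gs_wt R n 1.
exists (C * wt (lsubmx z) * 2 ^+ n) => v.
rewrite cabsM cabs_expi mulr1 cabsC ger0_norm ?expR_ge0//.
apply: le_trans (expR_nsq_le _) _; apply: le_trans (HC _) _.
have := wt_peetreV 1 (v - lsubmx z) (lsubmx z); rewrite subrK !expr1.
rewrite -!mulrA ler_pM2l// => H.
by rewrite -ler_pdivrMl ?wt_gt0// mulrC.
Qed.

(* Up to a constant, the Wigner function of [coh 0]. *)
Definition gs2 (z : phase) : R := gs (2 *: lsubmx z) * gs (rsubmx z).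

Definition symp (de z : phase) : R :=
  dotn (rsubmx de) (lsubmx z) - dotn (lsubmx de) (rsubmx z).

(** In midpoint coordinates the product of two packets separates: in [X] it is centred at the
    midpoint [mu] and oscillates with the momentum difference, in [Y] it is centred at the
    displacement and oscillates with the mean momentum. *)
Lemma coh_prod (z de : phase) (X Y : 'rV[R]_n) : let mu := z + 2^-1 *: de in
  (coh z (X - 2^-1 *: Y))^*%C * coh (z + de) (X + 2^-1 *: Y) =
  (gs (2 *: (X - lsubmx mu)) * gs (Y - lsubmx de))%:C%C *
   expi (dotn (rsubmx de) X + dotn (rsubmx mu) Y).
Proof.
move=> mu; rewrite -expR_nsq_pair /coh cJM. rewrite !cJC -expiN.
have -> : X - lsubmx mu - 2^-1 *: (Y - lsubmx de) = X - 2^-1 *: Y - lsubmx z.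
  by apply/rowP => i; rewrite !mxE; lra.
have -> : X - lsubmx mu + 2^-1 *: (Y - lsubmx de) = X + 2^-1 *: Y - lsubmx (z + de).
  by apply/rowP => i; rewrite !mxE; lra.
have -> : dotn (rsubmx de) X + dotn (rsubmx mu) Y =
    - dotn (rsubmx z) (X - 2^-1 *: Y) + dotn (rsubmx (z + de)) (X + 2^-1 *: Y).
  rewrite /mu !linearD /= linearZ /=.
  by rewrite !(dotnDl, dotnDr, dotnNl, dotnNr, dotnZl, dotnZr); field.
by rewrite expiD rmorphM /=; ring.
Qed.

Hypothesis mK : kmeasurable K.
Hypothesis iW : {ae lebn R (n + n), forall z : Rn R (n + n),
  cintegrable (wigner_integrand K (vec z))}.
Variable W0 : 'rV[R]_(n + n) -> R[i].
Hypothesis mW0 : cmeasurable W0.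
Hypothesis rW0 : rapid W0.
Hypothesis eW0 : {ae lebn R (n + n), forall z, wigner K (vec z) = W0 (vec z)}.

(** A windowed Fourier transform of [W0]: Gaussian window at [mu], frequency given by the symplectic
    pairing with [de]. *)
Definition smeared (de mu : phase) : R[i] :=
  cint (fun z => W0 z * (gs2 (z - mu))%:C%C * expi (symp de z)).

Let rL1_W0 : rL1 (pmeas l l) (fun z => cabs (W0 (row_mx (vec z.1) (vec z.2)))).
Proof.
have := mpres_rL1 (mpres_unsplit R n n) (cL1_cabs (rapid_cL1 mW0 rW0)).
by apply: eq_integrable => // z _; rewrite unvecK.
Qed.

Lemma cM_smeared_integrand (de mu : phase) :
  cmeasurable (fun z => W0 z * (gs2 (z - mu))%:C%C * expi (symp de z)).
Proof.
apply: cMM.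
  apply: cMM; first exact: mW0.
  apply: cMC; apply: measurable_funM; apply: measurable_gs.
    apply: vmeasZ; apply: vmeas_lsub; apply: vmeasB; first exact: vmeas_vec.
    exact: vmeas_cst.
  by apply: vmeas_rsub; apply: vmeasB; [exact: vmeas_vec|exact: vmeas_cst].
apply: cM_expi; apply: measurable_funB; apply: measurable_dotn; try exact: vmeas_cst.
  by apply: vmeas_lsub; exact: vmeas_vec.
by apply: vmeas_rsub; exact: vmeas_vec.
Qed.

(** In midpoint coordinates the kernel becomes [partial_ift], an integral over the momentum [p].
    Doing the [Y] integral before the [p] integral leaves a Gaussian Fourier integral; its value
    contains [gs (b - p)], the momentum half of the window, and the phase that completes [symp]. *)
Lemma sesq_coh (z de : phase) : let mu := z + 2^-1 *: de in
  sesq K (coh z) (coh (z + de)) =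
  C0 * expi (dotn (rsubmx mu) (lsubmx de)) * smeared de mu.
Proof.
move=> mu; set a := lsubmx mu; set b := rsubmx mu.
set d := lsubmx de; set v := rsubmx de.
pose Ev (w : E * E) := (gs (2 *: (vec w.1 - a)) * gs (vec w.2 - d))%:C%C *
  expi (dotn v (vec w.1) + dotn b (vec w.2)).
have m1 : vmeas (fun w : E * E => vec w.1) by exact: vmeas_vec.
have m2 : vmeas (fun w : E * E => vec w.2) by exact: vmeas_vec.
have mEv : cM Ev.
  apply: cMM.
    apply: cMC; apply: measurable_funM; apply: measurable_gs.
      by apply: vmeasZ; apply: vmeasB => //; exact: vmeas_cst.
    by apply: vmeasB => //; exact: vmeas_cst.
  apply: cM_expi; apply: measurable_funD; apply: measurable_dotn => //;
    exact: vmeas_cst.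
have Ev_le X Y : cabs (Ev (X, Y)) <= gs (2 *: (vec X - a)) * gs (vec Y - d).
  by rewrite /Ev cabsM cabs_expi mulr1 cabsC ger0_norm// mulr_ge0 ?gs_ge0.
have [c1m c2m] := (coh_testlike z, coh_testlike (z + de)).
have mpi := cM_partial_ift mW0.
have -> : sesq K (coh z) (coh (z + de)) =
    cI (pmeas l l) (fun w => Ev w * partial_ift W0 w).
  have mG := cL1_cM (cL1_sesq mK iW mW0 rW0 eW0 c1m c2m).
  rewrite /sesq -(mpres_cI (mpres_wigner R n) mG); apply: ae_eq_cI.
  - exact: (cM_comp (mpres_wigner R n).1 mG).
  - exact: cMM.
  - apply: filterS (ae_centered mK iW mW0 rW0 eW0) => w /= <-.
    by rewrite !unvecK mulrAC; congr (_ * _); exact: coh_prod.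
have gL1 c (u : 'rV[R]_n) : 0 < c -> rL1 l (fun x => gs (c *: (vec x - u))).
  exact: rL1_gs_affine.
have g1L1 (u : 'rV[R]_n) : rL1 l (fun x => gs (vec x - u)).
  by have := gL1 1 u ltr01; apply: eq_integrable => // x _; rewrite scale1r.
have iC : cL1 (pmeas l l) (fun w => Ev w * partial_ift W0 w).
  have [M HM] := partial_ift_le mW0 rW0.
  have two0 : (0 : R) < 2 by [].
  apply: (cL1_prod_le _ (rL1Z M (gL1 2 a two0)) (g1L1 d)) => [|X Y].
    exact: cMM.
  rewrite cabsM mulrC -mulrA; apply: ler_pM; rewrite ?cabs_ge0//.
pose H (w : (E * E) * E) := Ev (w.1.1, w.2) *
  (W0 (row_mx (vec w.1.1) (vec w.1.2)) * expi (- dotn (vec w.1.2) (vec w.2))).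
have mH : cM H.
  have f11 : measurable_fun setT (fun w : (E * E) * E => w.1.1).
    exact: (measurableT_comp measurable_fst).
  have f12 : measurable_fun setT (fun w : (E * E) * E => w.1.2).
    exact: (measurableT_comp measurable_snd).
  have v12 : vmeas (fun w : (E * E) * E => vec w.1.2) by exact: vmeas_vec.
  have v11 : vmeas (fun w : (E * E) * E => vec w.1.1) by exact: vmeas_vec.
  apply: cMM.
    by apply: (cM_comp _ mEv); exact: measurable_fun_pair.
  apply: cMM; first exact: cM_W0.
  apply: cM_expi; apply: measurable_funN; apply: measurable_dotn => //.
  exact: vmeas_vec.
have H_le w y : cabs (H (w, y)) <=
    cabs (W0 (row_mx (vec w.1) (vec w.2))) * gs (vec y - d).
  rewrite /H /= cabsM mulrC cabsM cabs_expi mulr1 ler_wpM2l ?cabs_ge0//.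
  apply: le_trans (Ev_le _ _) _.
  by rewrite ler_piMl ?gs_ge0 ?gs_le1.
have iH : cL1 (pmeas (pmeas l l) l) H by exact: (cL1_prod_le mH rL1_W0 (g1L1 d) H_le).
have iHy y : cL1 (pmeas l l) (fun w => H (w, y)).
  apply: (cL1_le _ rL1_W0) => [|w].
    by apply: (cM_comp _ mH); exact: measurable_fun_pair.
  by apply: le_trans (H_le _ _) _; rewrite ler_piMr ?cabs_ge0 ?gs_le1.
have -> : cI (pmeas l l) (fun w => Ev w * partial_ift W0 w) =
    cI (pmeas (pmeas l l) l) H.
  rewrite cFub2// [RHS]cFub2//; apply: eq_cI => y.
  rewrite [RHS]cFub1//; apply: eq_cI => x; rewrite /H /= cIZ//.
  have := cL1_bdM (M := 1) (f := fun p : E => expi (- dotn (vec p) (vec y))) _ _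
    (cL1_W0_row mW0 rW0 (vec x)).
  move=> /(_ _ _)/eq_cL1; apply => [p||p]; first by rewrite mulrC.
    apply: cM_expi; apply: measurable_funN.
    by apply: measurable_dotn; [exact: vmeas_vec|exact: vmeas_cst].
  by rewrite cabs_expi.
rewrite cFub1// /smeared.
have mS := cM_smeared_integrand de mu.
have iS : cintegrable (fun z => W0 z * (gs2 (z - mu))%:C%C * expi (symp de z)).
  apply: (cL1_le mS (cL1_cabs (rapid_cL1 mW0 rW0))) => w.
  rewrite !cabsM cabs_expi mulr1 cabsC ger0_norm ?mulr_ge0 ?gs_ge0//.
  by rewrite ler_piMr ?cabs_ge0// mulr_ile1 ?gs_ge0 ?gs_le1.
rewrite -[RHS]cIZ; last exact: iS.
have iS' := cL1Z (C0 * expi (dotn b d)) iS.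
rewrite -(mpres_cI (mpres_unsplit R n n) (cL1_cM iS')).
apply: eq_cI => -[X p]; rewrite /H /= unvecK.
transitivity (W0 (row_mx (vec X) (vec p)) * (gs (2 *: (vec X - a)))%:C%C *
    expi (dotn v (vec X)) *
    cI l (fun y => (gs (vec y - d))%:C%C * expi (dotn (b - vec p) (vec y)))).
  rewrite -cIZ.
    apply: eq_cI => y; rewrite /Ev /= dotnDl dotnNl !expiD rmorphM /=; ring.
  apply: (cL1_le _ (g1L1 d)) => [|y].
    apply: cMM.
      apply: cMC; apply: measurable_gs; apply: vmeasB; first exact: vmeas_vec.
      exact: vmeas_cst.
    by apply: cM_expi; apply: measurable_dotn; [exact: vmeas_cst|exact: vmeas_vec].
  by rewrite cabsM cabs_expi mulr1 cabsC ger0_norm ?gs_ge0.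
rewrite gs_fourier_translate /gs2 /symp !linearB /= row_mxKl row_mxKr.
rewrite -(gsN (b - vec p)) opprB -/a -/b -/d -/v dotnDl dotnNl !expiD (dotnC d).
by rewrite !rmorphM /=; ring.
Qed.

End CoherentStates.

(** * The Gaussian window on phase space *)

Section PhaseSpaceGaussian.
Variables (R : realType) (n : nat).
Local Notation phase := 'rV[R]_(n + n).

Lemma gs2_ge0 (z : phase) : 0 <= gs2 z.
Proof. by rewrite mulr_ge0 ?gs_ge0. Qed.

Lemma gs2N (z : phase) : gs2 (- z) = gs2 z.
Proof. by rewrite /gs2 !linearN /= !gsN. Qed.

Lemma wt_lrsub (z : phase) : wt z = wt (lsubmx z) * wt (rsubmx z).
Proof. by rewrite -wt_row hsubmxK. Qed.

Lemma wt_scale_le k (c : R) (v : 'rV[R]_k) : 1 <= c -> wt v <= wt (c *: v).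
Proof.
move=> c1; apply: ler_prod => i _; rewrite (ltW (wt1_gt0 _)) /= mxE exprMn.
by rewrite lerD2l ler_peMl ?sqr_ge0// exprn_ege1.
Qed.

Lemma gs2_wt N : exists2 C, 0 < C & forall z : phase, gs2 z <= C / wt z ^+ N.
Proof.
have [C C0 HC] := gs_wt R n N; exists (C * C) => [|z]; first exact: mulr_gt0.
rewrite wt_lrsub exprMn invfM mulrACA; apply: ler_pM; rewrite ?gs_ge0//.
apply: le_trans (HC _) _; rewrite ler_pM2l//.
rewrite lef_pV2 ?posrE ?wtX_gt0//; apply: lerXn2r; rewrite ?nnegrE ?wt_ge0//.
by apply: wt_scale_le; rewrite ler1n.
Qed.

Lemma measurable_gs2 d (T : measurableType d) (f : T -> phase) : vmeas f ->
  measurable_fun setT (fun t => gs2 (f t)).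
Proof.
move=> mf; apply: measurable_funM; apply: measurable_gs.
  by apply: vmeasZ; exact: vmeas_lsub.
exact: vmeas_rsub.
Qed.

Lemma rL1_gs2 : rL1 (lebn R (n + n)) (fun z => gs2 (vec z)).
Proof.
have [C C0 HC] := gs2_wt 1.
apply: (rL1_le _ (rL1Z C (@rL1_wt R (n + n)))) => [|x].
  by apply: measurable_gs2; exact: vmeas_vec.
by rewrite ger0_norm ?gs2_ge0// (le_trans (HC _)).
Qed.

Lemma gs2_integral_gt0 : 0 < Rintegral (lebn R (n + n)) setT (fun z => gs2 (vec z)).
Proof.
rewrite lt_def Rintegral_ge0 ?andbT; last by move=> x _; exact: gs2_ge0.
apply/negP => /eqP I0.
have z0 : {ae lebn R (n + n), forall x, gs2 (vec x) = 0}.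
  have m2 : measurable_fun setT (fun x : Rn R (n + n) => (gs2 (vec x))%:E).
    by apply/measurable_EFinP; apply: measurable_gs2; exact: vmeas_vec.
  have H0 : (\int[lebn R (n + n)]_x `|(gs2 (vec x))%:E| = 0)%E.
    rewrite -[RHS]/(0%:E) -I0 /Rintegral fineK//; last first.
      exact: (integrable_fin_num measurableT rL1_gs2).
    by apply: eq_integral => x _; rewrite gee0_abs// lee_fin gs2_ge0.
  have H := (ae_eq_integral_abs (lebn R (n + n)) measurableT m2).1 H0.
  by apply: filterS H => x /(_ I) [].
have [x] := ae_ex z0; apply/eqP.
by rewrite gt_eqF// mulr_gt0// gs_gt0.
Qed.

End PhaseSpaceGaussian.

(** * Rapid decay of the Fourier transform on phase space *)

Section CharacteristicFunction.
Variables (R : realType) (n : nat) (K : 'rV[R]_n -> 'rV[R]_n -> R[i]).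
Local Notation l2 := (lebn R (n + n)).
Local Notation phase := 'rV[R]_(n + n).
Hypothesis psdK : psd_kernel K.
Let mK : kmeasurable K := psdK.1.
Hypothesis iW : {ae lebn R (n + n), forall z : Rn R (n + n),
  cintegrable (wigner_integrand K (vec z))}.
Variable W0 : 'rV[R]_(n + n) -> R[i].
Hypothesis mW0 : cmeasurable W0.
Hypothesis rW0 : rapid W0.
Hypothesis eW0 : {ae lebn R (n + n), forall z : Rn R (n + n),
  wigner K (vec z) = W0 (vec z)}.

Let I1 : R := Rintegral l2 setT (fun x => (wt (vec x))^-1).

Let I1_ge0 : 0 <= I1.
Proof. by apply: Rintegral_ge0 => x _; rewrite invr_ge0 wt_ge0. Qed.

Let mwV : measurable_fun setT (fun x : Rn R (n + n) => (wt (vec x))^-1).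
Proof. exact: rL1_meas (@rL1_wt R (n + n)). Qed.

(** Of the [N + 1] powers of decay of the window, [N] combine with those of [W0] by Peetre into
    decay at [mu]; the last one keeps the integral finite, uniformly in [mu]. *)
Lemma smeared_le N : exists2 C, 0 < C & forall de mu : phase,
  cabs (smeared W0 de mu) <= C / wt mu ^+ N.
Proof.
have [C1 C10 H1] := rW0 N; have [C2 C20 H2] := gs2_wt R n N.+1.
pose M := (2 ^+ (n + n)) ^+ N : R.
have M0 : 0 < M by rewrite !exprn_gt0.
exists (C1 * C2 * M * (I1 + 1)) => [|de mu].
  by rewrite !mulr_gt0// ltr_pwDr.
pose B := C1 * C2 * M / wt mu ^+ N.
have B0 : 0 < B by rewrite divr_gt0 ?wtX_gt0// !mulr_gt0.
have iw : rL1 l2 (fun x => (wt (vec x + - mu))^-1).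
  exact: (rL1_translate (h := fun v => (wt v)^-1) _ (@rL1_wt R (n + n))).
apply: (@le_trans _ _ (Rintegral l2 setT (fun x => B * (wt (vec x + - mu))^-1))).
  apply: cabs_cI_le; first exact: cM_smeared_integrand.
    exact: rL1Z.
  move=> x; rewrite !cabsM cabs_expi mulr1 cabsC ger0_norm ?gs2_ge0//.
  apply: (@le_trans _ _ (C1 / wt (vec x) ^+ N * (C2 / wt (vec x - mu) ^+ N.+1))).
    by apply: ler_pM; rewrite ?cabs_ge0 ?gs2_ge0.
  have := wt_peetreV N (vec x) (- (vec x - mu)).
  rewrite wtN opprB subrKC -/M => HP.
  have -> : C1 / wt (vec x) ^+ N * (C2 / wt (vec x - mu) ^+ N.+1) =
     C1 * C2 * ((wt (vec x) ^+ N)^-1 * (wt (vec x - mu) ^+ N)^-1) *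
       (wt (vec x - mu))^-1.
    by rewrite exprSr invfM; ring.
  rewrite ler_wpM2r ?invr_ge0 ?wt_ge0// /B -!mulrA mulrA [leRHS]mulrA.
  by rewrite ler_wpM2l// mulr_ge0 ?ltW.
rewrite RintegralZl// (rI_translate (h := fun v => (wt v)^-1) (- mu) mwV) -/I1.
rewrite /B -!mulrA !ler_pM2l// [leRHS]mulrC ler_pM2l ?invr_gt0 ?wtX_gt0//.
by rewrite lerDl.
Qed.

Let c0n : 0 < @c0 R ^+ n. Proof. by rewrite exprn_gt0 ?c0_gt0. Qed.

Lemma sesq_coh_diag_le N : exists2 C, 0 < C & forall z : phase,
  cre (sesq K (coh z) (coh z)) <= C / wt z ^+ N.
Proof.
have [C C1 HC] := smeared_le N.
exists (@c0 R ^+ n * C) => [|z]; first exact: mulr_gt0.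
apply: le_trans (ler_norm _) _; apply: le_trans (cre_le _) _.
have := sesq_coh mK iW mW0 rW0 eW0 z 0; rewrite scaler0 !addr0 => ->.
rewrite !cabsM cabs_expi mulr1 cabsC (ger0_norm (ltW c0n)) -mulrA.
by rewrite ler_pM2l.
Qed.

(* The Cauchy-Schwarz inequality bounds [<coh z, rho coh (z + de)>] by the diagonal
   values at [z] and [z + de], and one of the two points is at distance at least
   [|de| / 2] from the origin. *)
Lemma smeared_shift_le N : exists2 C, 0 < C & forall de z : phase,
  cabs (smeared W0 de (z + 2^-1 *: de)) <= C / wt de ^+ N * (wt z)^-1.
Proof.
(* Cauchy-Schwarz costs a square root, leaving [N + 1] powers at [z] and at [z + de]. Peetre turns
   [N] of each into decay in [de]; the extra one at [z] serves to integrate over [z], the one at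
   [z + de] is dropped. *)
have [C C1 HC] := sesq_coh_diag_le (N.+1 * 2).
pose M := (2 ^+ (n + n)) ^+ N : R.
have M0 : 0 < M by rewrite !exprn_gt0.
exists ((@c0 R ^+ n)^-1 * (C * M)) => [|de z].
  by rewrite !mulr_gt0// invr_gt0.
have CS := sesq_CS mK iW mW0 rW0 eW0 psdK (coh_testlike z) (coh_testlike (z + de)).
have sq : cabs (sesq K (coh z) (coh (z + de))) <=
    C * ((wt z ^+ N.+1)^-1 * (wt (z + de) ^+ N.+1)^-1).
  have r0 : 0 <= C * ((wt z ^+ N.+1)^-1 * (wt (z + de) ^+ N.+1)^-1).
    by rewrite !mulr_ge0 ?wtVX_ge0 ?ltW.
  rewrite -ler_sqr ?nnegrE ?cabs_ge0//; apply: le_trans CS _.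
  have p1 : 0 <= cre (sesq K (coh z) (coh z)).
    by have [] := ge0_cplx (sesq_ge0 mK iW mW0 rW0 eW0 psdK (coh_testlike z)).
  have p2 : 0 <= cre (sesq K (coh (z + de)) (coh (z + de))).
    by have [] := ge0_cplx (sesq_ge0 mK iW mW0 rW0 eW0 psdK (coh_testlike (z + de))).
  apply: le_trans (ler_pM p1 p2 (HC _) (HC _)) _.
  by rewrite le_eqVlt; apply/orP; left; apply/eqP; rewrite !exprM -!exprVn; ring.
have HP := wt_peetreV N (- z) (z + de).
rewrite wtN addrA addNr add0r -/M in HP.
move: sq; rewrite (sesq_coh mK iW mW0 rW0 eW0) !cabsM cabs_expi mulr1 cabsC.
rewrite (ger0_norm (ltW c0n)) mulrC -ler_pdivlMr// => sq; apply: le_trans sq _.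
rewrite [leLHS]mulrC -!mulrA ler_pM2l ?invr_gt0// ler_pM2l//.
apply: (@le_trans _ _ (((wt z ^+ N)^-1 * (wt (z + de) ^+ N)^-1) * (wt z)^-1)).
  have -> : (wt z ^+ N.+1)^-1 * (wt (z + de) ^+ N.+1)^-1 =
     ((wt z ^+ N)^-1 * (wt (z + de) ^+ N)^-1 * (wt z)^-1) * (wt (z + de))^-1.
    by rewrite !exprSr !invfM; ring.
  rewrite ler_piMr ?invf_le1 ?wt_gt0 ?wt_ge1//.
  by rewrite !mulr_ge0 ?wtVX_ge0// invr_ge0 wt_ge0.
by rewrite mulrA ler_wpM2r// invr_ge0 wt_ge0.
Qed.

Let kappa : R := Rintegral l2 setT (fun z => gs2 (vec z)).

(** As [z] varies the window sweeps all of phase space, so Fubini replaces it by its total mass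
    [kappa] and only the phase remains. *)
Lemma smeared_integral (de : phase) :
  cL1 l2 (fun z => smeared W0 de (vec z + 2^-1 *: de)) /\
  cI l2 (fun z => smeared W0 de (vec z + 2^-1 *: de)) =
  kappa%:C%C * cint (fun z => W0 z * expi (symp de z)).
Proof.
pose H (w : Rn R (n + n) * Rn R (n + n)) := W0 (vec w.2) *
  (gs2 (vec w.2 - (vec w.1 + 2^-1 *: de)))%:C%C * expi (symp de (vec w.2)).
have mom (T : measurableType _) (f : T -> phase) : vmeas f ->
    cM (fun t => expi (symp de (f t))).
  move=> mf; apply: cM_expi; apply: measurable_funB; apply: measurable_dotn;
    try exact: vmeas_cst.
    exact: vmeas_lsub.
  exact: vmeas_rsub.
have v1 : vmeas (fun w : Rn R (n + n) * Rn R (n + n) => vec w.1) by exact: vmeas_vec.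
have v2 : vmeas (fun w : Rn R (n + n) * Rn R (n + n) => vec w.2) by exact: vmeas_vec.
have mH : cM H.
  apply: cMM; last exact: mom.
  apply: cMM; first exact: (vmeas_cM v2 mW0).
  apply: cMC; apply: measurable_gs2; apply: vmeasB => //.
  by apply: vmeasD => //; exact: vmeas_cst.
(* One power from [W0] joins that of the window, by Peetre, to give decay in [x]; the other gives
   decay in [z]. *)
have [C1 C10 H1] := rW0 2; have [C2 C20 H2] := gs2_wt R n 1.
have iw : rL1 l2 (fun x => (wt (vec x + 2^-1 *: de))^-1).
  exact: (rL1_translate (h := fun v => (wt v)^-1) _ (@rL1_wt R (n + n))).
have iH : cL1 (pmeas l2 l2) H.
  apply: (cL1_prod_le mH (rL1Z (C1 * C2 * 2 ^+ (n + n)) iw) (@rL1_wt R (n + n))) => x z.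
  rewrite /H /= !cabsM cabs_expi mulr1 cabsC ger0_norm ?gs2_ge0//.
  set mu := vec x + 2^-1 *: de.
  apply: (@le_trans _ _ (C1 / wt (vec z) ^+ 2 * (C2 / wt (vec z - mu) ^+ 1))).
    by apply: ler_pM; rewrite ?cabs_ge0 ?gs2_ge0.
  have := wt_peetreV 1 (vec z) (- (vec z - mu)).
  rewrite wtN opprB subrKC !expr1 => HP.
  have -> : C1 / wt (vec z) ^+ 2 * (C2 / wt (vec z - mu)) =
     C1 * C2 * ((wt (vec z))^-1 * (wt (vec z - mu))^-1) * (wt (vec z))^-1.
    by rewrite expr2 invfM; ring.
  rewrite ler_wpM2r ?invr_ge0 ?wt_ge0//.
  by rewrite -[leRHS]mulrA ler_wpM2l// mulr_ge0 ?ltW.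
split; first exact: (cL1_fub1 iH).
transitivity (cI l2 (fun x => cI l2 (fun z => H (x, z)))); first by [].
rewrite -cFub1// cFub2//.
have iW0 : cL1 l2 (fun z => W0 (vec z) * expi (symp de (vec z))).
  apply: (cL1_le _ (cL1_cabs (rapid_cL1 mW0 rW0))) => [|z].
    by apply: cMM; [exact: mW0|apply: mom; exact: vmeas_vec].
  by rewrite cabsM cabs_expi mulr1.
rewrite -cIZ//; apply: eq_cI => z; rewrite /H /=.
have flip (x : Rn R (n + n)) : gs2 (vec x + (2^-1 *: de - vec z)) =
    gs2 (vec z - (vec x + 2^-1 *: de)).
  by rewrite -[RHS]gs2N; congr gs2; apply/rowP => i; rewrite !mxE; ring.
have -> : kappa = Rintegral l2 setT (fun x => gs2 (vec z - (vec x + 2^-1 *: de))).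
  rewrite /kappa -(rI_translate (h := @gs2 R n) (2^-1 *: de - vec z)); last first.
    by apply: measurable_gs2; exact: vmeas_vec.
  by apply: eq_Rintegral => x _; rewrite flip.
rewrite -cIC mulrC -cIZ.
  by apply: eq_cI => x; ring.
apply: cL1C.
have := rL1_translate (h := @gs2 R n) (2^-1 *: de - vec z) (@rL1_gs2 R n).
by apply: eq_integrable => // x _; rewrite flip.
Qed.

Theorem rapid_ft : rapid (ft W0).
Proof.
move=> N; have [C C1 HC] := smeared_shift_le N.
have k0 : 0 < kappa by exact: gs2_integral_gt0.
exists (C * (I1 + 1) / kappa) => [|q].
  by rewrite divr_gt0 ?mulr_gt0// ltr_pwDr.
(* Rotating [q] by the symplectic matrix turns the symplectic pairing into the dot product and
   preserves [wt]. *)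
pose de : phase := row_mx (- rsubmx q) (lsubmx q).
have wde : wt de = wt q by rewrite wt_row wtN mulrC -wt_lrsub.
have sympE z : symp de z = dotn q z.
  rewrite -(hsubmxK q) -(hsubmxK z) dotn_row /symp /de !row_mxKl !row_mxKr.
  by rewrite dotnNl opprK.
have -> : ft W0 q = cint (fun z => W0 z * expi (symp de z)).
  by apply: eq_cI => z; rewrite sympE mulrC.
rewrite mulrAC ler_pdivlMr// mulrC.
have [iS eS] := smeared_integral de.
rewrite -[X in X * _](ger0_norm (ltW k0)) -cabsC -cabsM -eS.
apply: (@le_trans _ _ (Rintegral l2 setT (fun z => C / wt de ^+ N * (wt (vec z))^-1))).
  apply: cabs_cI_le; first exact: (cL1_cM iS).
    exact: (rL1Z _ (@rL1_wt R (n + n))).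
  by move=> x; exact: HC.
rewrite RintegralZl//; last exact: (@rL1_wt R (n + n)).
rewrite -/I1 wde mulrAC ler_wpM2r ?wtVX_ge0// ler_pM2l//.
by rewrite lerDl.
Qed.

End CharacteristicFunction.

(** * Smoothness and decay of the derivatives *)

Section Taylor.
Variable R : realType.

Lemma mvt_le (f f' : R -> R) (M t : R) : (forall x, is_derive x (1 : R) f (f' x)) ->
  (forall x, `|x| <= `|t| -> `|f' x| <= M) -> `|f t - f 0| <= M * `|t|.
Proof.
move=> df bf.
have cf : continuous f := is_derive_continuous df.
have [t0|/ltW t0] := leP 0 t.
  have [c + ->] := MVT_segment t0 (fun x _ => df x) (continuous_subspaceT cf).
  rewrite in_itv /= => /andP[c0 ct]; rewrite subr0 normrM ler_wpM2r//.
  by apply: bf; rewrite !ger0_norm.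
have [c + e] := MVT_segment t0 (fun x _ => df x) (continuous_subspaceT cf).
rewrite in_itv /= => /andP[tc c0]; rewrite distrC e sub0r normrM normrN ler_wpM2r//.
by apply: bf; rewrite !ler0_norm// lerN2.
Qed.

(** The mean value theorem, applied twice to each part, bounds the real and the imaginary remainder
    by [t ^+ 2] each. *)
Lemma expi_taylor (t : R) :
  cabs (expi t - 1 - (0 +i* t)%C) <= 2 * t ^+ 2.
Proof.
have sin_le (x : R) : `|sin x| <= `|x|.
  have := @mvt_le sin cos 1 x (@is_derive_sin R); rewrite sin0 subr0 mul1r.
  by apply => y _; rewrite ler_norml cos_geN1 cos_le1.
have cos_le (x : R) : `|cos x - 1| <= `|x|.
  have := @mvt_le cos (fun x => - sin x) 1 x (@is_derive_cos R).
  rewrite cos0 mul1r; apply => y _.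
  by rewrite normrN ler_norml sin_geN1 sin_le1.
have c2 : `|cos t - 1| <= t ^+ 2.
  rewrite -(real_normK (num_real t)) expr2 -cos0.
  by apply: (mvt_le (@is_derive_cos R)) => x xt; rewrite normrN (le_trans (sin_le x)).
have s2 : `|sin t - t| <= t ^+ 2.
  have d x : is_derive x (1 : R) (fun x => sin x - x) (cos x - 1).
    exact: is_deriveB.
  have := mvt_le (t := t) (M := `|t|) d.
  rewrite sin0 !subr0 -expr2 real_normK ?num_real//.
  by apply => x xt; rewrite (le_trans (cos_le x)).
apply: le_trans (cabs_le_reim _) _.
have -> : cre (expi t - 1 - (0 +i* t)%C) = cos t - 1.
  by transitivity (cos t - 1 - 0 : R); last exact: subr0.
have -> : cim (expi t - 1 - (0 +i* t)%C) = sin t - t.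
  by transitivity (sin t - 0 - t : R); last by rewrite subr0.
by rewrite mulrDl mul1r lerD.
Qed.

End Taylor.

(** * Derivatives read off from difference quotients *)

Section Derivatives.
Variables (R : realType) (m : nat).
Local Notation l := (lebn R m).
Local Notation V := 'rV[R]_m.

Lemma derive_quadratic (f : V -> R) (z v : V) (L A : R) :
  (forall h : R, `|f (h *: v + z) - f z - h * L| <= A * h ^+ 2) ->
  derivable f z v /\ 'D_v f z = L.
Proof.
move=> H.
have A0 : 0 <= A by have := le_trans (normr_ge0 _) (H 1); rewrite expr1n mulr1.
have cv : (fun h => h^-1 *: (f (h *: v + z) - f z)) @ 0^' --> L.
  apply/cvgrPdist_le => e e0; near=> h.
  have h0 : h != 0 by near: h; exact: nbhs_dnbhs_neq.
  have -> : L - h^-1 *: (f (h *: v + z) - f z) =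
      - (h^-1 * (f (h *: v + z) - f z - h * L)).
    by rewrite /GRing.scale /=; field.
  rewrite normrN normrM; apply: (@le_trans _ _ (`|h^-1| * (A * h ^+ 2))).
    by rewrite ler_wpM2l.
  rewrite -(real_normK (num_real h)) normfV.
  have -> : `|h|^-1 * (A * `|h| ^+ 2) = A * `|h| by field; rewrite normr_eq0.
  apply: (@le_trans _ _ ((A + 1) * `|h|)); first by rewrite ler_wpM2r// lerDl.
  rewrite mulrC -ler_pdivlMr ?ltr_wpDl//.
  near: h; apply: dnbhs0_le; rewrite divr_gt0// ltr_wpDl//.
split; first by apply/cvg_ex; exists L.
exact: cvg_lim cv.
Unshelve. all: end_near. Qed.

(* A rapidly decaying function with a bounded second difference quotient has a
   rapidly decaying derivative: take the increment [h = wt z ^- N]. *)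
Lemma rapid_difference (g g' : V -> R[i]) (i : 'I_m) (A : R) : rapid g ->
  (forall z (h : R), cabs (g (z + h *: ei R i) - g z - h%:C%C * g' z) <= A * h ^+ 2) ->
  rapid g'.
Proof.
(* With twice the exponent both values of [g] are of order [h ^+ 2], like the remainder, so division
   by [h] leaves the order [h = wt z ^- N]. *)
move=> rg H N; have [C C0 HC] := rg (N * 2)%N.
have A0 : 0 <= A by have := le_trans (cabs_ge0 _) (H 0 1); rewrite expr1n mulr1.
pose M := ((2 ^+ m) ^+ (N * 2) : R).
have M0 : 0 < M by rewrite !exprn_gt0.
exists (C * (M * M) + C + A) => [|z].
  by rewrite ltr_wpDr// addr_gt0// !mulr_gt0.
pose h := (wt z ^+ N)^-1.
have h0 : 0 < h by rewrite invr_gt0 wtX_gt0.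
have h1 : h <= 1 by exact: wtVX_le1.
have hh : (wt z ^+ (N * 2))^-1 = h ^+ 2 by rewrite exprM -exprVn.
(* As [h <= 1] the increment has bounded weight, so by Peetre the weights at [z] and at
   [z + h *: ei R i] are comparable. *)
have wh : wt (h *: ei R i) <= 2 ^+ m.
  rewrite -[X in 2 ^+ X](card_ord m) -prodr_const; apply: ler_prod => j _.
  rewrite (ltW (wt1_gt0 _)) /= !mxE eqxx /=.
  have : (h * (j == i)%:R) ^+ 2 <= 1; last by lra.
  rewrite exprn_ile1 ?mulr_ge0 ?(ltW h0)//.
  by rewrite mulr_ile1 ?(ltW h0)// lern1 leq_b1.
have b1 : cabs (g (z + h *: ei R i)) <= C * (M * M) * h ^+ 2.
  apply: le_trans (HC _) _; rewrite -!mulrA ler_pM2l//.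
  have := wt_peetreV (N * 2) (z + h *: ei R i) (- (h *: ei R i)).
  rewrite addrK wtN -/M hh => HP.
  rewrite [leRHS]mulrCA.
  have whM : wt (h *: ei R i) ^+ (N * 2) <= M.
    by apply: lerXn2r; rewrite ?nnegrE ?wt_ge0// exprn_ge0.
  rewrite -ler_pdivrMl// mulrC; apply: le_trans HP.
  by rewrite ler_wpM2l ?wtVX_ge0// lef_pV2 ?posrE ?wtX_gt0.
have b2 : cabs (g z) <= C * h ^+ 2 by rewrite -hh HC.
rewrite -/h -(ler_pM2l h0) -[X in X * _](ger0_norm (ltW h0)) -cabsC -cabsM.
have -> : h%:C%C * g' z = g (z + h *: ei R i) - g z -
    (g (z + h *: ei R i) - g z - h%:C%C * g' z) by ring.
apply: le_trans (cabsB _ _) _.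
apply: le_trans (lerD (cabsB _ _) (H z h)) _.
apply: le_trans (lerD (lerD b1 b2) (lexx _)) _.
by rewrite le_eqVlt; apply/orP; left; apply/eqP; ring.
Qed.

Definition synth (q : V -> R[i]) (z : V) : R[i] :=
  cint (fun p => q p * expi (- dotn p z)).

(** The multiplier [- i p_i], which is the [i]-th partial derivative seen through the kernel
    [expi (- dotn p z)]. *)
Definition dmul (i : 'I_m) (q : V -> R[i]) (p : V) : R[i] :=
  (0 +i* (- p 0 i))%C * q p.

Lemma sqr_le_wt (p : V) i : p 0 i ^+ 2 <= wt p.
Proof.
rewrite /wt (bigD1 i)//=; apply: (@le_trans _ _ (1 + p 0 i ^+ 2)).
  by rewrite lerDr.
rewrite ler_peMr ?(ltW (wt1_gt0 _))//.
elim/big_rec: _ => // j y _ y1.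
by apply: (le_trans y1); rewrite ler_peMl ?wt1_ge1// (le_trans ler01).
Qed.

Lemma abs_le_wt (p : V) i : `|p 0 i| <= wt p.
Proof.
have w1 := wt_ge1 p; have := sqr_le_wt p i.
by rewrite -(real_normK (num_real (p 0 i))); nra.
Qed.

Lemma cabs_im (t : R) : cabs (0 +i* t)%C = `|t|.
Proof. by rewrite /cabs /= expr0n add0r sqrtr_sqr. Qed.

Lemma dmul_cM i q : cmeasurable q -> cmeasurable (dmul i q).
Proof.
move=> mq; apply: cMM => //; split; first exact: measurable_cst.
by apply: measurable_funN; exact: vmeas_vec1.
Qed.

Lemma dmul_rapid i q : rapid q -> rapid (dmul i q).
Proof.
move=> rq N; have [C C0 HC] := rq N.+1; exists C => // p.
rewrite cabsM cabs_im normrN.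
apply: le_trans (ler_pM _ _ (abs_le_wt p i) (HC p)) _; rewrite ?cabs_ge0//.
rewrite exprS invfM; rewrite mulrCA [wt p * _]mulrA mulfV ?mul1r//.
by rewrite gt_eqF ?wt_gt0.
Qed.

Lemma synth_cL1 q (z : V) : cmeasurable q -> rapid q ->
  cL1 l (fun p => q (vec p) * expi (- dotn (vec p) z)).
Proof.
move=> mq rq; have := @cL1_bdM _ _ _ l (fun p => expi (- dotn (vec p) z)) _ 1 _ _
   (rapid_cL1 mq rq).
move=> H; apply: eq_cL1 (H _ _) => [p||p]; first by rewrite mulrC.
  apply: cM_expi; apply: measurable_funN.
  by apply: measurable_dotn; [exact: vmeas_vec|exact: vmeas_cst].
by rewrite cabs_expi.
Qed.

(** This uniform estimate serves twice: [derive_quadratic] reads the derivative off it,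
    [rapid_difference] the decay of that derivative. Of two powers of decay of [q], one absorbs the
    [p_i^2] of the Taylor remainder and the other makes the bound integrable. *)
Lemma synth_difference i q : cmeasurable q -> rapid q ->
  exists A, forall z (h : R),
  cabs (synth q (z + h *: ei R i) - synth q z - h%:C%C * synth (dmul i q) z)
    <= A * h ^+ 2.
Proof.
move=> mq rq; have [C C0 HC] := rq 2.
exists (2 * C * Rintegral l setT (fun x => (wt (vec x))^-1)) => z h.
have i1 := synth_cL1 (z + h *: ei R i) mq rq.
have i2 := synth_cL1 z mq rq.
have i3 := synth_cL1 z (dmul_cM i mq) (dmul_rapid i rq).
rewrite /synth -[X in _ - _ - X]cIZ// -[X in X - _]cIB// -cIB//; last 2 first.
- by apply: cL1D => //; exact: cL1N.
- exact: cL1Z.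
rewrite mulrAC -RintegralZl//; last exact: (@rL1_wt R m).
apply: cabs_cI_le.
- apply: (cL1_cM (mu := l)); apply: cL1D; first by apply: cL1D => //; exact: cL1N.
  by apply: cL1N; exact: cL1Z.
- exact: (rL1Z _ (@rL1_wt R m)).
- move=> x; set p := vec x.
  have de : dotn p (ei R i) = p 0 i.
    rewrite /dotn (bigD1 i)//= big1 ?addr0 => [|j /negbTE ji].
      by rewrite !mxE !eqxx mulr1.
    by rewrite !mxE ji andbF mulr0.
  have -> : q p * expi (- dotn p (z + h *: ei R i)) - q p * expi (- dotn p z) -
      h%:C%C * (dmul i q p * expi (- dotn p z)) =
    q p * expi (- dotn p z) * (expi (- (h * p 0 i)) - 1 - (0 +i* (- (h * p 0 i)))%C).
    have -> : (0 +i* (- (h * p 0 i)))%C = h%:C%C * (0 +i* (- p 0 i))%C.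
      have r0 : (0 : R) = h * 0 - 0 * - p 0 i by ring.
      have i0 : - (h * p 0 i) = h * - p 0 i + 0 * 0 by ring.
      by apply: eq_cplx; [exact: r0|exact: i0].
    by rewrite dotnDr dotnZr de opprD expiD /dmul; ring.
  rewrite !cabsM cabs_expi mulr1.
  apply: le_trans (ler_pM _ _ (HC p) (expi_taylor _)) _; rewrite ?cabs_ge0//.
  rewrite sqrrN exprMn expr2 invfM.
  have wp := sqr_le_wt p i.
  have -> : C * ((wt p)^-1 * (wt p)^-1) * (2 * (h * h * p 0 i ^+ 2)) =
    2 * C * (h * h) * (wt p)^-1 * (p 0 i ^+ 2 / wt p) by ring.
  have q0 : 0 <= 2 * C * (h * h) * (wt p)^-1.
    apply: mulr_ge0; last by rewrite invr_ge0 wt_ge0.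
    by apply: mulr_ge0; [rewrite mulr_ge0 ?(ltW C0)|rewrite -expr2 sqr_ge0].
  have q1 : p 0 i ^+ 2 / wt p <= 1 by rewrite ler_pdivrMr ?wt_gt0// mul1r.
  by have := ler_wpM2l q0 q1; rewrite mulr1 -expr2.
Qed.

Lemma synth_derivative i q : cmeasurable q -> rapid q ->
  cderivable i (synth q) /\ cpartial i (synth q) = synth (dmul i q).
Proof.
move=> mq rq; have [A HA] := synth_difference i mq rq.
have Hr z (h : R) : `|cre (synth q (h *: ei R i + z)) - cre (synth q z) -
    h * cre (synth (dmul i q) z)| <= A * h ^+ 2.
  apply: le_trans (HA z h); rewrite [h *: _ + z]addrC.
  apply: le_trans (cre_le _); rewrite creD creN creM creC cimC mul0r subr0.
  by rewrite creD creN.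
have Hi z (h : R) : `|cim (synth q (h *: ei R i + z)) - cim (synth q z) -
    h * cim (synth (dmul i q) z)| <= A * h ^+ 2.
  apply: le_trans (HA z h); rewrite [h *: _ + z]addrC.
  apply: le_trans (cim_le _); rewrite cimD cimN cimM creC cimC mul0r addr0.
  by rewrite cimD cimN.
split.
  move=> z; have [d1 _] := derive_quadratic (f := fun w => cre (synth q w)) (Hr z).
  by have [d2 _] := derive_quadratic (f := fun w => cim (synth q w)) (Hi z).
apply/funext => z; apply: eq_cplx.
  by have [_ e] := derive_quadratic (f := fun w => cre (synth q w)) (Hr z).
by have [_ e] := derive_quadratic (f := fun w => cim (synth q w)) (Hi z).
Qed.

(** [ift f] is at every point the limit of Gaussian means of [f], and Peetre bounds these uniformly,
    since [eps k <= 1] gives [wt (eps k *: u) <= wt u]. Equality with a multiple of [f] would give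
    the bound only almost everywhere. *)
Lemma rapid_ift (f : V -> R[i]) : cmeasurable f -> rapid f ->
  cintegrable (ft f) -> rapid (ift f).
Proof.
move=> mf rf fti N.
have fi := rapid_cL1 mf rf.
have [C C1 HC] := rf N; have [C' C'1 HC'] := gs_wt R m N.+1.
pose M := ((2 ^+ m) ^+ N : R).
have M0 : 0 < M by rewrite !exprn_gt0.
pose I1 := Rintegral l setT (fun x => (wt (vec x))^-1).
have I10 : 0 <= I1 by apply: Rintegral_ge0 => x _; rewrite invr_ge0 wt_ge0.
have c0m : 0 < @c0 R ^+ m by rewrite exprn_gt0 ?c0_gt0.
exists (@c0 R ^+ m * (C * C' * M * (I1 + 1))) => [|y].
  by rewrite !mulr_gt0// ltr_pwDr.
apply: (ccvg_le (cvg_gauss_mean fi fti y)) => k.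
rewrite cabsM cabsC (ger0_norm (ltW c0m)) -[leRHS]mulrA ler_pM2l//.
pose B := C * C' * M / wt y ^+ N.
have B0 : 0 < B by rewrite divr_gt0 ?wtX_gt0// !mulr_gt0.
apply: (@le_trans _ _ (Rintegral l setT (fun x => B * (wt (vec x))^-1))).
  apply: cabs_cI_le.
  - apply: cMM.
      apply: (vmeas_cM _ mf); apply: vmeasD; first exact: vmeas_cst.
      by apply: vmeasZ; exact: vmeas_vec.
    by apply: cMC; apply: measurable_gs; exact: vmeas_vec.
  - exact: (rL1Z _ (@rL1_wt R m)).
  move=> x; set u := vec x; set e := eps R k.
  rewrite cabsM cabsC ger0_norm ?gs_ge0//.
  apply: le_trans (ler_pM _ _ (HC _) (HC' u)) _; rewrite ?cabs_ge0 ?gs_ge0//.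
  have we : wt (e *: u) <= wt u.
    apply: ler_prod => i _; rewrite (ltW (wt1_gt0 _)) /= mxE exprMn lerD2l.
    rewrite ler_piMl ?sqr_ge0// exprn_ile1 ?(ltW (eps_gt0 _ _))//.
    exact: eps_le1.
  have := wt_peetreV N (y + e *: u) (- (e *: u)); rewrite addrK wtN -/M => HP.
  have -> : C / wt (y + e *: u) ^+ N * (C' / wt u ^+ N.+1) =
      C * C' * ((wt (y + e *: u) ^+ N)^-1 * (wt u ^+ N)^-1) * (wt u)^-1.
    by rewrite exprSr invfM; ring.
  rewrite ler_wpM2r ?invr_ge0 ?wt_ge0// /B -[leRHS]mulrA ler_pM2l ?mulr_gt0//.
  apply: le_trans HP; rewrite ler_wpM2l ?wtVX_ge0//.
  rewrite lef_pV2 ?posrE ?wtX_gt0//; apply: lerXn2r; rewrite ?nnegrE ?wt_ge0//.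
rewrite RintegralZl//; last exact: (@rL1_wt R m).
rewrite -/I1 /B mulrAC ler_wpM2r ?wtVX_ge0// ler_wpM2l ?lerDl//.
by rewrite !mulr_ge0// ltW.
Qed.

Definition dmuls (s : seq 'I_m) (q : V -> R[i]) : V -> R[i] := foldr dmul q s.

Lemma dmuls_cM_rapid s q : cmeasurable q -> rapid q ->
  cmeasurable (dmuls s q) /\ rapid (dmuls s q).
Proof.
move=> mq rq; elim: s => [|i s [ms rs]] //=.
by split; [exact: dmul_cM|exact: dmul_rapid].
Qed.

Lemma cdiff_synth s q : cmeasurable q -> rapid q ->
  cdiff s (synth q) = synth (dmuls s q).
Proof.
move=> mq rq; elim: s => [//|i s IH] /=; rewrite -/(cdiff s _) IH.
have [ms rs] := dmuls_cM_rapid s mq rq.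
by have [_ ->] := synth_derivative i ms rs.
Qed.

(** Each derivative is again a [synth] of a rapidly decaying function, hence obeys
    [synth_difference]; induction on the number of derivatives passes decay from one to the next,
    starting from that of [synth q]. *)
Lemma schwartz_synth q : cmeasurable q -> rapid q -> rapid (synth q) ->
  schwartz (synth q).
Proof.
move=> mq rq rS; split=> [s i|a s].
  rewrite cdiff_synth//; have [ms rs] := dmuls_cM_rapid s mq rq.
  by have [] := synth_derivative i ms rs.
have rs : rapid (cdiff s (synth q)).
  elim: s => [//|i s IH] /=; rewrite -/(cdiff s _).
  have [ms rs] := dmuls_cM_rapid s mq rq.
  have [A HA] := synth_difference i ms rs.
  rewrite cdiff_synth// in IH *; have [_ ->] := synth_derivative i ms rs.
  exact: rapid_difference IH HA.
have [C C0 HC] := rs (\max_i a i)%N; exists C => z.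
rewrite cabsM cabsC; apply: le_trans (ler_pM _ _ (monom_wt a z) (HC z)) _.
- exact: normr_ge0.
- exact: cabs_ge0.
- by rewrite mulrCA mulfV ?mulr1// gt_eqF ?wtX_gt0.
Qed.

End Derivatives.

Unset Implicit Arguments.
Set Strict Implicit.

Theorem theorem1 (R : realType) (n : nat)
    (K : 'rV[R]_n -> 'rV[R]_n -> R[i]) :
  psd_kernel K ->
  {ae lebn R (n + n), forall z : Rn R (n + n),
     cintegrable (wigner_integrand K (vec z))} ->
  rapidly_decaying_ae (wigner K) ->
  exists F : 'rV[R]_(n + n) -> R[i],
    schwartz F /\
    {ae lebn R (n + n), forall z : Rn R (n + n), F (vec z) = wigner K (vec z)}.
Proof.
move=> psdK iW dW.
have mW := cM_wigner (proj1 psdK).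
have [W0 [mW0 rW0 eW0]] := rapid_version mW dW.
have rft := rapid_ft psdK iW mW0 rW0 eW0.
have iW0 := rapid_cL1 mW0 rW0.
have mft := cM_ft iW0.
have ift_int := rapid_cL1 mft rft.
(* The inversion constant in dimension [n + n], placed inside [synth] so that the result equals [W0]
   almost everywhere. *)
pose c : R[i] := (((2 * pi) ^+ (n + n))^-1)%:C%C.
have mq : cmeasurable (fun p => c * ft W0 p).
  by apply: cMM; [exact: cM_cst|exact: mft].
have rq : rapid (fun p => c * ft W0 p) by exact: rapid_scale.
have synthE z : synth (fun p => c * ft W0 p) z = c * ift W0 z.
  rewrite -[RHS]cIZ; last exact: synth_cL1.
  by apply: eq_cI => p; rewrite mulrA.
exists (synth (fun p => c * ft W0 p)); split.
  apply: schwartz_synth => // N.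
  have [C C0 HC] := rapid_scale c (rapid_ift mW0 rW0 ift_int) N.
  by exists C => // z; rewrite synthE.
apply: filterS2 eW0 (fourier_inversion iW0 ift_int) => z -> e.
rewrite synthE e mulrA -rmorphM /= mulVf ?mul1r//.
by rewrite expf_neq0// mulf_neq0// gt_eqF ?pi_gt0.
Qed.
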